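(* Let $E$ be a complex Banach space. Let $K\in L^1_{loc}([0,\infty))$ be Laplace transformable and suppose that there is $\beta\ge\mathrm{abs}(K)$ with $\tilde K(\lambda)\ne0$ for $\operatorname{Re}\lambda>\beta$. Let the closed linear operator $A$ on $E$ be the generator of an exponentially bounded, $K$-convoluted cosine function $(C_K(t))_{t\ge0}$. Suppose $M_p=p!^s$ for some $s\in(1,2)$. If there exist $k>0$ and $\overline C>0$, in the Beurling case, resp., if for every $k>0$ there exists an appropriate $\overline{C_k}>0$, in the Roumieu case, such that $$\frac1{|\tilde K(\lambda)|}=O\left(e^{M(k|\lambda|)}\right),\quad\operatorname{Re}\lambda\ge\overline C,\ \text{ resp., }\ \operatorname{Re}\lambda\ge\overline{C_k},$$ then there exist ultradistribution fundamental solutions of $(M_p)$-class (in the Beurling case), resp., of $\{M_p\}$-class (in the Roumieu case), for $iA$ and for $-iA$.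
   Context: $K$ is Laplace transformable if $\tilde K(\lambda)=\int_0^\infty e^{-\lambda t}K(t)dt$ exists on some right half-plane; $\mathrm{abs}(K)=\inf\{\operatorname{Re}\lambda:\tilde K(\lambda)\text{ exists}\}$. $M(\rho)=\sup_p\ln(\rho^p/M_p)$ for $\rho>0$, $M(0)=0$. With $\Theta(t)=\int_0^tK(s)ds$, $A$ is the generator of a $K$-convoluted cosine function $(C_K(t))_{t\ge0}\subset L(E)$ if the family is strongly continuous, $C_K(t)A\subset AC_K(t)$, and for all $x\in E$, $t\ge0$: $\int_0^t(t-s)C_K(s)x\,ds\in D(A)$ and $A\int_0^t(t-s)C_K(s)x\,ds=C_K(t)x-\Theta(t)x$. It is exponentially bounded if $\|C_K(t)\|\le M'e^{\omega t}$, $t\ge 0$, for some $M'>0$, $\omega\in\mathbb R$. An ultradistribution fundamental solution of $(M_p)$-class (Beurling), resp. $\{M_p\}$-class (Roumieu), for a closed operator $B$ on $E$ is an $L(E,[D(B)])$-valued ultradistribution $G$ of that class (in Komatsu's sense), supported in $[0,\infty)$, with $(\delta'\otimes I-\delta\otimes B)*G=\delta\otimes I_E$ and $G*(\delta'\otimes I-\delta\otimes B)=\delta\otimes I_{[D(B)]}$ ($[D(B)]$ is $D(B)$ with the graph norm). Equivalently: with $\Omega^{M_p}_{k,c}=\{\lambda\in\mathbb C:\operatorname{Re}\lambda\ge M(k|\lambda|)+c\}$, for some $k,c>0$ (Beurling), resp. for every $k>0$ and some corresponding $c=c_k>0$ (Roumieu), one has $\Omega^{M_p}_{k,c}\subset\rho(B)$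 and $\|(\lambda-B)^{-1}\|\le ce^{M(k|\lambda|)}$ for all $\lambda\in\Omega^{M_p}_{k,c}$. *)

(* Defs.v *)
From mathcomp Require Import all_boot all_order all_algebra.
From mathcomp Require Import all_classical all_reals all_analysis.
From mathcomp Require Import Rstruct Rstruct_topology.
From Stdlib Require Import Reals.
From Coquelicot Require Import Coquelicot.

Set Implicit Arguments.
Unset Strict Implicit.
Unset Printing Implicit Defensive.

Open Scope R_scope.

(** Vector-valued objects live in a Coquelicot [CompleteNormedModule C_AbsRing]
    (a complex Banach space). The scalar kernel [K] is only locally integrable,
    so its integrals are the Lebesgue integrals of MathComp-Analysis,
    instantiated at the real numbers of Stdlib. *)

(** * Restriction of scalars from C to R *)

(** [is_RInt] integrates functions with values in a normed module over R. *)
Section RealRestriction.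
Variable E : NormedModule C_AbsRing.

Definition realify_scal (r : R) (x : E) : E := scal (RtoC r : C_AbsRing) x.

Lemma realify_scal_assoc (r s : R_Ring) (x : E) :
  realify_scal r (realify_scal s x) = realify_scal (mult r s) x.
Proof.
rewrite /realify_scal scal_assoc; congr (scal _ x).
by rewrite /mult /= RtoC_mult.
Qed.

Lemma realify_scal_one (x : E) : realify_scal (@one R_Ring) x = x.
Proof. exact: scal_one. Qed.

Lemma realify_scal_distr_l (r : R_Ring) (x y : E) :
  realify_scal r (plus x y) = plus (realify_scal r x) (realify_scal r y).
Proof. exact: scal_distr_l. Qed.

Lemma realify_scal_distr_r (r s : R_Ring) (x : E) :
  realify_scal (plus r s) x = plus (realify_scal r x) (realify_scal s x).
Proof.
rewrite /realify_scal -scal_distr_r; congr (scal _ x).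
by rewrite /plus /= RtoC_plus.
Qed.

Definition realify_ModuleSpace_mixin :=
  ModuleSpace.Mixin R_Ring E realify_scal realify_scal_assoc realify_scal_one
    realify_scal_distr_l realify_scal_distr_r.

Definition realify_NormedModuleAux : NormedModuleAux R_AbsRing :=
  NormedModuleAux.Pack R_AbsRing E
    (NormedModuleAux.Class R_AbsRing E
      (ModuleSpace.Class R_Ring E _ realify_ModuleSpace_mixin)
      (UniformSpace.class E)) E.

Lemma realify_norm_scal (r : R_AbsRing) (x : E) :
  norm (realify_scal r x) <= abs r * norm x.
Proof.
have := norm_scal (RtoC r : C_AbsRing) x.
by rewrite {1}/abs /= Cmod_R.
Qed.

Definition realify_NormedModule_mixin :=
  NormedModule.Mixin R_AbsRing realify_NormedModuleAux (@norm _ E)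
    (@norm_factor _ E) (@norm_triangle _ E) realify_norm_scal
    (@norm_compat1 _ E) (@norm_compat2 _ E) (@norm_eq_zero _ E).

Definition realify : NormedModule R_AbsRing :=
  NormedModule.Pack R_AbsRing E
    (NormedModule.Class R_AbsRing E _ realify_NormedModule_mixin) E.

End RealRestriction.

(** * Unbounded linear operators *)

(** [app A x] is meaningless when [x] is outside [dom A]. *)
Record linop (E : NormedModule C_AbsRing) := Linop {
  dom : E -> Prop;
  app : E -> E;
  dom_zero : dom zero;
  dom_plus : forall x y, dom x -> dom y -> dom (plus x y);
  dom_scal : forall (a : C) x, dom x -> dom (scal (a : C_AbsRing) x);
  app_plus : forall x y, dom x -> dom y ->
    app (plus x y) = plus (app x) (app y);
  app_scal : forall (a : C) x, dom x ->
    app (scal (a : C_AbsRing) x) = scal (a : C_AbsRing) (app x) }.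

Definition closed_linop (E : NormedModule C_AbsRing) (A : linop E) : Prop :=
  closed (fun p : prod_UniformSpace E E =>
    dom A (fst p) /\ app A (fst p) = snd p).

(** The operator [z A]; on [dom A] only, which is the right domain for the
    nonzero [z] used below. *)
Section ScaleLinop.
Variables (E : NormedModule C_AbsRing) (z : C) (A : linop E).

Definition scale_app (x : E) : E := scal (z : C_AbsRing) (app A x).

Lemma scale_app_plus x y : dom A x -> dom A y ->
  scale_app (plus x y) = plus (scale_app x) (scale_app y).
Proof. by move=> Dx Dy; rewrite /scale_app app_plus // scal_distr_l. Qed.

Lemma scale_app_scal (a : C) x : dom A x ->
  scale_app (scal (a : C_AbsRing) x) = scal (a : C_AbsRing) (scale_app x).
Proof.
move=> Dx; rewrite /scale_app app_scal // !scal_assoc; congr (scal _ _).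
exact: Cmult_comm.
Qed.

Definition scale_linop : linop E :=
  Linop (@dom_zero E A) (@dom_plus E A) (@dom_scal E A)
    scale_app_plus scale_app_scal.

End ScaleLinop.

(** * The kernel and its Laplace transform *)

Definition L1loc (K : R -> C) : Prop :=
  forall T : R, 0 <= T ->
    integrable (@lebesgue_measure R) `[0, T]%classic
      (fun t : R => (fst (K t))%:E) /\
    integrable (@lebesgue_measure R) `[0, T]%classic
      (fun t : R => (snd (K t))%:E).

Definition CLint (f : R -> C) (T : R) : C :=
  (Rintegral (@lebesgue_measure R) `[0, T]%classic (fun t : R => fst (f t)),
   Rintegral (@lebesgue_measure R) `[0, T]%classic (fun t : R => snd (f t))).

Definition Cexp (z : C) : C :=
  (exp (Re z) * cos (Im z), exp (Re z) * sin (Im z)).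

(** The integral over [0, oo[ is improper: the limit of the integrals over
    [0, T] as T tends to infinity. *)
Definition is_laplace (K : R -> C) (lambda l : C) : Prop :=
  filterlim (CLint (fun t => Cmult (Cexp (Copp (Cmult lambda (RtoC t)))) (K t)))
    (Rbar_locally p_infty) (locally l).

Definition laplace_transformable (K : R -> C) : Prop :=
  L1loc K /\
  exists omega : R, forall lambda : C, omega < Re lambda ->
    exists l : C, is_laplace K lambda l.

Definition abs_laplace (K : R -> C) : Rbar :=
  Glb_Rbar (fun r => exists lambda l : C, Re lambda = r /\ is_laplace K lambda l).

(** * Convoluted cosine functions *)

Section Cosine.
Variable E : NormedModule C_AbsRing.

Definition strongly_continuous (CK : R -> E -> E) : Prop :=
  forall (x : E) (t : R), 0 <= t ->
    filterlim (fun s => CK s x) (within (fun s => 0 <= s) (locally t))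
      (locally (CK t x)).

(** The family is indexed by [t >= 0]; its values at negative times are
    irrelevant. *)
Definition generates_convoluted_cosine (K : R -> C) (A : linop E)
    (CK : R -> E -> E) : Prop :=
  (forall t, 0 <= t -> is_linear (CK t)) /\
  strongly_continuous CK /\
  (forall t x, 0 <= t -> dom A x ->
     dom A (CK t x) /\ app A (CK t x) = CK t (app A x)) /\
  (forall t x, 0 <= t ->
     exists y : E,
       is_RInt (V := realify E)
         (fun s => scal (RtoC (t - s) : C_AbsRing) (CK s x)) 0 t y /\
       dom A y /\
       app A y = minus (CK t x) (scal (CLint K t : C_AbsRing) x)).

Definition exponentially_bounded (CK : R -> E -> E) : Prop :=
  exists M' omega : R, 0 < M' /\
    forall t x, 0 <= t -> norm (CK t x) <= M' * exp (omega * t) * norm x.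

End Cosine.

(** * Weight sequences *)

Definition gevrey (s : R) (p : nat) : R := Rpower (INR (Factorial.fact p)) s.

(** The associated function; for [gevrey s] with [s > 0] the supremum is
    finite. *)
Definition assoc (Mp : nat -> R) (rho : R) : R :=
  if Rlt_dec 0 rho
  then real (Sup_seq (fun p => Finite (ln (rho ^ p / Mp p))))
  else 0.

(** 1 / |K~(lambda)| = O(exp (M (k |lambda|))) on the half-plane
    Re lambda >= c0. *)
Definition inv_laplace_bigO (Mp : nat -> R) (K : R -> C) (k c0 : R) : Prop :=
  exists c : R, forall lambda l : C, c0 <= Re lambda ->
    is_laplace K lambda l ->
    / Cmod l <= c * exp (assoc Mp (k * Cmod lambda)).

(** * Ultradifferentiable test functions *)

Inductive ultra_class := Beurling | Roumieu.

Definition CDerive_n (phi : R -> C) (p : nat) (t : R) : C :=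
  (Derive_n (fun u => fst (phi u)) p t, Derive_n (fun u => snd (phi u)) p t).

Definition smooth (phi : R -> C) : Prop :=
  forall p t, ex_derive_n (fun u => fst (phi u)) p t /\
              ex_derive_n (fun u => snd (phi u)) p t.

Definition supp (phi : R -> C) (t : R) : Prop :=
  ~ locally t (fun u => phi u = RtoC 0).

(** [c] bounds the norm sup_{p,t} |phi^(p)(t)| / (h^p M_p). *)
Definition ultra_bound (Mp : nat -> R) (phi : R -> C) (h c : R) : Prop :=
  forall p t, Cmod (CDerive_n phi p t) <= c * h ^ p * Mp p.

(** The spaces of test functions of the two classes with support in [a, b]. *)
Definition test_on (cl : ultra_class) (Mp : nat -> R) (a b : R)
    (phi : R -> C) : Prop :=
  smooth phi /\ (forall t, supp phi t -> a <= t <= b) /\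
  match cl with
  | Beurling => forall h, 0 < h -> exists c, ultra_bound Mp phi h c
  | Roumieu => exists h c, 0 < h /\ ultra_bound Mp phi h c
  end.

Definition test (cl : ultra_class) (Mp : nat -> R) (phi : R -> C) : Prop :=
  exists a b, test_on cl Mp a b phi.

(** * Ultradistributions with values in L(E, [D(B)]) *)

Definition graph_norm (E : NormedModule C_AbsRing) (B : linop E) (x : E) : R :=
  norm x + norm (app B x).

Section Ultradistribution.
Variables (cl : ultra_class) (Mp : nat -> R).
Variables (E : NormedModule C_AbsRing) (B : linop E).

Definition graph_opnorm_le (T : E -> E) (m : R) : Prop :=
  forall x, graph_norm B (T x) <= m * norm x.

(** Continuity for the locally convex topology of the test function space.
    Beurling: the inductive limit over [a, b] of the projective limits, as
    h -> 0, of the Banach spaces with norm sup |phi^(p)| / (h^p M_p).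
    Roumieu: the inductive limit over [a, b] and over h -> oo of these Banach
    spaces. A linear map on an inductive limit is continuous iff its
    restriction to each step is. *)
Definition ultra_continuous (G : (R -> C) -> E -> E) : Prop :=
  forall a b : R,
  match cl with
  | Beurling =>
      exists h m, 0 < h /\ forall phi c, test_on cl Mp a b phi ->
        ultra_bound Mp phi h c -> graph_opnorm_le (G phi) (m * c)
  | Roumieu =>
      forall h, 0 < h -> exists m, forall phi c, test_on cl Mp a b phi ->
        ultra_bound Mp phi h c -> graph_opnorm_le (G phi) (m * c)
  end.

(** [G] is a total function on [R -> C], constrained on test functions only. *)
Definition ultradistribution (G : (R -> C) -> E -> E) : Prop :=
  (forall phi, test cl Mp phi ->
     is_linear (G phi) /\ (forall x, dom B (G phi x)) /\
     exists m, graph_opnorm_le (G phi) m) /\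
  (forall phi psi x, test cl Mp phi -> test cl Mp psi ->
     G (fun t => Cplus (phi t) (psi t)) x = plus (G phi x) (G psi x)) /\
  (forall (a : C) phi x, test cl Mp phi ->
     G (fun t => Cmult a (phi t)) x = scal (a : C_AbsRing) (G phi x)) /\
  ultra_continuous G.

Definition supported_nonneg (G : (R -> C) -> E -> E) : Prop :=
  forall phi, test cl Mp phi -> (forall t, supp phi t -> t < 0) ->
    forall x, G phi x = zero.

End Ultradistribution.

Definition delta (phi : R -> C) : C := phi 0.

Definition delta' (phi : R -> C) : C := Copp (CDerive_n phi 1 0).

(** <S * G, phi> = <G_t, <S_u, phi (t + u)>>, for a scalar [S] supported at the
    origin. *)
Definition conv (E : NormedModule C_AbsRing) (S : (R -> C) -> C)
    (G : (R -> C) -> E -> E) : (R -> C) -> E -> E :=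
  fun phi => G (fun t => S (fun u => phi (t + u))).

(** For an operator [T], (S (x) T) * G = T o (S * G) and
    G * (S (x) T) = (S * G) o T. With P = delta' (x) I - delta (x) B, the last
    two clauses say P * G = delta (x) I_E and G * P = delta (x) I_[D(B)]. *)
Definition fundamental_solution (cl : ultra_class) (Mp : nat -> R)
    (E : NormedModule C_AbsRing) (B : linop E)
    (G : (R -> C) -> E -> E) : Prop :=
  ultradistribution cl Mp B G /\
  supported_nonneg cl Mp G /\
  (forall phi x, test cl Mp phi ->
     minus (conv delta' G phi x) (app B (conv delta G phi x)) =
     scal (delta phi : C_AbsRing) x) /\
  (forall phi x, test cl Mp phi -> dom B x ->
     minus (conv delta' G phi x) (conv delta G phi (app B x)) =
     scal (delta phi : C_AbsRing) x).

(* Main.v *)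
(** For [iota = Ci] or [-Ci] put [B = iota A] and write points of the resolvent
    set of [B] as [mu = iota z^2]. Laplace transforming the convoluted cosine
    function and dividing by [z K~(z)] gives the resolvent [R(z) = (z^2 - A)^{-1}]
    on a half-plane, bounded by [N e^{k |z|}] because
    [M(rho) <= rho] for [M_p >= p!]. The fundamental solution is
      [G(phi) x = (2 pi iota)^{-1} \int 2 z phi^(iota z^2) R(z) x dz],
    where [phi^(mu) = \int e^{mu t} phi(t) dt] and [z] runs from infinity to [a]
    along [a - iota t] and then from [a] to infinity along [a + t]. On this path
    [Re mu = O(|z|)], and for [phi] of Gevrey class [s < 2] the transform
    [phi^(iota z^2)] decays faster than every [e^{-L |z|}], so the integral
    converges. Moving the corner along [a + (1 - iota) t], where [Re mu] tends
    to infinity, gives the support condition, and moving it to [0] turns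
    [\int 2 z phi^(iota z^2) dz] into Fourier inversion, which yields
    [(delta' - delta B) * G = delta]. *)

(* The rate [e^{k |z|}] and the condition [s < 2] meet in one comparison. The transform of the
   [p]-th derivative of [phi] carries the factor [|iota z^2|^p = |z|^(2p)], and [p!^s] is smaller
   than [(2p)!] by a factor that beats every geometric sequence; even moments bounded by [(2p)!]
   mean exponential decay in [|z|]. Every rate [L] is reached, so one [G] serves both classes. The
   resolvent is known only to the right of [C0]. From [A R = z^2 R - 1] the integral of [A R] splits
   off a part without resolvent, and only that part is moved to the corner [0]. Cauchy's theorem
   enters as invariance under translation of the path: a shift by [w] changes the integral by [w]
   times the integral of the derivative, which is zero, plus [O(|w|^2)], and over a fine subdivision
   quadratic errors add up to nothing. The same subdivision argument proves integration by parts for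
   the merely integrable [K]. It serves to pass from [K] to its continuous primitive, after which
   Riemann integrals suffice. *)
Require Import Defs.
From mathcomp Require all_boot all_order all_algebra all_classical all_reals.
From mathcomp Require all_analysis measurable_realfun Rstruct Rstruct_topology.
From mathcomp Require Import ssreflect ssrfun ssrbool.
From Stdlib Require Import Reals Lra Lia Classical ClassicalEpsilon.
From Stdlib Require Import FunctionalExtensionality PropExtensionality.
From Stdlib Require List.
From Coquelicot Require Import Coquelicot.
Open Scope R_scope.

(** * Lebesgue primitives *)

Module LebesguePrimitive.
Import all_boot all_order all_algebra all_classical all_reals all_analysis.
Import measurable_realfun.
Local Set Implicit Arguments.
Local Unset Strict Implicit.
Local Unset Printing Implicit Defensive.
Import Order.TTheory GRing.Theory Num.Theory.
Import numFieldNormedType.Exports.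
Local Open Scope classical_set_scope.
Local Open Scope ring_scope.

Section Primitive.
Variable (R : realType).
Notation mu := (@lebesgue_measure R).
Variable f : R -> R.
Hypothesis hf : forall T, 0 <= T -> mu.-integrable `[0, T] (EFin \o f).

Lemma integrable_mul_continuous (g : R -> R) T : continuous g -> 0 <= T ->
  mu.-integrable `[0, T] (EFin \o (fun t => g t * f t)).
Proof.
move=> cg T0.
have cgw : {within `[0, T], continuous g} by apply: continuous_subspaceT.
have := @integrableMr _ _ _ mu `[0, T] (measurable_itv _) g (EFin \o f) _ _ (hf T0).
apply.
- by apply: subspace_continuous_measurable_fun => //; exact: measurable_itv.
- have /compact_bounded[M [Mr mrt]] := continuous_compact cgw (@segment_compact _ 0 T).
  by exists M; split => // y My x Tx; apply: mrt => //; exists x.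
Qed.

Lemma primitive_sub (h : R -> R) a b : 0 <= a -> a <= b ->
  mu.-integrable `[0, b] (EFin \o h) ->
  \int[mu]_(t in `[0, b]) h t - \int[mu]_(t in `[0, a]) h t =
  \int[mu]_(t in `]a, b]) h t.
Proof. by move=> a0 ab ih; apply: Rintegral_itvB => //; rewrite bnd_simp. Qed.

Lemma integrable_sub_itv (h : R -> R) a b : 0 <= a -> a <= b ->
  mu.-integrable `[0, b] (EFin \o h) -> mu.-integrable `]a, b] (EFin \o h).
Proof.
move=> a0 ab; apply: integrableS; [exact: measurable_itv|exact: measurable_itv|].
by apply: subset_itvr; rewrite bnd_simp.
Qed.

(** Domination by the increments of the nondecreasing function [int |f|]. Applied to [g - c], with
    [c] a value of [g], the constant [M] becomes of the order of the interval length; this gain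
    carries the integration by parts. *)
Lemma primitive_increment_le (g : R -> R) M a b : continuous g -> 0 <= a -> a <= b ->
  (forall t, a <= t <= b -> `|g t| <= M) ->
  `| \int[mu]_(t in `[0, b]) (g t * f t) - \int[mu]_(t in `[0, a]) (g t * f t) | <=
  M * (\int[mu]_(t in `[0, b]) `|f t| - \int[mu]_(t in `[0, a]) `|f t|).
Proof.
move=> cg a0 ab gM; have b0 : 0 <= b := le_trans a0 ab.
have ig := integrable_mul_continuous cg b0.
have in_ : mu.-integrable `[0, b] (EFin \o (fun t => `|f t|)).
  exact: integrable_norm (hf b0).
rewrite !primitive_sub //.
have ig' := integrable_sub_itv a0 ab ig.
have in' := integrable_sub_itv a0 ab in_.
rewrite (le_trans (le_normr_Rintegral _ _)) //.
rewrite -RintegralZl //.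
apply: le_Rintegral => //.
- exact: integrable_norm ig'.
- have : mu.-integrable `]a, b] (fun x => (M%:E * (EFin \o (fun t => `|f t|)%R) x)%E).
    exact: integrableZl.
  by [].
- move=> x; rewrite /= in_itv /= => /andP[ax xb].
  by rewrite normrM ler_wpM2r // gM // ltW.
Qed.

Lemma primitive_abs_continuous T e : 0 <= T -> 0 < e -> exists d, 0 < d /\
  forall a b, 0 <= a -> a <= b -> b <= T -> b - a < d ->
  \int[mu]_(t in `[0, b]) `|f t| - \int[mu]_(t in `[0, a]) `|f t| < e.
Proof.
(* The cut-off to [[0, T]] is integrable over the whole line, where absolute continuity of the
   integral applies. *)
move=> T0 e0; pose F := f \_ `[0, T].
have iF : mu.-integrable setT (EFin \o F).
  rewrite -restrict_EFin; apply/integrable_restrict => //=.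
  by rewrite setTI; exact: hf.
have [d [d0 H]] := integral_normr_continuous iF e0.
exists d; split=> // a b a0 ab bT bad.
have in_ : mu.-integrable `[0, b] (EFin \o (fun t => `|f t|)).
  exact: integrable_norm (hf (le_trans a0 ab)).
rewrite primitive_sub //.
have -> : \int[mu]_(t in `]a, b]) `|f t| = \int[mu]_(t in `]a, b]) `|F t|.
  apply: eq_Rintegral => z; rewrite inE /= in_itv /= => /andP[az zb].
  rewrite /F patchE ifT // inE /= in_itv /=.
  by rewrite (le_trans a0 (ltW az)) (le_trans zb bT).
apply: H; first exact: measurable_itv.
rewrite /= lebesgue_measure_itv /=; case: ifPn => // _.
Qed.

Lemma primitive0 (h : R -> R) : \int[mu]_(t in `[0, 0]) h t = 0.
Proof. by rewrite set_itv1 Rintegral_set1. Qed.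

End Primitive.
Local Unset Implicit Arguments.
Import Rstruct Rstruct_topology.
Import Rdefinitions Rbasic_fun Ranalysis1.

(** * The same facts in the notation of the Stdlib reals *)

Definition prim (h : Rdefinitions.R -> Rdefinitions.R) (T : Rdefinitions.R) :
    Rdefinitions.R :=
  \int[@lebesgue_measure Rdefinitions.R]_(t in `[0, T]) h t.

Definition locally_integrable (f : Rdefinitions.R -> Rdefinitions.R) : Prop :=
  forall T, Rle 0 T ->
    integrable (@lebesgue_measure Rdefinitions.R) `[0, T] (fun t => (f t)%:E).

Lemma locally_integrableE f : locally_integrable f -> forall T, 0 <= T ->
  integrable (@lebesgue_measure Rdefinitions.R) `[0, T] (EFin \o f).
Proof. by move=> H T /RleP; exact: H. Qed.

Lemma continuity_continuous (g : Rdefinitions.R -> Rdefinitions.R) :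
  continuity g -> continuous g.
Proof. by move=> H x; apply/continuity_pt_cvg; exact: H. Qed.

Lemma locally_integrable_mul f g : locally_integrable f -> continuity g ->
  locally_integrable (fun t => Rmult (g t) (f t)).
Proof.
move=> /locally_integrableE hf /continuity_continuous cg T /RleP T0.
exact: integrable_mul_continuous.
Qed.

Lemma locally_integrable_minus f g : locally_integrable f -> locally_integrable g ->
  locally_integrable (fun t => Rminus (f t) (g t)).
Proof.
move=> /locally_integrableE hf /locally_integrableE hg T /RleP T0.
have : integrable (@lebesgue_measure Rdefinitions.R) `[0, T] ((EFin \o f) \- (EFin \o g))%E.
  by apply: integrableB => //; [exact: hf|exact: hg].
by [].
Qed.

Lemma locally_integrable_plus f g : locally_integrable f -> locally_integrable g ->
  locally_integrable (fun t => Rplus (f t) (g t)).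
Proof.
move=> /locally_integrableE hf /locally_integrableE hg T /RleP T0.
have : integrable (@lebesgue_measure Rdefinitions.R) `[0, T] ((EFin \o f) \+ (EFin \o g))%E.
  by apply: integrableD => //; [exact: hf|exact: hg].
by [].
Qed.

Lemma prim_increment_le f g M a b : locally_integrable f -> continuity g ->
  Rle 0 a -> Rle a b -> (forall t, Rle a t -> Rle t b -> Rle (Rabs (g t)) M) ->
  Rle (Rabs (Rminus (prim (fun t => Rmult (g t) (f t)) b) (prim (fun t => Rmult (g t) (f t)) a)))
    (Rmult M (Rminus (prim (fun t => Rabs (f t)) b) (prim (fun t => Rabs (f t)) a))).
Proof.
move=> /locally_integrableE hf /continuity_continuous cg /RleP a0 /RleP ab gM.
apply/RleP; rewrite RabsE.
apply: (@primitive_increment_le _ _ hf) => // t /andP[/RleP at_ /RleP tb].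
by rewrite -RabsE; apply/RleP; exact: gM.
Qed.

Lemma prim_abs_continuous f T e : locally_integrable f -> Rle 0 T -> Rlt 0 e ->
  exists d, Rlt 0 d /\ forall a b, Rle 0 a -> Rle a b -> Rle b T -> Rlt (Rminus b a) d ->
    Rlt (Rminus (prim (fun t => Rabs (f t)) b) (prim (fun t => Rabs (f t)) a)) e.
Proof.
move=> /locally_integrableE hf /RleP T0 /RltP e0.
have [d [d0 H]] := primitive_abs_continuous hf T0 e0.
exists d; split; first exact/RltP.
by move=> a b /RleP a0 /RleP ab /RleP bT /RltP bad; apply/RltP; exact: H.
Qed.

Lemma prim_0 h : prim h 0 = 0 :> Rdefinitions.R.
Proof. exact: primitive0. Qed.

Lemma prim_minus f g T : locally_integrable f -> locally_integrable g -> Rle 0 T ->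
  prim (fun t => Rminus (f t) (g t)) T = Rminus (prim f T) (prim g T).
Proof.
move=> /locally_integrableE hf /locally_integrableE hg /RleP T0.
by apply: RintegralB => //; [exact: hf|exact: hg].
Qed.

Lemma prim_plus f g T : locally_integrable f -> locally_integrable g -> Rle 0 T ->
  prim (fun t => Rplus (f t) (g t)) T = Rplus (prim f T) (prim g T).
Proof.
move=> /locally_integrableE hf /locally_integrableE hg /RleP T0.
by apply: RintegralD => //; [exact: hf|exact: hg].
Qed.

Lemma prim_scal c f T : locally_integrable f -> Rle 0 T ->
  prim (fun t => Rmult c (f t)) T = Rmult c (prim f T).
Proof.
move=> /locally_integrableE hf /RleP T0.
by apply: RintegralZl => //; exact: hf.
Qed.

Lemma L1loc_parts K : L1loc K ->
  locally_integrable (fun t => fst (K t)) /\ locally_integrable (fun t => snd (K t)).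
Proof. by move=> H; split=> T T0; have [] := H T T0. Qed.

Lemma CLintE K T : CLint K T = (prim (fun t => fst (K t)) T, prim (fun t => snd (K t)) T).
Proof. by []. Qed.

End LebesguePrimitive.

(** Cut [[0, H]] into [n] equal pieces: the bounds telescope in [Phi] to [M (H/n) (Phi H - Phi 0)],
    which tends to [0]. In the application [P x y] is [|D y - D x|]. *)
Lemma bv_increments_constant (P : R -> R -> R) (Phi : R -> R) M H : 0 <= H ->
  (forall x y z, P x z <= P x y + P y z) ->
  (forall x, 0 <= x <= H -> P x x <= 0) ->
  (forall x y, 0 <= x -> x <= y -> y <= H -> P x y <= M * (y - x) * (Phi y - Phi x)) ->
  P 0 H <= 0.
Proof.
move=> HH tri refl inc.
have step n : (0 < n)%nat -> P 0 H <= M * H * (Phi H - Phi 0) / INR n.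
  move=> Hn; have Hn' : 0 < INR n by apply: lt_0_INR.
  have A : forall k, (k <= n)%nat ->
      P 0 (INR k * (H / INR n)) <= M * (H / INR n) * (Phi (INR k * (H / INR n)) - Phi 0).
    elim=> [|k IH] Hk.
      by rewrite /= !Rmult_0_l Rminus_diag Rmult_0_r; apply: refl; lra.
    apply: Rle_trans (tri _ (INR k * (H / INR n)) _) _.
    have IH' := IH ltac:(lia).
    have hk : INR (S k) = INR k + 1 by rewrite S_INR.
    have hk2 : INR (S k) <= INR n by apply: le_INR.
    have q : 0 <= H / INR n by apply: Rdiv_le_0_compat.
    have q2 : INR (S k) * (H / INR n) <= H.
      have {2}-> : H = INR n * (H / INR n) by field; lra.
      exact: Rmult_le_compat_r.
    have p := pos_INR k.
    have := inc (INR k * (H / INR n)) (INR (S k) * (H / INR n)) _ _ q2.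
    have -> : INR (S k) * (H / INR n) - INR k * (H / INR n) = H / INR n
      by rewrite hk; ring.
    move=> h; have := h (Rmult_le_pos _ _ p q) ltac:(rewrite hk; nra); lra.
  have := A n (Nat.le_refl n).
  have -> : INR n * (H / INR n) = H by field; lra.
  have -> : M * (H / INR n) * (Phi H - Phi 0) = M * H * (Phi H - Phi 0) / INR n by field; lra.
  by [].
apply: le_epsilon => e He; rewrite Rplus_0_l.
set Q := M * H * (Phi H - Phi 0) in step.
have [n Hn] := nfloor_ex (Rmax 0 (Q / e)) (Rmax_l _ _).
apply: Rle_trans (step (S n) ltac:(lia)) _.
have hn : 0 < INR (S n) by apply: lt_0_INR; lia.
have h2 : Q / e <= INR (S n).
  by rewrite S_INR; have := Rmax_r 0 (Q / e); lra.
apply: (Rmult_le_reg_r (INR (S n))) => //.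
have -> : Q / INR (S n) * INR (S n) = Q / e * e by field; lra.
by rewrite (Rmult_comm e); apply: Rmult_le_compat_r; lra.
Qed.

Lemma Rmax0_lipschitz s t : Rabs (Rmax 0 s - Rmax 0 t) <= Rabs (s - t).
Proof.
rewrite /Rmax; destruct (Rle_dec 0 s), (Rle_dec 0 t); rewrite /Rabs;
  repeat match goal with |- context [Rcase_abs ?x] => destruct (Rcase_abs x) end; lra.
Qed.

Section ByParts.
(* [J1 t] and [Jg t] stand for the Lebesgue integrals of [f] and [g f] over
   [0, t], and [Phi t] for that of [|f|]. *)
Variables (J1 Jg Phi g g' : R -> R).
Hypothesis J1_0 : J1 0 = 0.
Hypothesis Jg_0 : Jg 0 = 0.
Hypothesis J1_inc : forall a b, 0 <= a -> a <= b -> Rabs (J1 b - J1 a) <= Phi b - Phi a.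
(** [Jg - c J1] is the primitive of [(g - c) f]; the free constant [c] lets [g] be frozen at an
    endpoint. *)
Hypothesis Jg_inc : forall c M a b, 0 <= a -> a <= b ->
  (forall t, a <= t -> t <= b -> Rabs (g t - c) <= M) ->
  Rabs ((Jg b - c * J1 b) - (Jg a - c * J1 a)) <= M * (Phi b - Phi a).
Hypothesis Phi_cont : forall T e, 0 <= T -> 0 < e -> exists d, 0 < d /\
  forall a b, 0 <= a -> a <= b -> b <= T -> b - a < d -> Phi b - Phi a < e.
Hypothesis g_derive : forall t, is_derive g t (g' t).
Hypothesis g'_cont : forall t, continuous g' t.

(** [Rmax 0] extends the primitive constantly to negative times, so that continuity can be stated on
    all of [R]. *)
Lemma primitive_continuous t : continuous (fun s => J1 (Rmax 0 s)) t.
Proof.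
apply/filterlim_locally => eps.
have [d [hd Hd]] := Phi_cont (Rabs t + 1) eps ltac:(have := Rabs_pos t; lra) (cond_pos eps).
have hd' : 0 < Rmin 1 d by apply: Rmin_pos; lra.
exists (mkposreal _ hd') => s Hs.
have hs : Rabs (s - t) < Rmin 1 d by exact: Hs.
have s1 : Rabs (s - t) < 1 := Rlt_le_trans _ _ _ hs (Rmin_l _ _).
have s2 : Rabs (s - t) < d := Rlt_le_trans _ _ _ hs (Rmin_r _ _).
have lip := Rmax0_lipschitz s t.
change (Rabs (J1 (Rmax 0 s) - J1 (Rmax 0 t)) < eps).
have bs : Rmax 0 s <= Rabs t + 1.
  apply: Rmax_lub; first by have := Rabs_pos t; lra.
  by have := Rle_abs t; have := Rle_abs (s - t); lra.
have bt : Rmax 0 t <= Rabs t + 1.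
  by apply: Rmax_lub; [have := Rabs_pos t|have := Rle_abs t]; lra.
have z1 := Rmax_l 0 s. have z2 := Rmax_l 0 t.
case: (Rle_dec (Rmax 0 s) (Rmax 0 t)) => h.
  rewrite -Rabs_Ropp Ropp_minus_distr.
  apply: Rle_lt_trans (J1_inc _ _ z1 h) _; apply: Hd => //.
  by rewrite -Rabs_Ropp Ropp_minus_distr in lip; have := Rle_abs (Rmax 0 t - Rmax 0 s); lra.
apply: Rle_lt_trans (J1_inc _ _ z2 _) _; first lra.
by apply: Hd => //; [lra|have := Rle_abs (Rmax 0 s - Rmax 0 t); lra].
Qed.

Lemma by_parts_integrable a b : ex_RInt (fun t => g' t * J1 (Rmax 0 t)) a b.
Proof.
apply: (ex_RInt_continuous (V := R_CompleteNormedModule)) => t _.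
apply: (continuous_mult g' (fun t => J1 (Rmax 0 t))); first exact: g'_cont.
exact: primitive_continuous.
Qed.

(** The defect [D] of the formula has increments of size at most [2 M (b - a) (Phi b - Phi a)], and
    such increments add up to zero by [bv_increments_constant]. No approximation of [f] by smooth
    functions is made. *)
Lemma integral_by_parts T : 0 <= T ->
  Jg T = g T * J1 T - RInt (fun t => g' t * J1 (Rmax 0 t)) 0 T.
Proof.
move=> hT.
pose D t := Jg t - g t * J1 t + RInt (fun t => g' t * J1 (Rmax 0 t)) 0 t.
have D0 : D 0 = 0 by rewrite /D Jg_0 J1_0 RInt_point /zero /=; ring.
suff DT : D T = D 0 by rewrite D0 /D in DT; lra.
have [M [M0 HM]] : exists M, 0 <= M /\ forall t, 0 <= t <= T -> Rabs (g' t) <= M.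
  have [M HM] : exists M, forall t, Rmin 0 T <= t <= Rmax 0 T -> norm (g' t) <= M.
    apply: ex_RInt_ub; apply: (ex_RInt_continuous (V := R_CompleteNormedModule)) => t _.
    exact: g'_cont.
  rewrite Rmin_left // Rmax_right // in HM.
  exists M; split; last by move=> t Ht; exact: HM.
  by apply: Rle_trans (Rabs_pos (g' 0)) (HM 0 _); lra.
have lip a b : 0 <= a -> b <= T -> forall t, a <= t <= b -> Rabs (g t - g b) <= M * (b - a).
  move=> ha hb t Ht.
  have I : is_RInt g' t b (g b - g t).
    by apply: (is_RInt_derive g) => x _; [exact: g_derive|exact: g'_cont].
  have := norm_RInt_le_const (V := R_NormedModule) g' t b _ M (proj2 Ht) _ I.
  rewrite -Rabs_Ropp Ropp_minus_distr => h.
  have h2 : Rabs (g b - g t) <= (b - t) * M by apply: h => x Hx; apply: HM; lra.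
  by apply: Rle_trans h2 _; rewrite Rmult_comm; apply: Rmult_le_compat_l => //; lra.
have PhiM a b : 0 <= a -> a <= b -> 0 <= Phi b - Phi a.
  by move=> ha hab; apply: Rle_trans (Rabs_pos _) (J1_inc a b ha hab).
have inc a b : 0 <= a -> a <= b -> b <= T ->
    Rabs (D b - D a) <= (2 * M) * (b - a) * (Phi b - Phi a).
  move=> ha hab hb.
  have i1 := Jg_inc (g b) (M * (b - a)) a b ha hab (fun t h1 h2 => lip a b ha hb t (conj h1 h2)).
  have I1 := RInt_correct _ _ _ (by_parts_integrable 0 a).
  have I2 := RInt_correct _ _ _ (by_parts_integrable a b).
  have I3 := is_RInt_unique _ _ _ _ (is_RInt_Chasles _ _ _ _ _ _ I1 I2).
  have Ig : is_RInt g' a b (g b - g a).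
    by apply: (is_RInt_derive g) => x _; [exact: g_derive|exact: g'_cont].
  have I4 := is_RInt_minus _ _ _ _ _ _ I2 (is_RInt_scal _ _ _ (J1 a) _ Ig).
  have b2 : Rabs (RInt (fun t => g' t * J1 (Rmax 0 t)) a b - J1 a * (g b - g a)) <=
      (b - a) * (M * (Phi b - Phi a)).
    apply: (norm_RInt_le_const (V := R_NormedModule) _ a b _ _ hab _ I4) => t Ht.
    rewrite /norm /= /abs /= /minus /plus /opp /scal /= /mult /=.
    have -> : g' t * J1 (Rmax 0 t) + - (J1 a * g' t) = g' t * (J1 (Rmax 0 t) - J1 a) by ring.
    rewrite Rabs_mult Rmax_right; last lra.
    apply: Rmult_le_compat; [exact: Rabs_pos|exact: Rabs_pos|apply: HM; lra|].
    apply: Rle_trans (J1_inc a t ha (proj1 Ht)) _.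
    by have := PhiM t b ltac:(lra) (proj2 Ht); lra.
  set R1 := RInt _ a b in I3 b2.
  (* The first bracket is the error of freezing [g] at [g b], the second that of freezing [J1] at
     [J1 a]; each is at most [M (b - a) (Phi b - Phi a)]. *)
  have e : D b - D a = ((Jg b - g b * J1 b) - (Jg a - g b * J1 a)) + (R1 - J1 a * (g b - g a)).
    rewrite /D I3; set R2 := RInt _ 0 a.
    change (Jg b - g b * J1 b + (R2 + R1) - (Jg a - g a * J1 a + R2) =
      Jg b - g b * J1 b - (Jg a - g b * J1 a) + (R1 - J1 a * (g b - g a))); ring.
  rewrite e; apply: Rle_trans (Rabs_triang _ _) _.
  have -> : 2 * M * (b - a) * (Phi b - Phi a) =
    M * (b - a) * (Phi b - Phi a) + (b - a) * (M * (Phi b - Phi a)) by ring.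
  exact: Rplus_le_compat.
apply: Rminus_diag_uniq.
have : Rabs (D T - D 0) <= 0.
  apply: (bv_increments_constant (fun x y => Rabs (D y - D x)) Phi (2 * M) T hT) => //.
  - move=> x y z; have -> : D z - D x = (D y - D x) + (D z - D y) by ring.
    exact: Rabs_triang.
  - by move=> x _; rewrite Rminus_diag Rabs_R0; lra.
move=> h; 
have := Rle_abs (D T - D 0); have := Rle_abs (- (D T - D 0)); rewrite Rabs_Ropp; lra.
Qed.

End ByParts.

(** * Inversion of the cosine transform *)

Section TrigonometricIntegrals.
Variables (g : R -> R) (a b : R).
Hypothesis hab : a <= b.
Hypothesis g_cont : forall t, a <= t <= b -> continuous g t.

Lemma trig_integrable (u : R -> R) : (forall t, continuous u t) ->
  ex_RInt (fun t => g t * u t) a b.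
Proof.
move=> hu; apply: (ex_RInt_continuous (V := R_CompleteNormedModule)) => t.
rewrite Rmin_left // Rmax_right // => Ht.
by apply: (continuous_mult g u); [exact: g_cont|exact: hu].
Qed.

Lemma continuous_trig (u : R -> R) xi t : (forall t, continuous u t) ->
  continuous (fun t => u (xi * t)) t.
Proof.
move=> hu; apply: (continuous_comp (fun t => xi * t) u); last exact: hu.
by apply: (ex_derive_continuous (fun t => xi * t)); auto_derive.
Qed.

Lemma trig_derive (u u' : R -> R) xi :
  (forall t, is_derive u t (u' t)) -> (forall t, continuous u' t) ->
  is_derive (fun x => RInt (fun t => g t * u (x * t)) a b) xi
    (RInt (fun t => g t * (t * u' (xi * t))) a b).
Proof.
move=> hu hu'.
have hc : forall t, continuous u t.
  by move=> t; apply: ex_derive_continuous; eexists; exact: hu.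
have D : forall x t, is_derive (fun z => g t * u (z * t)) x (g t * (t * u' (x * t))).
  move=> x t; apply: is_derive_scal.
  have := is_derive_comp u (fun z => z * t) x _ t (hu (x * t)).
  apply; rewrite -[X in is_derive _ _ X]Rmult_1_l -[X in is_derive _ _ X]Rplus_0_r.
  auto_derive => //; ring.
have -> : RInt (fun t => g t * (t * u' (xi * t))) a b =
  RInt (fun t => Derive (fun z => g t * u (z * t)) xi) a b.
  by apply: RInt_ext => t _; symmetry; apply: is_derive_unique; exact: D.
apply: (is_derive_RInt_param (fun x t => g t * u (x * t))).
- by apply: filter_forall => x t _; eexists; exact: D.
- move=> t; rewrite Rmin_left // Rmax_right // => Ht.
  apply: (continuity_2d_pt_ext (fun x v => g v * (v * u' (x * v)))).
    by move=> x v; symmetry; apply: is_derive_unique; exact: D.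
  apply: continuity_2d_pt_mult.
    apply: (continuity_1d_2d_pt_comp g (fun _ v => v)); last exact: continuity_2d_pt_id2.
    by apply/continuity_pt_filterlim; exact: g_cont.
  apply: continuity_2d_pt_mult; first exact: continuity_2d_pt_id2.
  apply: (continuity_1d_2d_pt_comp u' (fun x v => x * v)).
    by apply/continuity_pt_filterlim; exact: hu'.
  by apply: continuity_2d_pt_mult; [exact: continuity_2d_pt_id1|exact: continuity_2d_pt_id2].
- apply: filter_forall => x; apply: trig_integrable => t; exact: continuous_trig.
Qed.
End TrigonometricIntegrals.

Lemma is_derive_sin' t : is_derive sin t (cos t).
Proof. by auto_derive => //; ring. Qed.
Lemma is_derive_cos' t : is_derive cos t (- sin t).
Proof. by auto_derive => //; ring. Qed.
Lemma continuous_cos' t : continuous cos t.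
Proof. by apply: ex_derive_continuous; eexists; exact: is_derive_cos'. Qed.
Lemma continuous_sin' t : continuous sin t.
Proof. by apply: ex_derive_continuous; eexists; exact: is_derive_sin'. Qed.
Lemma continuous_opp_sin t : continuous (fun t => - sin t) t.
Proof. by apply: (continuous_opp sin); exact: continuous_sin'. Qed.

Lemma cos_integral_continuous g a b xi : a <= b ->
  (forall t, a <= t <= b -> continuous g t) ->
  continuous (fun x => RInt (fun t => g t * cos (x * t)) a b) xi.
Proof.
move=> hab hg; apply: ex_derive_continuous; eexists.
by apply: trig_derive => //; [exact: is_derive_cos'|exact: continuous_opp_sin].
Qed.

Lemma exp_cos_integral S xi :
  is_RInt (fun t => exp (- t) * cos (xi * t)) 0 S
    (/ (1 + xi ^ 2) + exp (- S) * (xi * sin (xi * S) - cos (xi * S)) / (1 + xi ^ 2)).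
Proof.
have h : 0 < 1 + xi ^ 2 by have := pow2_ge_0 xi; lra.
have -> : / (1 + xi ^ 2) + exp (- S) * (xi * sin (xi * S) - cos (xi * S)) / (1 + xi ^ 2) =
  minus (exp (- S) * (xi * sin (xi * S) - cos (xi * S)) / (1 + xi ^ 2))
     (exp (- 0) * (xi * sin (xi * 0) - cos (xi * 0)) / (1 + xi ^ 2)).
  rewrite Ropp_0 exp_0 Rmult_0_r sin_0 cos_0 /minus /plus /opp /=; field; lra.
apply: (is_RInt_derive (fun t => exp (- t) * (xi * sin (xi * t) - cos (xi * t)) / (1 + xi ^ 2))).
  by move=> t _; auto_derive => //; field; lra.
move=> t _; apply: (ex_derive_continuous (fun t => exp (- t) * cos (xi * t))).
by auto_derive.
Qed.

Lemma atan_integral X : is_RInt (fun x => / (1 + x ^ 2)) 0 X (atan X).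
Proof.
have -> : atan X = minus (atan X) (atan 0).
  by rewrite atan_0 /minus /plus /opp /=; ring.
have h x : 0 < 1 + x ^ 2 by have := pow2_ge_0 x; lra.
apply: (is_RInt_derive atan).
  by move=> x _; apply/is_derive_Reals; exact: derivable_pt_lim_atan.
move=> x _; apply: (ex_derive_continuous (fun x => / (1 + x ^ 2))).
by auto_derive; have := h x; lra.
Qed.

(** [atan X] and [atan (/ X)] are complementary, and [atan y <= y] for [y >= 0] because the
    derivative [1/(1+x^2)] is at most [1]. *)
Lemma atan_near_PI2 X : 0 < X -> Rabs (atan X - PI / 2) <= / X.
Proof.
move=> hX.
have hi : 0 < / X := Rinv_0_lt_compat _ hX.
have e : atan X = PI / 2 - atan (/ X) by have := atan_inv (/ X) hi; rewrite Rinv_inv.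
have p : 0 < atan (/ X) by rewrite -atan_0; apply: atan_increasing.
have q : atan (/ X) <= / X.
  have := is_RInt_le _ _ 0 (/ X) _ _ (Rlt_le _ _ hi) (atan_integral (/ X))
    (is_RInt_const (V := R_NormedModule) 0 (/ X) 1).
  rewrite /scal /= /mult /= Rminus_0_r Rmult_1_r; apply => x _.
  rewrite -Rinv_1; apply: Rinv_le_contravar; first lra.
  by have := pow2_ge_0 x; rewrite /=; lra.
by rewrite e Rabs_left1; lra.
Qed.

Lemma Rabs_cos_le x : Rabs (cos x) <= 1.
Proof. by apply: Rabs_le; have := COS_bound x; lra. Qed.
Lemma Rabs_sin_le x : Rabs (sin x) <= 1.
Proof. by apply: Rabs_le; have := SIN_bound x; lra. Qed.

Section RiemannLebesgue.
Variables (w w' : R -> R) (C : R).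
Hypothesis w_derive : forall t, is_derive w t (w' t).
Hypothesis w'_cont : forall t, continuous w' t.
Hypothesis w'_le : forall t, 0 <= t -> Rabs (w' t) <= C.
Hypothesis w0 : w 0 = 0.

Lemma vanishing_continuous t : continuous w t.
Proof. by apply: ex_derive_continuous; eexists; exact: w_derive. Qed.

Lemma vanishing_le t : 0 <= t -> Rabs (w t) <= C * t.
Proof.
move=> ht.
have I : is_RInt w' 0 t (minus (w t) (w 0)).
  by apply: (is_RInt_derive w) => x _; [exact: w_derive|exact: w'_cont].
have := norm_RInt_le_const (V := R_NormedModule) w' 0 t _ C ht _ I.
have -> : minus (w t) (w 0) = w t by rewrite w0 /minus /plus /opp /=; ring.
rewrite /norm /= /abs /= => h.
have := h (fun x Hx => w'_le x (proj1 Hx)); lra.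
Qed.

Lemma derivative_bound_ge0 : 0 <= C.
Proof. exact: Rle_trans (Rabs_pos _) (w'_le 0 (Rle_refl 0)). Qed.

(* Integrating in [xi] first turns [w t cos (xi t)] into [w t / t * sin (X t)],
   to which one integration by parts applies. *)
Lemma double_integral_tail d S X : 0 < d <= S -> 0 < X ->
  Rabs (RInt (fun xi => RInt (fun t => w t * cos (xi * t)) d S) 0 X) <=
  (2 * C + 2 * C * (S / d)) / X.
Proof.
move=> [hd hS] hX.
have hC := derivative_bound_ge0.
pose psi t := w t / t.
have psi_c t : d <= t <= S -> continuous psi t.
  move=> Ht; apply: (continuous_mult w Rinv); first exact: vanishing_continuous.
  by apply: continuous_Rinv; lra.
pose Q x := RInt (fun t => psi t * sin (x * t)) d S.
have DQ xi : is_derive Q xi (RInt (fun t => w t * cos (xi * t)) d S).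
  have -> : RInt (fun t => w t * cos (xi * t)) d S =
     RInt (fun t => psi t * (t * cos (xi * t))) d S.
    apply: RInt_ext => t; rewrite Rmin_left // Rmax_right // => Ht.
    by change (w t * cos (xi * t) = w t / t * (t * cos (xi * t))); field; lra.
  by apply: trig_derive => //; [exact: is_derive_sin'|exact: continuous_cos'].
have IQ : is_RInt (fun xi => RInt (fun t => w t * cos (xi * t)) d S) 0 X (minus (Q X) (Q 0)).
  apply: (is_RInt_derive Q) => xi _; first exact: DQ.
  by apply: cos_integral_continuous => // t _; exact: vanishing_continuous.
rewrite (is_RInt_unique _ _ _ _ IQ).
have Q0 : Q 0 = 0.
  rewrite /Q (RInt_ext _ (fun _ => 0)).
    by rewrite RInt_const /scal /= /mult /= Rmult_0_r.
  by move=> t _; rewrite Rmult_0_l sin_0 Rmult_0_r.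
have -> : minus (Q X) (Q 0) = Q X by rewrite Q0 /minus /plus /opp /=; ring.
(* The derivative of [psi]. As [w] vanishes at [0], [|w t| <= C t], so both terms are at most
   [C / t]; hence the bound [2 C / d]. *)
pose psi' t := w' t / t - w t / t ^ 2.
have psi'_le t : d <= t <= S -> Rabs (psi' t) <= 2 * C / d.
  move=> Ht; apply: Rle_trans (Rabs_triang _ _) _.
  rewrite Rabs_Ropp /Rdiv !Rabs_mult !Rabs_inv (Rabs_pos_eq (t ^ 2)) ?(Rabs_pos_eq t); try nra.
  have h1 := w'_le t ltac:(lra). have h2 := vanishing_le t ltac:(lra).
  have i1 : / t <= / d by apply: Rinv_le_contravar; lra.
  have i2 : 0 < / t by apply: Rinv_0_lt_compat; lra.
  have a1 : Rabs (w' t) * / t <= C * / d.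
    by apply: Rmult_le_compat => //; [exact: Rabs_pos|lra].
  have a2 : Rabs (w t) * / t ^ 2 <= C * / d.
    have -> : C * / d = C * / d * (t * / t) by field; lra.
    have -> : / t ^ 2 = / t * / t by field; lra.
    have : Rabs (w t) * / t * / t <= C * t * / d * / t.
      apply: Rmult_le_compat_r; first lra.
      by apply: Rmult_le_compat => //; [exact: Rabs_pos|lra].
    lra.
  lra.
have BP : is_RInt (fun t => psi t * sin (X * t)) d S (Q X).
  by apply: RInt_correct; apply: trig_integrable => // t; apply: continuous_trig; exact: continuous_sin'.
have DP t : d <= t <= S ->
   is_derive (fun t => - (psi t * cos (X * t)) / X) t
     (psi t * sin (X * t) - psi' t * cos (X * t) / X).
  move=> Ht.
  rewrite /psi /psi'; auto_derive.
    by split; [eexists; exact: w_derive|lra].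
  rewrite (is_derive_unique _ _ _ (w_derive t)); field; lra.
have cP t : d <= t <= S -> continuous (fun t => psi t * sin (X * t) - psi' t * cos (X * t) / X) t.
  move=> Ht.
  apply: (continuous_minus (V := R_NormedModule)).
    apply: (continuous_mult psi (fun t => sin (X * t))); first exact: psi_c.
    by apply: continuous_trig; exact: continuous_sin'.
  apply: (continuous_mult (fun t => psi' t * cos (X * t)) (fun _ => / X)); last exact: continuous_const.
  apply: (continuous_mult psi' (fun t => cos (X * t))); last first.
    by apply: continuous_trig; exact: continuous_cos'.
  apply: (continuous_minus (V := R_NormedModule)).
    apply: (continuous_mult w' Rinv); first exact: w'_cont.
    by apply: continuous_Rinv; lra.
  apply: (continuous_mult w (fun t => / t ^ 2)); first exact: vanishing_continuous.
  by apply: (ex_derive_continuous (fun t => / t ^ 2)); auto_derive; nra.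
have IP := is_RInt_derive (V := R_CompleteNormedModule) (fun t => - (psi t * cos (X * t)) / X)
   (fun t => psi t * sin (X * t) - psi' t * cos (X * t) / X) d S.
rewrite Rmin_left // Rmax_right // in IP.
have {}IP := IP DP cP.
have I3 := is_RInt_minus _ _ _ _ _ _ BP IP.
have N3 := norm_RInt_le_const (V := R_NormedModule) _ d S _ (2 * C / d / X) hS _ I3.
have {N3} : Rabs (Q X - (- (psi S * cos (X * S)) / X - - (psi d * cos (X * d)) / X))
   <= (S - d) * (2 * C / d / X).
  apply: N3 => t Ht.
  rewrite /norm /= /abs /= /minus /plus /opp /=.
  have -> : psi t * sin (X * t) + - (psi t * sin (X * t) - psi' t * cos (X * t) / X) =
     psi' t * cos (X * t) * / X by rewrite /Rdiv; ring.
  rewrite !Rabs_mult (Rabs_pos_eq (/ X)); last by apply: Rlt_le; exact: Rinv_0_lt_compat.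
  apply: Rmult_le_compat_r; first by apply: Rlt_le; exact: Rinv_0_lt_compat.
  have := Rmult_le_compat _ _ _ _ (Rabs_pos _) (Rabs_pos _) (psi'_le t Ht) (Rabs_cos_le (X * t)).
  by rewrite Rmult_1_r.
have psi_le t : d <= t <= S -> Rabs (psi t) <= C.
  move=> Ht; rewrite /psi /Rdiv Rabs_mult Rabs_inv (Rabs_pos_eq t); last lra.
  have i2 : 0 < / t by apply: Rinv_0_lt_compat; lra.
  have := Rmult_le_compat_r _ _ _ (Rlt_le _ _ i2) (vanishing_le t ltac:(lra)).
  by rewrite Rmult_assoc Rinv_r ?Rmult_1_r; lra.
have hb t : d <= t <= S -> Rabs (psi t * cos (X * t) / X) <= C / X.
  move=> Ht; rewrite /Rdiv Rabs_mult (Rabs_mult (psi t)) (Rabs_pos_eq (/ X)); last by apply: Rlt_le; exact: Rinv_0_lt_compat.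
  apply: Rmult_le_compat_r; first by apply: Rlt_le; exact: Rinv_0_lt_compat.
  rewrite -(Rmult_1_r C); apply: Rmult_le_compat; [exact: Rabs_pos|exact: Rabs_pos|exact: psi_le|exact: Rabs_cos_le].
have b1 := hb S ltac:(lra). have b2 := hb d ltac:(lra).
set u := psi S * cos (X * S) in b1 *. set v := psi d * cos (X * d) in b2 *.
have e1 : - u / X - - v / X = v / X - u / X by rewrite /Rdiv; ring.
rewrite e1 => H.
have e2 : forall q z : R, q = (q - z) + z by move=> q z; ring.
rewrite (e2 (Q X) (v / X - u / X)); apply: Rle_trans (Rabs_triang _ _) _.
have H2 : Rabs (v / X - u / X) <= Rabs (v / X) + Rabs (u / X).
  by rewrite -(Rabs_Ropp (u / X)); exact: Rabs_triang.
have H3 : (S - d) * (2 * C / d / X) <= S * (2 * C / d / X).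
  apply: Rmult_le_compat_r; last lra.
  by apply: Rmult_le_pos; [apply: Rmult_le_pos; [lra|]|]; apply: Rlt_le; apply: Rinv_0_lt_compat.
(* The two boundary terms give [2 C / X]; the remaining integral gives at most [S] times
   [2 C / (d X)]. *)
have -> : (2 * C + 2 * C * (S / d)) / X = S * (2 * C / d / X) + (C / X + C / X) by field; lra.
lra.
Qed.

(** Near [0] the oscillation is not exploited: [|w t| <= C t] on a short interval compensates the
    length [X] of the frequency range. *)
Lemma double_integral_head d X : 0 <= d -> 0 <= X ->
  Rabs (RInt (fun xi => RInt (fun t => w t * cos (xi * t)) 0 d) 0 X) <= X * (d * (C * d)).
Proof.
move=> hd hX.
have hC := derivative_bound_ge0.
have := abs_RInt_le_const (fun xi => RInt (fun t => w t * cos (xi * t)) 0 d) 0 X (d * (C * d)) hX.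
rewrite Rminus_0_r; apply.
  apply: (ex_RInt_continuous (V := R_CompleteNormedModule)) => xi _.
  by apply: cos_integral_continuous => // t _; exact: vanishing_continuous.
move=> xi _.
have := abs_RInt_le_const (fun t => w t * cos (xi * t)) 0 d (C * d) hd.
rewrite Rminus_0_r; apply.
  apply: trig_integrable => // [t _|t]; [exact: vanishing_continuous|].
  by apply: continuous_trig; exact: continuous_cos'.
move=> t Ht; rewrite Rabs_mult.
have := Rmult_le_compat _ _ _ _ (Rabs_pos _) (Rabs_pos _) (vanishing_le t (proj1 Ht)) (Rabs_cos_le (xi * t)).
by nra.
Qed.

End RiemannLebesgue.

(** The exponent [7] makes [Y^6 exp(-Y)] of order [1/Y], as the choice [X = Y^6] below requires;
    [823543 = 7^7] comes from [(Y/7)^7 <= exp Y]. *)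
Lemma exp_pow7 Y : 0 <= Y -> Y ^ 7 / 823543 <= exp Y.
Proof.
move=> hY.
have h : Y / 7 <= exp (Y / 7).
  case: (Req_dec Y 0) => [->|hn].
    by rewrite /Rdiv Rmult_0_l; exact: Rlt_le (exp_pos _).
  by have := exp_ineq1 (Y / 7) ltac:(lra); lra.
have -> : exp Y = exp (Y / 7) ^ 7.
  rewrite /= Rmult_1_r -!exp_plus; congr exp; field.
have -> : Y ^ 7 / 823543 = (Y / 7) ^ 7 by field.
apply: pow_incr; lra.
Qed.

(** Subtracting [F(0) exp(-t)], whose cosine transform [1/(1+xi^2)] has the
    primitive [atan], reduces the claim to a function vanishing at [0]; with
    [X = Y^6] the cut-offs [Y^-4] and [Y] make all error terms [O(1/Y)]. *)
Theorem cosine_inversion (F F' : R -> R) (T M : R) :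
  0 < T ->
  (forall t, is_derive F t (F' t)) -> (forall t, continuous F' t) ->
  (forall t, Rabs (F' t) <= M) -> (forall t, T < t -> F t = 0) ->
  forall eps, 0 < eps -> exists X0, forall X, X0 <= X ->
    Rabs (RInt (fun xi => RInt (fun t => F t * cos (xi * t)) 0 T) 0 X - PI / 2 * F 0) <= eps.
Proof.
move=> hT hF hF' hM hs.
have M0 : 0 <= M := Rle_trans _ _ _ (Rabs_pos _) (hM 0).
have Fc t : continuous F t by apply: ex_derive_continuous; eexists; exact: hF.
pose w t := F t - F 0 * exp (- t).
pose w' t := F' t + F 0 * exp (- t).
pose C := M + Rabs (F 0).
have Dw t : is_derive w t (w' t).
  rewrite /w /w'; auto_derive; first by eexists; exact: hF.
  by rewrite (is_derive_unique _ _ _ (hF t)); ring.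
have cw' t : continuous w' t.
  apply: (continuous_plus (V := R_NormedModule)); first exact: hF'.
  by apply: (ex_derive_continuous (fun t => F 0 * exp (- t))); auto_derive.
have bw' t : 0 <= t -> Rabs (w' t) <= C.
  move=> ht; apply: Rle_trans (Rabs_triang _ _) _; rewrite /C.
  apply: Rplus_le_compat; first exact: hM.
  rewrite Rabs_mult -{2}(Rmult_1_r (Rabs (F 0))).
  apply: Rmult_le_compat_l; first exact: Rabs_pos.
  rewrite Rabs_pos_eq; last exact: Rlt_le (exp_pos _).
  rewrite -exp_0; case: (Req_dec t 0) => [->|hn]; first by rewrite Ropp_0; lra.
  by apply: Rlt_le; apply: exp_increasing; lra.
have w0 : w 0 = 0 by rewrite /w Ropp_0 exp_0; ring.
have hC : 0 <= C by apply: Rle_trans (Rabs_pos _) (bw' 0 (Rle_refl 0)).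
have cw t : continuous w t by apply: ex_derive_continuous; eexists; exact: Dw.
(* [5 C] is [C] from the short interval and [4 C] from the tail; [2000000] covers the [1700000] from
   cutting [exp(-t)] at [Y] and the [1] from [atan]. *)
have main Y : 1 <= Y -> T <= Y ->
  Rabs (RInt (fun xi => RInt (fun t => F t * cos (xi * t)) 0 T) 0 (Y ^ 6) - PI / 2 * F 0)
   <= (5 * C + 2000000 * Rabs (F 0)) * / Y.
  move=> h1 hTY.
  have Y0 : 0 < Y by lra.
  have iY : 0 < / Y := Rinv_0_lt_compat _ Y0.
  have iY1 : / Y <= 1 by rewrite -Rinv_1; apply: Rinv_le_contravar; lra.
  (* With these choices [X d^2 = Y^-2] and [(Y/d)/X = 1/Y], the sizes of head and tail up to
     multiples of [C]. *)
  pose X := Y ^ 6. pose d := / Y ^ 4.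
  have hX : 1 <= X by apply: pow_R1_Rle.
  have hd : 0 < d by apply: Rinv_0_lt_compat; apply: pow_lt.
  have hd1 : d <= 1.
    by rewrite -Rinv_1; apply: Rinv_le_contravar; [lra|exact: pow_R1_Rle].
  have J g a b : (forall t, continuous g t) -> a <= b -> forall xi,
    ex_RInt (fun t => g t * cos (xi * t)) a b.
    move=> hg hab xi; apply: trig_integrable => // t.
    by apply: continuous_trig; exact: continuous_cos'.
  have cexp t : continuous (fun t => exp (- t)) t.
    by apply: (ex_derive_continuous (fun t => exp (- t))); auto_derive.
  (* [F = F 0 exp(-t) + w]. As [F] vanishes beyond [T], its integral may be extended to [Y], where
     the two summands are treated separately. *)
  have dec xi : RInt (fun t => F t * cos (xi * t)) 0 T =
    F 0 * RInt (fun t => exp (- t) * cos (xi * t)) 0 Y +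
    (RInt (fun t => w t * cos (xi * t)) 0 d + RInt (fun t => w t * cos (xi * t)) d Y).
    have -> : RInt (fun t => F t * cos (xi * t)) 0 T = RInt (fun t => F t * cos (xi * t)) 0 Y.
      rewrite -(RInt_Chasles (V := R_CompleteNormedModule) _ 0 T Y); try (apply: J => //; lra).
      rewrite (RInt_ext _ (fun _ => 0) T Y).
        by rewrite RInt_const /scal /= /mult /= /plus /= Rmult_0_r Rplus_0_r.
      by move=> t; rewrite Rmin_left // => Ht; rewrite hs ?Rmult_0_l; lra.
    have := RInt_Chasles (V := R_CompleteNormedModule) (fun t => w t * cos (xi * t)) 0 d Y
      (J w 0 d cw (Rlt_le _ _ hd) xi) (J w d Y cw ltac:(lra) xi).
    rewrite /plus /= => ->.
    have := RInt_scal (V := R_CompleteNormedModule) (fun t => exp (- t) * cos (xi * t)) 0 Y (F 0)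
      (J _ 0 Y cexp (Rlt_le _ _ Y0) xi).
    rewrite /scal /= /mult /= => <-.
    have := RInt_plus (V := R_CompleteNormedModule) (fun t => F 0 * (exp (- t) * cos (xi * t)))
      (fun t => w t * cos (xi * t)) 0 Y.
    rewrite /plus /= => <-; [|apply: (ex_RInt_scal (V := R_NormedModule)); apply: J => //; lra|apply: J => //; lra].
    by apply: RInt_ext => t _; change (F t * cos (xi * t) = F 0 * (exp (- t) * cos (xi * t)) + (F t - F 0 * exp (- t)) * cos (xi * t)); ring.
  have ce b c xi : b <= c -> continuous (fun xi => RInt (fun t => w t * cos (xi * t)) b c) xi.
    by move=> hbc; apply: cos_integral_continuous.
  have ie : ex_RInt (fun xi => RInt (fun t => exp (- t) * cos (xi * t)) 0 Y) 0 X.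
    apply: (ex_RInt_continuous (V := R_CompleteNormedModule)) => xi _.
    by apply: cos_integral_continuous => //; lra.
  have i1 : ex_RInt (fun xi => RInt (fun t => w t * cos (xi * t)) 0 d) 0 X.
    by apply: (ex_RInt_continuous (V := R_CompleteNormedModule)) => xi _; apply: ce; lra.
  have i2 : ex_RInt (fun xi => RInt (fun t => w t * cos (xi * t)) d Y) 0 X.
    by apply: (ex_RInt_continuous (V := R_CompleteNormedModule)) => xi _; apply: ce; lra.
  have -> : RInt (fun xi => RInt (fun t => F t * cos (xi * t)) 0 T) 0 (Y ^ 6) =
    F 0 * RInt (fun xi => RInt (fun t => exp (- t) * cos (xi * t)) 0 Y) 0 X +
    (RInt (fun xi => RInt (fun t => w t * cos (xi * t)) 0 d) 0 X +
     RInt (fun xi => RInt (fun t => w t * cos (xi * t)) d Y) 0 X).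
    rewrite (RInt_ext _ _ _ _ (fun xi _ => dec xi)).
    have e1 := RInt_plus (V := R_CompleteNormedModule) _ _ 0 (Y ^ 6)
       (ex_RInt_scal (V := R_NormedModule) _ _ _ (F 0) ie)
       (ex_RInt_plus (V := R_NormedModule) _ _ _ _ i1 i2).
    have e2 := RInt_scal (V := R_CompleteNormedModule) _ _ _ (F 0) ie.
    have e3 := RInt_plus (V := R_CompleteNormedModule) _ _ _ _ i1 i2.
    by rewrite e2 e3 in e1.
  have B1 := double_integral_head w w' C Dw cw' bw' w0 d X (Rlt_le _ _ hd) ltac:(lra).
  have B2 := double_integral_tail w w' C Dw cw' bw' w0 d Y X ltac:(lra) ltac:(lra).
  have B3 : Rabs (RInt (fun xi => RInt (fun t => exp (- t) * cos (xi * t)) 0 Y) 0 X - atan X)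
     <= X * (2 * exp (- Y)).
    have ia := atan_integral X.
    have := is_RInt_minus _ _ _ _ _ _ (RInt_correct _ _ _ ie) ia => I.
    have := norm_RInt_le_const (V := R_NormedModule) _ 0 X _ (2 * exp (- Y)) ltac:(lra) _ I.
    rewrite Rminus_0_r; apply => xi Hxi.
    rewrite (is_RInt_unique _ _ _ _ (exp_cos_integral Y xi)) /norm /= /abs /= /minus /plus /opp /=.
    have hp : 0 < 1 + xi * (xi * 1) by nra.
    match goal with |- Rabs ?x <= _ =>
      have -> : x = exp (- Y) * ((xi * sin (xi * Y) - cos (xi * Y)) / (1 + xi * (xi * 1))) by field; lra end.
    rewrite Rabs_mult (Rabs_pos_eq (exp _)); last exact: Rlt_le (exp_pos _).
    rewrite Rmult_comm; apply: Rmult_le_compat_r; first exact: Rlt_le (exp_pos _).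
    rewrite /Rdiv Rabs_mult Rabs_inv (Rabs_pos_eq (1 + _)); last lra.
    apply: (Rmult_le_reg_r (1 + xi * (xi * 1))) => //.
    rewrite Rmult_assoc Rinv_l ?Rmult_1_r; last lra.
    apply: Rle_trans (Rabs_triang _ _) _; rewrite Rabs_Ropp Rabs_mult (Rabs_pos_eq xi); last lra.
    have := Rabs_cos_le (xi * Y); have := Rabs_sin_le (xi * Y); nra.
  have B4 := atan_near_PI2 X ltac:(lra).
  have c1 : X * (d * (C * d)) <= C * / Y.
    have -> : X * (d * (C * d)) = C * (/ Y * / Y) by rewrite /X /d; field; lra.
    apply: Rmult_le_compat_l => //; nra.
  have c2 : (2 * C + 2 * C * (Y / d)) / X <= 4 * C * / Y.
    have -> : (2 * C + 2 * C * (Y / d)) / X = 2 * C * / X + 2 * C * / Y.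
      by rewrite /X /d; field; lra.
    have : / X <= / Y.
      apply: Rinv_le_contravar => //; rewrite /X.
      have : 1 <= Y ^ 5 by apply: pow_R1_Rle.
      rewrite /= in hX *; nra.
    nra.
  have c3 : X * (2 * exp (- Y)) <= 1700000 * / Y.
    rewrite exp_Ropp.
    have h7 := exp_pow7 Y (Rlt_le _ _ Y0).
    have h8 : / exp Y <= / (Y ^ 7 / 823543).
      apply: Rinv_le_contravar => //; apply: Rdiv_lt_0_compat; [exact: pow_lt|lra].
    have e : / (Y ^ 7 / 823543) = 823543 * / Y ^ 7 by field; lra.
    rewrite e in h8.
    have : X * (2 * / exp Y) <= X * (2 * (823543 * / Y ^ 7)) by nra.
    have -> : X * (2 * (823543 * / Y ^ 7)) = 1647086 * / Y by rewrite /X; field; lra.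
    lra.
  have c4 : / X <= / Y.
    apply: Rinv_le_contravar => //; rewrite /X.
    have : 1 <= Y ^ 5 by apply: pow_R1_Rle.
    rewrite /= in hX *; nra.
  set e := RInt _ 0 X in B3 *; set i := RInt _ 0 X in B1 *; set k := RInt _ 0 X in B2 *.
  have split_err : forall q u v a : R, F 0 * q + (u + v) - PI / 2 * F 0 =
     F 0 * ((q - a) + (a - PI / 2)) + (u + v) by move=> q u v a; ring.
  rewrite (split_err e i k (atan X)).
  apply: Rle_trans (Rabs_triang _ _) _; rewrite Rabs_mult.
  have t1 := Rabs_triang (e - atan X) (atan X - PI / 2).
  have t2 := Rabs_triang i k.
  have t3 := Rabs_pos (F 0).
  have : Rabs (F 0) * Rabs ((e - atan X) + (atan X - PI / 2)) <= Rabs (F 0) * (2000000 * / Y).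
    by apply: Rmult_le_compat_l => //; lra.
  lra.
move=> e He.
pose D := 5 * C + 2000000 * Rabs (F 0).
have hD : 0 <= D by rewrite /D; have := Rabs_pos (F 0); lra.
pose Y0 := Rmax 1 (Rmax T (D / e)).
have y1 : 1 <= Y0 := Rmax_l _ _.
have y2 : Rmax T (D / e) <= Y0 := Rmax_r _ _.
have y3 : T <= Y0 := Rle_trans _ _ _ (Rmax_l _ _) y2.
have y4 : D / e <= Y0 := Rle_trans _ _ _ (Rmax_r _ _) y2.
exists (Y0 ^ 6) => X HX.
have X1 : 1 <= X by apply: Rle_trans HX; apply: pow_R1_Rle.
pose Y := Rpower X (/ 6).
have YX : Y ^ 6 = X.
  rewrite /Y -Rpower_pow; last exact: exp_pos.
  by rewrite Rpower_mult (_ : / 6 * INR 6 = 1) ?Rpower_1; [|lra|rewrite /=; field].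
have YY : Y0 <= Y.
  apply: Rnot_lt_le => h.
  have : Y ^ 6 < Y0 ^ 6.
    have yp : 0 < Y := exp_pos _.
    have : 0 < Y ^ 5 by apply: pow_lt.
    have : Y ^ 5 <= Y0 ^ 5 by apply: pow_incr; lra.
    rewrite (_ : Y ^ 6 = Y * Y ^ 5) // (_ : Y0 ^ 6 = Y0 * Y0 ^ 5) //; nra.
  lra.
rewrite -YX; apply: Rle_trans (main Y ltac:(lra) ltac:(lra)) _.
rewrite -/D.
apply: (Rmult_le_reg_r Y); first lra.
rewrite Rmult_assoc Rinv_l ?Rmult_1_r; last lra.
have -> : D = D / e * e by field; lra.
rewrite (Rmult_comm e); apply: Rmult_le_compat_r; lra.
Qed.

(** * Linear combinations in a normed module *)

Section LinearCombinations.
Local Open Scope list_scope.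
Context {E : NormedModule C_AbsRing}.

(** Syntax of a reflexive normaliser: both sides of a vector identity are read as expressions over
    one list of atoms, and the identity reduces to equality of coefficients in [C]. *)
Inductive lin_expr :=
  | LAtom of nat
  | LZero
  | LPlus of lin_expr & lin_expr
  | LOpp of lin_expr
  | LScal of C & lin_expr.

Fixpoint lin_denote (l : list E) (e : lin_expr) : E :=
  match e with
  | LAtom n => List.nth n l zero
  | LZero => zero
  | LPlus e1 e2 => plus (lin_denote l e1) (lin_denote l e2)
  | LOpp e1 => opp (lin_denote l e1)
  | LScal c e1 => scal (c : C_AbsRing) (lin_denote l e1)
  end.

Fixpoint lin_coef (e : lin_expr) (n : nat) : C :=
  match e with
  | LAtom m => if Nat.eqb m n then RtoC 1 else RtoC 0
  | LZero => RtoC 0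
  | LPlus e1 e2 => Cplus (lin_coef e1 n) (lin_coef e2 n)
  | LOpp e1 => Copp (lin_coef e1 n)
  | LScal c e1 => Cmult c (lin_coef e1 n)
  end.

Fixpoint lin_comb (c : nat -> C) (l : list E) : E :=
  match l with
  | nil => zero
  | x :: l' => plus (scal (c O : C_AbsRing) x) (lin_comb (fun n => c (S n)) l')
  end.

Lemma lin_comb_ext c d l :
  (forall n, (n < length l)%nat -> c n = d n) -> lin_comb c l = lin_comb d l.
Proof.
elim: l c d => [|x l IH] c d H //=.
rewrite (H O) /=; last lia.
by congr plus; apply: IH => n Hn; apply: H => /=; lia.
Qed.

Lemma lin_comb_plus c d l :
  lin_comb (fun n => Cplus (c n) (d n)) l = plus (lin_comb c l) (lin_comb d l).
Proof.
elim: l c d => [|x l IH] c d /=; first by rewrite plus_zero_l.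
rewrite IH -!plus_assoc.
have -> : scal (Cplus (c O) (d O) : C_AbsRing) x =
  plus (scal (c O : C_AbsRing) x) (scal (d O : C_AbsRing) x)
  by exact: (@scal_distr_r C_Ring E).
rewrite -!plus_assoc; congr plus.
by rewrite plus_assoc (plus_comm (scal _ x)) -plus_assoc.
Qed.

Lemma lin_comb_scal a c l :
  lin_comb (fun n => Cmult a (c n)) l = scal (a : C_AbsRing) (lin_comb c l).
Proof.
elim: l c => [|x l IH] c /=; first by rewrite scal_zero_r.
by rewrite IH scal_distr_l scal_assoc.
Qed.

Lemma lin_comb_zero l : lin_comb (fun _ => RtoC 0) l = zero.
Proof.
elim: l => [|x l IH] //=.
by rewrite IH plus_zero_r; exact: (@scal_zero_l C_Ring E).
Qed.

Lemma lin_comb_atom m l :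
  lin_comb (fun n => if Nat.eqb m n then RtoC 1 else RtoC 0) l = List.nth m l zero.
Proof.
elim: l m => [|x l IH] [|m] //=.
  rewrite lin_comb_zero plus_zero_r; exact: (@scal_one C_Ring E).
rewrite IH -[RHS]plus_zero_l; congr plus; exact: (@scal_zero_l C_Ring E).
Qed.

Lemma lin_denoteE l e : lin_denote l e = lin_comb (lin_coef e) l.
Proof.
elim: e => [m||e1 IH1 e2 IH2|e1 IH1|c e1 IH1] /=.
- by rewrite lin_comb_atom.
- by rewrite lin_comb_zero.
- by rewrite lin_comb_plus IH1 IH2.
- rewrite IH1 -(@scal_opp_one C_Ring E).
  rewrite -(lin_comb_scal (Copp (RtoC 1))).
  apply: lin_comb_ext => n _; ring.
- by rewrite lin_comb_scal IH1.
Qed.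

Lemma lin_eq l e1 e2 :
  (forall n, (n < length l)%nat -> lin_coef e1 n = lin_coef e2 n) ->
  lin_denote l e1 = lin_denote l e2.
Proof. by move=> H; rewrite !lin_denoteE; apply: lin_comb_ext. Qed.

End LinearCombinations.

(** Atoms are identified up to conversion, not syntactically. *)
Ltac lin_mem x l :=
  lazymatch l with
  | nil => constr:(false)
  | cons ?y ?l' =>
    let b := match goal with _ => let _ := constr:(eq_refl : x = y) in constr:(true)
             | _ => constr:(false) end in
    lazymatch b with true => constr:(true) | false => lin_mem x l' end
  end.
Ltac lin_index x l :=
  lazymatch l with
  | cons ?y ?l' =>
    let b := match goal with _ => let _ := constr:(eq_refl : x = y) in constr:(true)
             | _ => constr:(false) end in
    lazymatch b with
    | true => constr:(O)
    | false => let n := lin_index x l' in constr:(S n)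
    end
  end.
Ltac lin_atoms t l :=
  lazymatch t with
  | @plus _ ?a ?b => let l' := lin_atoms a l in lin_atoms b l'
  | @minus _ ?a ?b => let l' := lin_atoms a l in lin_atoms b l'
  | @opp _ ?a => lin_atoms a l
  | @scal _ _ _ ?a => lin_atoms a l
  | @zero _ => l
  | ?a => let m := lin_mem a l in
    lazymatch m with true => l | false => constr:(cons a l) end
  end.
Ltac lin_coefficient c :=
  let T := type of c in
  let c' := match goal with _ => constr:(c : C) | _ => constr:(RtoC c) end in c'.
Ltac lin_reify t l :=
  lazymatch t with
  | @plus _ ?a ?b =>
    let a' := lin_reify a l in let b' := lin_reify b l in constr:(LPlus a' b')
  | @minus _ ?a ?b =>
    let a' := lin_reify a l in let b' := lin_reify b l in
    constr:(LPlus a' (LOpp b'))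
  | @opp _ ?a => let a' := lin_reify a l in constr:(LOpp a')
  | @scal _ _ ?c ?a =>
    let a' := lin_reify a l in
    let c' := lin_coefficient c in constr:(LScal c' a')
  | @zero _ => constr:(LZero)
  | ?a => let n := lin_index a l in constr:(LAtom n)
  end.
Ltac lin_cases :=
  match goal with
  | |- forall n, (n < _)%nat -> _ =>
    let n := fresh "n" in let H := fresh "H" in
    move=> n H; simpl in H;
    repeat first [exfalso; lia | destruct n as [|n]; [clear H; simpl | ]]
  end.
(** Proves an equality of linear combinations in a complex normed module [E],
    leaving the equalities of complex coefficients that [ring] cannot solve. *)
Ltac module_eq_in E :=
  match goal with
  | |- ?s = ?t =>
    let l0 := lin_atoms s (@nil (NormedModule.sort C_AbsRing E)) in
    let l := lin_atoms t l0 in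
    let e1 := lin_reify s l in
    let e2 := lin_reify t l in
    change (@lin_denote E l e1 = @lin_denote E l e2);
    apply: lin_eq; lin_cases
  end.
Ltac module_eq E := module_eq_in E; try (unfold one, mult, plus, opp, zero; simpl); try ring.

(** * Vector-valued improper integrals *)

(** Completeness is kept apart from the algebraic structure, so that [E] stays a
    [NormedModule C_AbsRing], as [linop] requires, and scalars and vectors are treated alike. *)
Class complete_space (E : UniformSpace) :=
  complete_mixin : CompleteSpace.mixin_of E.

#[export] Instance complete_C : complete_space C_NormedModule :=
  CompleteNormedModule.mixin _ _ (CompleteNormedModule.class _ C_CompleteNormedModule).

#[export] Instance complete_CompleteNormedModule (E : CompleteNormedModule C_AbsRing) :
  complete_space E :=
  CompleteNormedModule.mixin _ _ (CompleteNormedModule.class _ E).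

(** The home of Riemann integrals. Its normed structure is that of [realify E], so that integrals
    stated over either space are convertible. *)
Definition VR (E : NormedModule C_AbsRing) {cE : complete_space E} :
    CompleteNormedModule R_AbsRing :=
  CompleteNormedModule.Pack R_AbsRing E
    (CompleteNormedModule.Class R_AbsRing E
      (NormedModule.class _ (realify E)) cE) E.

Lemma plus_minus_cancel {G : AbelianGroup} (x y : G) : plus x (minus y x) = y.
Proof. by rewrite /minus plus_comm -plus_assoc plus_opp_l plus_zero_r. Qed.

Lemma norm_minus_sym {K : AbsRing} {V : NormedModule K} (x y : V) :
  norm (minus x y) = norm (minus y x).
Proof. by rewrite -norm_opp opp_minus. Qed.

Lemma norm_minus_le {K : AbsRing} {V : NormedModule K} (x y : V) :
  norm (minus x y) <= norm x + norm y.
Proof. by apply: Rle_trans (norm_triangle _ _) _; rewrite norm_opp; lra. Qed.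

Lemma norm_le_minus {K : AbsRing} {V : NormedModule K} (x y : V) :
  norm x <= norm y + norm (minus x y).
Proof.
have {1}-> : x = plus y (minus x y).
  by rewrite /minus plus_comm -plus_assoc plus_opp_l plus_zero_r.
exact: norm_triangle.
Qed.

Lemma norm_minus_tri {K : AbsRing} {V : NormedModule K} (x y z : V) :
  norm (minus x z) <= norm (minus x y) + norm (minus y z).
Proof.
have -> : minus x z = plus (minus x y) (minus y z) by rewrite (minus_trans y).
exact: norm_triangle.
Qed.

Lemma norm_minus_eq_zero {K : AbsRing} {V : NormedModule K} (x y : V) :
  (forall eps, 0 < eps -> norm (minus x y) <= eps) -> x = y.
Proof.
move=> H.
have h0 : norm (minus x y) = 0.
  apply: Rle_antisym; last exact: norm_ge_0.
  by apply: le_epsilon => e He; rewrite Rplus_0_l; apply: H.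
move/norm_eq_zero: h0 => h0.
by rewrite -(plus_zero_r y) -h0 /minus (plus_comm x) plus_assoc plus_opp_r plus_zero_l.
Qed.

(** Riemann sums commute with linear maps, and boundedness gives the continuity needed in the
    limit. *)
Lemma is_RInt_linear {U V : NormedModule R_AbsRing} (T : U -> V) (f : R -> U)
    a b l :
  is_linear T -> is_RInt f a b l -> is_RInt (fun t => T (f t)) a b (T l).
Proof.
move=> HT H.
have C : filterlim T (locally l) (locally (T l)) by apply: linear_cont.
have := filterlim_comp _ _ _ _ _ _ _ _ H C.
apply: filterlim_ext => ptd /=.
rewrite linear_scal //; congr scal.
move: ptd; apply: SF_cons_ind => [x0|h s IH].
  rewrite /Riemann_sum /=.
  have -> : (zero : U) = scal 0 zero by rewrite scal_zero_r.
  by rewrite linear_scal //; exact: (@scal_zero_l R_Ring).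
by rewrite !Riemann_sum_cons linear_plus // linear_scal // IH.
Qed.

Lemma is_RInt_zero_extend {V : NormedModule R_AbsRing} (f : R -> V) a b a' b' l :
  a' <= a -> b <= b' -> (forall t, a' < t < a \/ b < t < b' -> f t = zero) ->
  is_RInt f a b l -> is_RInt f a' b' l.
Proof.
move=> ha hb Z I.
have Z' u v : u <= v -> (forall t, u < t < v -> f t = zero) -> is_RInt f u v zero.
  move=> uv H; apply: (is_RInt_ext (fun _ => zero)).
    by move=> x; rewrite Rmin_left // Rmax_right // => Hx; rewrite H.
  by have := is_RInt_const u v (zero : V); rewrite scal_zero_r.
have I1 : is_RInt f a' a zero by apply: Z' => // t Ht; apply: Z; left.
have I2 : is_RInt f b b' zero by apply: Z' => // t Ht; apply: Z; right.
have := is_RInt_Chasles _ _ _ _ _ _ I1 (is_RInt_Chasles _ _ _ _ _ _ I I2).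
by rewrite plus_zero_r plus_zero_l.
Qed.

(** Stated with a witness [y] for each [T]: the relation carries integrability on all long
    intervals, which a total [RInt] would hide. *)
Definition improper {V : NormedModule R_AbsRing} (f : R -> V) (l : V) : Prop :=
  forall eps, 0 < eps -> exists T0, forall T, T0 <= T -> exists y,
    is_RInt f 0 T y /\ norm (minus y l) <= eps.

Lemma is_RInt_value_unique {V : NormedModule R_AbsRing} (f : R -> V) a b l1 l2 :
  is_RInt f a b l1 -> is_RInt f a b l2 -> l1 = l2.
Proof.
move=> H1 H2; exact: (filterlim_locally_unique _ _ _ H1 H2).
Qed.

Lemma improper_unique {V : NormedModule R_AbsRing} (f : R -> V) l1 l2 :
  improper f l1 -> improper f l2 -> l1 = l2.
Proof.
move=> H1 H2; apply: norm_minus_eq_zero => e He.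
have [T1 h1] := H1 (e/2) ltac:(lra).
have [T2 h2] := H2 (e/2) ltac:(lra).
have [y1 [i1 n1]] := h1 (Rmax T1 T2) (Rmax_l _ _).
have [y2 [i2 n2]] := h2 (Rmax T1 T2) (Rmax_r _ _).
rewrite -(is_RInt_value_unique _ _ _ _ _ i1 i2) in n2.
have := norm_minus_tri l1 y1 l2; rewrite (norm_minus_sym l1 y1); lra.
Qed.

Lemma improper_ext {V : NormedModule R_AbsRing} (f g : R -> V) l :
  (forall t, 0 <= t -> f t = g t) -> improper f l -> improper g l.
Proof.
move=> H Hf e He; have [T0 h] := Hf e He.
exists (Rmax 0 T0) => T HT.
have h0 := Rmax_l 0 T0; have h1 := Rmax_r 0 T0.
have [y [i n]] := h T ltac:(lra).
exists y; split=> //; apply: is_RInt_ext i => x.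
by rewrite Rmin_left ?Rmax_right; try lra; move=> [hx _]; apply: H; lra.
Qed.

Lemma improper_plus {V : NormedModule R_AbsRing} (f g : R -> V) l1 l2 :
  improper f l1 -> improper g l2 ->
  improper (fun t => plus (f t) (g t)) (plus l1 l2).
Proof.
move=> H1 H2 e He.
have [T1 h1] := H1 (e/2) ltac:(lra).
have [T2 h2] := H2 (e/2) ltac:(lra).
exists (Rmax T1 T2) => T HT.
have [y1 [i1 n1]] := h1 T ltac:(have := Rmax_l T1 T2; lra).
have [y2 [i2 n2]] := h2 T ltac:(have := Rmax_r T1 T2; lra).
exists (plus y1 y2); split; first exact: is_RInt_plus.
have -> : minus (plus y1 y2) (plus l1 l2) = plus (minus y1 l1) (minus y2 l2).
  rewrite /minus opp_plus -!plus_assoc; congr plus.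
  by rewrite !plus_assoc; congr plus; rewrite plus_comm.
apply: Rle_trans (norm_triangle _ _) _; lra.
Qed.

Lemma improper_linear {U V : NormedModule R_AbsRing} (T : U -> V) (f : R -> U) l :
  is_linear T -> improper f l -> improper (fun t => T (f t)) (T l).
Proof.
move=> HT Hf e He.
case: (linear_norm _ HT) => M [HM hM].
have [T0 h] := Hf (e/M) (Rdiv_lt_0_compat _ _ He HM).
exists T0 => X HX; have [y [i n]] := h X HX.
exists (T y); split; first exact: is_RInt_linear.
have -> : minus (T y) (T l) = T (minus y l).
  rewrite /minus linear_plus //; congr plus.
  by rewrite -(scal_opp_one l) -(scal_opp_one (T l)) linear_scal.
apply: Rle_trans (hM _) _.
have -> : e = M * (e/M) by field; lra.
apply: Rmult_le_compat_l => //; lra.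
Qed.

Lemma improper_limit {V : CompleteNormedModule R_AbsRing} (f : R -> V) (u : R -> V) l :
  (forall T, 0 <= T -> is_RInt f 0 T (u T)) ->
  (forall eps, 0 < eps -> exists T0, forall T, T0 <= T -> norm (minus (u T) l) <= eps) ->
  improper f l.
Proof.
move=> H1 H2 e He; have [T0 h] := H2 e He.
exists (Rmax 0 T0) => T HT; have h0 := Rmax_l 0 T0; have h1 := Rmax_r 0 T0.
exists (u T); split; [apply: H1|apply: h]; lra.
Qed.

Lemma is_RInt_exp_decay c D a b : c <> 0 ->
  is_RInt (fun t => D * exp (- c * t)) a b (D / c * (exp (- c * a) - exp (- c * b))).
Proof.
move=> Hc.
have -> : D / c * (exp (- c * a) - exp (- c * b)) =
  minus (- D / c * exp (- c * b)) (- D / c * exp (- c * a)).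
  by rewrite /minus /plus /opp /=; field.
apply: (is_RInt_derive (fun t => - D / c * exp (- c * t))).
  by move=> t _; auto_derive => //; field.
move=> t _; apply: (ex_derive_continuous (fun t => D * exp (- c * t))).
by auto_derive.
Qed.

Lemma exp_decay_small c : 0 < c -> forall D eps, 0 < eps ->
  exists T0, 0 <= T0 /\ forall T, T0 <= T -> D * exp (- c * T) <= eps.
Proof.
move=> Hc D e He.
exists (Rmax 0 (Rabs D / (e * c))); split; first exact: Rmax_l.
move=> T HT.
have h0 := Rmax_l 0 (Rabs D / (e * c)); have h1 := Rmax_r 0 (Rabs D / (e * c)).
apply: (Rle_trans _ (Rabs D * exp (- c * T))).
  by apply: Rmult_le_compat_r; [exact: Rlt_le (exp_pos _)|exact: Rle_abs].
have -> : - c * T = - (c * T) by ring.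
rewrite exp_Ropp.
have hp := exp_pos (c * T).
apply: (Rmult_le_reg_r (exp (c * T))) => //.
rewrite Rmult_assoc Rinv_l ?Rmult_1_r; last lra.
have : 1 + c * T <= exp (c * T).
  have [->|hn] := Req_dec (c * T) 0; first by rewrite exp_0; lra.
  by apply: Rlt_le; apply: exp_ineq1.
move=> h.
have : Rabs D <= e * (c * T).
  have -> : Rabs D = (e * c) * (Rabs D / (e * c)) by field; lra.
  rewrite -Rmult_assoc; apply: Rmult_le_compat_l; last lra.
  by apply: Rlt_le; apply: Rmult_lt_0_compat.
have := Rmult_le_compat_l e _ _ (Rlt_le _ _ He) h; lra.
Qed.

Section ImproperDominated.
Context {V : CompleteNormedModule R_AbsRing}.
Variables (f : R -> V) (D c : R).
Hypothesis Hc : 0 < c.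
Hypothesis f_int : forall T, 0 <= T -> ex_RInt f 0 T.
Hypothesis f_le : forall t, 0 <= t -> norm (f t) <= D * exp (- c * t).

Lemma dominated_RInt_le T1 T2 y : 0 <= T1 <= T2 -> is_RInt f T1 T2 y ->
  norm y <= D / c * exp (- c * T1).
Proof.
move=> HT Hy.
have := norm_RInt_le f _ T1 T2 y _ (proj2 HT) _ Hy
  (is_RInt_exp_decay c D T1 T2 ltac:(lra)).
move=> h; apply: Rle_trans (h _) _.
  by move=> x Hx; apply: f_le; lra.
have HD : 0 <= D.
  have := Rle_trans _ _ _ (norm_ge_0 _) (f_le 0 (Rle_refl 0)).
  by rewrite Rmult_0_r exp_0; lra.
have : 0 <= D / c by apply: Rdiv_le_0_compat.
move=> h2; have := exp_pos (- c * T2) => h3.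
apply: Rmult_le_compat_l => //; lra.
Qed.

Lemma improper_dominated : exists l, improper f l /\ norm l <= D / c.
Proof.
have Hcau : exists l : V, filterlim (fun T => RInt f 0 T) (Rbar_locally p_infty) (locally l).
  apply/(filterlim_locally_cauchy (F := Rbar_locally p_infty)) => eps.
  have [T0 [h0 h]] := exp_decay_small c Hc (D / c) (eps/2) ltac:(have := cond_pos eps; lra).
  exists (fun T => T0 <= T); split.
    by exists T0 => x hx; lra.
  have key : forall u v, T0 <= u <= v -> norm (minus (RInt f 0 v) (RInt f 0 u)) <= eps/2.
    move=> u v Huv.
    have I1 := RInt_correct _ _ _ (f_int u ltac:(lra)).
    have I2 := RInt_correct _ _ _ (f_int v ltac:(lra)).
    have [l Hl] : ex_RInt f u v.
      by apply: (ex_RInt_Chasles_2 f 0 u v); [lra|apply: f_int; lra].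
    have := is_RInt_Chasles _ _ _ _ _ _ I1 Hl => I3.
    rewrite (is_RInt_value_unique _ _ _ _ _ I2 I3).
    have -> : minus (plus (RInt f 0 u) l) (RInt f 0 u) = l.
      by rewrite /minus (plus_comm _ l) -plus_assoc plus_opp_r plus_zero_r.
    apply: Rle_trans (dominated_RInt_le u v l _ Hl) _; first lra.
    by apply: h; lra.
  move=> u v Hu Hv; apply: norm_compat1.
  have he := cond_pos eps.
  case: (Rle_dec u v) => Huv.
    by apply: Rle_lt_trans (key u v _) _; lra.
  by rewrite norm_minus_sym; apply: Rle_lt_trans (key v u _) _; lra.
have [l Hl] := Hcau; exists l.
have Il : improper f l.
  apply: (improper_limit f (fun T => RInt f 0 T)).
    by move=> T HT; apply: RInt_correct; apply: f_int.
  move=> e He.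
  (* A ball of radius [r] yields only [norm < norm_factor * r], so the radius is divided by this
     factor. *)
  have hn := norm_factor_gt_0 (V:=V).
  pose e' := mkposreal _ (Rdiv_lt_0_compat _ _ He hn).
  have [T0 h] := Hl _ (locally_ball l e').
  exists (T0 + 1) => T HT.
  apply: Rlt_le; apply: Rlt_le_trans (norm_compat2 _ _ e' (h T _)) _; first lra.
  by apply: Req_le; rewrite /=; field; lra.
split=> //.
apply: le_epsilon => e He.
have [T0 h] := Il e He.
have h1 := Rmax_l 0 T0; have h2 := Rmax_r 0 T0.
have [y [i n]] := h (Rmax 0 T0) h2.
have := dominated_RInt_le 0 (Rmax 0 T0) y ltac:(lra) i.
rewrite Rmult_0_r exp_0 Rmult_1_r.
have := norm_le_minus l y; rewrite norm_minus_sym; lra.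
Qed.

End ImproperDominated.

(** * Derivatives in a real or complex parameter *)

Notation CC := C_NormedModule.
Notation "a *; x" := (scal (a%C : C_AbsRing) x) (at level 40, left associativity).

Lemma norm_cscal {E : NormedModule C_AbsRing} (a : C) (x : E) :
  norm (a *; x) <= Cmod a * norm x.
Proof. exact: (norm_scal (a : C_AbsRing) x). Qed.

Section Derivatives.
Variables (K : AbsRing) (j : K -> C).
Hypothesis j_abs : forall h, Cmod (j h) = abs h.

(** [j] embeds the parameter field in [C]: the identity for complex derivatives, [RtoC] for
    derivatives along a real parameter. One set of rules serves both. *)
Definition der {E : NormedModule C_AbsRing} (f : K -> E) (x : K) (l : E) :=
  forall eps, 0 < eps -> exists del, 0 < del /\ forall h, abs h < del ->
    norm (minus (minus (f (plus x h)) (f x)) (j h *; l)) <= eps * abs h.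

Definition cnt {E : NormedModule C_AbsRing} (f : K -> E) (x : K) :=
  forall eps, 0 < eps -> exists del, 0 < del /\ forall h, abs h < del ->
    norm (minus (f (plus x h)) (f x)) < eps.

Context {E : NormedModule C_AbsRing}.

Lemma der_cnt (f : K -> E) x l : der f x l -> cnt f x.
Proof.
move=> H e He; have [d [Hd h]] := H 1 Rlt_0_1.
have Hl := norm_ge_0 l.
exists (Rmin d (e / (2 + norm l))); split.
  by apply: Rmin_pos => //; apply: Rdiv_lt_0_compat; lra.
move=> k Hk.
have k1 : abs k < d by apply: Rlt_le_trans Hk (Rmin_l _ _).
have k2 : abs k < e / (2 + norm l) by apply: Rlt_le_trans Hk (Rmin_r _ _).
have := norm_le_minus (minus (f (plus x k)) (f x)) (j k *; l).
have := h k k1; have := norm_cscal (j k) l; rewrite j_abs.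
have : abs k * (2 + norm l) < e.
  have -> : e = e / (2 + norm l) * (2 + norm l) by field; lra.
  by apply: Rmult_lt_compat_r => //; lra.
have := abs_ge_0 k; lra.
Qed.

Lemma cnt_const (c : E) x : cnt (fun _ => c) x.
Proof.
by move=> e He; exists 1; split; [lra|move=> h _; rewrite minus_eq_zero norm_zero].
Qed.

Lemma cnt_plus (f g : K -> E) x :
  cnt f x -> cnt g x -> cnt (fun y => plus (f y) (g y)) x.
Proof.
move=> Hf Hg e He.
have [d1 [p1 h1]] := Hf (e/2) ltac:(lra).
have [d2 [p2 h2]] := Hg (e/2) ltac:(lra).
exists (Rmin d1 d2); split; first exact: Rmin_pos.
move=> h Hh.
have := h1 h (Rlt_le_trans _ _ _ Hh (Rmin_l _ _)).
have := h2 h (Rlt_le_trans _ _ _ Hh (Rmin_r _ _)).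
have -> : minus (plus (f (plus x h)) (g (plus x h))) (plus (f x) (g x)) =
  plus (minus (f (plus x h)) (f x)) (minus (g (plus x h)) (g x)).
  by module_eq E.
move=> ? ?; apply: Rle_lt_trans (norm_triangle _ _) _; lra.
Qed.

Lemma cnt_scal (a : K -> CC) (f : K -> E) x :
  cnt a x -> cnt f x -> cnt (fun y => a y *; f y) x.
Proof.
move=> Ha Hf e He.
have N1 := norm_ge_0 (f x). have N2 := Cmod_ge_0 (a x).
have [d1 [p1 h1]] := Ha (e / (2 * (norm (f x) + 1)))
  ltac:(apply: Rdiv_lt_0_compat; lra).
have [d2 [p2 h2]] := Hf (Rmin 1 (e / (2 * (Cmod (a x) + 1))))
  ltac:(apply: Rmin_pos; [lra|apply: Rdiv_lt_0_compat; lra]).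
exists (Rmin d1 d2); split; first exact: Rmin_pos.
move=> h Hh.
have u := h1 h (Rlt_le_trans _ _ _ Hh (Rmin_l _ _)).
have v := h2 h (Rlt_le_trans _ _ _ Hh (Rmin_r _ _)).
have v1 := Rlt_le_trans _ _ _ v (Rmin_l _ _).
have v2 := Rlt_le_trans _ _ _ v (Rmin_r _ _).
have -> : minus (a (plus x h) *; f (plus x h)) (a x *; f x) =
  plus (Cminus (a (plus x h)) (a x) *; f (plus x h))
       (a x *; minus (f (plus x h)) (f x)).
  by module_eq E.
apply: Rle_lt_trans (norm_triangle _ _) _.
have b1 := norm_cscal (Cminus (a (plus x h)) (a x)) (f (plus x h)).
have b2 := norm_cscal (a x) (minus (f (plus x h)) (f x)).
have b3 := norm_le_minus (f (plus x h)) (f x).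
have b4 : norm (f (plus x h)) <= norm (f x) + 1 by lra.
have b5 : Cmod (Cminus (a (plus x h)) (a x)) * norm (f (plus x h)) <= e/2.
  have -> : e / 2 = e / (2 * (norm (f x) + 1)) * (norm (f x) + 1) by field; lra.
  apply: Rmult_le_compat => //; [exact: Cmod_ge_0|exact: norm_ge_0|].
  exact: Rlt_le u.
have b6 : Cmod (a x) * norm (minus (f (plus x h)) (f x)) < e/2.
  have -> : e / 2 = (Cmod (a x) + 1) * (e / (2 * (Cmod (a x) + 1))) by field; lra.
  apply: Rle_lt_trans (Rmult_le_compat_l _ _ _ N2 (Rlt_le _ _ v2)) _.
  apply: Rmult_lt_compat_r; last lra.
  by apply: Rdiv_lt_0_compat; lra.
apply: Rle_lt_trans (Rplus_le_compat _ _ _ _ b1 b2) _; lra.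
Qed.

Lemma der_const (c : E) x : der (fun _ => c) x zero.
Proof.
move=> e He; exists 1; split; first lra; move=> h _.
have -> : minus (minus c c) (j h *; zero) = zero :> E by module_eq E.
by rewrite norm_zero; apply: Rmult_le_pos; [lra|exact: abs_ge_0].
Qed.

Lemma der_plus (f g : K -> E) x f' g' :
  der f x f' -> der g x g' -> der (fun y => plus (f y) (g y)) x (plus f' g').
Proof.
move=> Hf Hg e He.
have [d1 [p1 h1]] := Hf (e/2) ltac:(lra).
have [d2 [p2 h2]] := Hg (e/2) ltac:(lra).
exists (Rmin d1 d2); split; first exact: Rmin_pos.
move=> h Hh.
have := h1 h (Rlt_le_trans _ _ _ Hh (Rmin_l _ _)).
have := h2 h (Rlt_le_trans _ _ _ Hh (Rmin_r _ _)).
set u := minus (minus (f _) _) _; set v := minus (minus (g _) _) _.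
have -> : minus (minus (plus (f (plus x h)) (g (plus x h))) (plus (f x) (g x)))
   (j h *; plus f' g') = plus u v.
  by rewrite /u /v; module_eq E.
have := abs_ge_0 h.
move=> ? ? ?; apply: Rle_trans (norm_triangle _ _) _; lra.
Qed.

Lemma der_scal (a : K -> CC) (f : K -> E) x (a' : C) f' :
  der a x a' -> der f x f' ->
  der (fun y => a y *; f y) x (plus (a' *; f x) (a x *; f')).
Proof.
move=> Ha Hf e He.
have N1 := norm_ge_0 (f x). have N2 := Cmod_ge_0 (a x).
have N3 := Cmod_ge_0 a'.
have [d1 [p1 h1]] := Ha (e / (3 * (norm (f x) + 1)))
  ltac:(apply: Rdiv_lt_0_compat; lra).
have [d2 [p2 h2]] := Hf (e / (3 * (Cmod (a x) + 1)))
  ltac:(apply: Rdiv_lt_0_compat; lra).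
have [d3 [p3 h3]] := der_cnt f x f' Hf (Rmin 1 (e / (3 * (Cmod a' + 1))))
  ltac:(apply: Rmin_pos; [lra|apply: Rdiv_lt_0_compat; lra]).
exists (Rmin d1 (Rmin d2 d3)); split; first by do ?apply: Rmin_pos.
move=> h Hh.
have hh := abs_ge_0 h.
have hr := Rlt_le_trans _ _ _ Hh (Rmin_r _ _).
have u := h1 h (Rlt_le_trans _ _ _ Hh (Rmin_l _ _)).
have v := h2 h (Rlt_le_trans _ _ _ hr (Rmin_l _ _)).
have w := h3 h (Rlt_le_trans _ _ _ hr (Rmin_r _ _)).
have w1 := Rlt_le_trans _ _ _ w (Rmin_l _ _).
have w2 := Rlt_le_trans _ _ _ w (Rmin_r _ _).
(* The remainder of [a] acts on [f (x + h)], the linear part of [a] on the increment of [f], and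
   [a x] on the remainder of [f]; each gets a third of [e]. *)
have -> : minus (minus (a (plus x h) *; f (plus x h)) (a x *; f x))
    (j h *; plus (a' *; f x) (a x *; f')) =
  plus (Cminus (Cminus (a (plus x h)) (a x)) (Cmult (j h) a') *; f (plus x h))
   (plus (Cmult (j h) a' *; minus (f (plus x h)) (f x))
       (a x *; minus (minus (f (plus x h)) (f x)) (j h *; f'))).
  by module_eq E.
set D := Cminus (Cminus _ _) _.
set F := minus (minus (f _) _) _ in v *.
apply: Rle_trans (norm_triangle _ _) _.
have b0 := norm_triangle (Cmult (j h) a' *; minus (f (plus x h)) (f x)) (a x *; F).
have b1 := norm_cscal D (f (plus x h)).
have b2 := norm_cscal (Cmult (j h) a') (minus (f (plus x h)) (f x)).
have b2' := norm_cscal (a x) F.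
have b3 := norm_le_minus (f (plus x h)) (f x).
have b4 : norm (f (plus x h)) <= norm (f x) + 1 by lra.
have b5 : Cmod D * norm (f (plus x h)) <= e/3 * abs h.
  have -> : e / 3 * abs h = e / (3 * (norm (f x) + 1)) * abs h * (norm (f x) + 1)
    by field; lra.
  apply: Rmult_le_compat => //; [exact: Cmod_ge_0|exact: norm_ge_0].
have b6 : Cmod (Cmult (j h) a') * norm (minus (f (plus x h)) (f x)) <= e/3 * abs h.
  rewrite Cmod_mult j_abs.
  have -> : e / 3 * abs h = abs h * (Cmod a' + 1) * (e / (3 * (Cmod a' + 1)))
    by field; lra.
  apply: Rmult_le_compat; [|exact: norm_ge_0| |exact: Rlt_le w2].
    exact: Rmult_le_pos.
  by apply: Rmult_le_compat_l => //; lra.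
have b7 : Cmod (a x) * norm F <= e/3 * abs h.
  have -> : e / 3 * abs h = (Cmod (a x) + 1) * (e / (3 * (Cmod (a x) + 1)) * abs h)
    by field; lra.
  by apply: Rmult_le_compat => //; [exact: norm_ge_0|lra].
apply: Rle_trans (Rplus_le_compat _ _ _ _ b1 b0) _.
apply: Rle_trans (Rplus_le_compat_l _ _ _ (Rplus_le_compat _ _ _ _ b2 b2')) _; lra.
Qed.

End Derivatives.

Notation cder := (der C_AbsRing (fun z : C => z)).
Notation ccnt := (cnt C_AbsRing).
Notation rder := (der R_AbsRing RtoC).
Notation rcnt := (cnt R_AbsRing).

Lemma C_abs (h : C_AbsRing) : Cmod h = abs h. Proof. by []. Qed.
Lemma RtoC_abs (h : R_AbsRing) : Cmod (RtoC h) = abs h.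
Proof. exact: Cmod_R. Qed.

Section Chain.
Variables (K : AbsRing) (j : K -> C).
Hypothesis j_abs : forall h, Cmod (j h) = abs h.
Context {E : NormedModule C_AbsRing}.

Lemma cnt_comp (g : C -> E) (a : K -> CC) x :
  cnt K a x -> ccnt g (a x) -> cnt K (fun y => g (a y)) x.
Proof.
move=> Ha Hg e He.
have [d1 [p1 h1]] := Hg e He.
have [d2 [p2 h2]] := Ha d1 p1.
exists d2; split=> // h Hh.
have := h1 _ (h2 h Hh).
by rewrite (plus_minus_cancel (a x : C_AbsRing)).
Qed.

(** The outer function is complex differentiable while the parameter of the inner one may be real;
    this is what differentiates along rays. *)
Lemma der_comp (g : C -> E) (a : K -> CC) x (a' : C) g' :
  der K j a x a' -> cder g (a x) g' -> der K j (fun y => g (a y)) x (a' *; g').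
Proof.
move=> Ha Hg e He.
have N1 := norm_ge_0 g'. have N3 := Cmod_ge_0 a'.
have [d1 [p1 h1]] := Hg (e / (2 * (Cmod a' + 1)))
  ltac:(apply: Rdiv_lt_0_compat; lra).
have [d2 [p2 h2]] := Ha (Rmin 1 (e / (2 * (norm g' + 1))))
  ltac:(apply: Rmin_pos; [lra|apply: Rdiv_lt_0_compat; lra]).
have [d3 [p3 h3]] := der_cnt K j j_abs a x a' Ha d1 p1.
exists (Rmin d2 d3); split; first exact: Rmin_pos.
move=> h Hh.
have hh := abs_ge_0 h.
have u := h2 h (Rlt_le_trans _ _ _ Hh (Rmin_l _ _)).
have v := h3 h (Rlt_le_trans _ _ _ Hh (Rmin_r _ _)).
have w := h1 _ v.
have e1 : plus (a x) (minus (a (plus x h)) (a x)) = a (plus x h).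
  exact: (plus_minus_cancel (a x : C_AbsRing)).
rewrite e1 in w.
set dl : C := minus (a (plus x h)) (a x) in u v w *.
have -> : minus (minus (g (a (plus x h))) (g (a x))) (j h *; (a' *; g')) =
  plus (minus (minus (g (a (plus x h))) (g (a x))) (dl *; g'))
    (Cminus dl (Cmult (j h) a') *; g').
  by module_eq E.
have u1 : Cmod (Cminus dl (Cmult (j h) a')) <= abs h.
  apply: Rle_trans u _; rewrite -{2}(Rmult_1_l (abs h)).
  by apply: Rmult_le_compat_r => //; exact: Rmin_l.
have u2 : Cmod (Cminus dl (Cmult (j h) a')) <= e / (2 * (norm g' + 1)) * abs h.
  by apply: Rle_trans u _; apply: Rmult_le_compat_r => //; exact: Rmin_r.
have u3 : Cmod dl <= (Cmod a' + 1) * abs h.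
  have := norm_le_minus (dl : CC) (Cmult (j h) a').
  have : norm (Cmult (j h) a' : CC) = abs h * Cmod a' by rewrite -j_abs -Cmod_mult.
  move=> -> q; apply: Rle_trans q _.
  apply: Rle_trans (Rplus_le_compat_l _ _ _ u1) _; lra.
apply: Rle_trans (norm_triangle _ _) _.
have b1 : e / (2 * (Cmod a' + 1)) * Cmod dl <= e/2 * abs h.
  have -> : e / 2 * abs h = e / (2 * (Cmod a' + 1)) * ((Cmod a' + 1) * abs h) by field; lra.
  apply: Rmult_le_compat_l => //; apply: Rlt_le; apply: Rdiv_lt_0_compat; lra.
have b2 : norm (Cminus dl (Cmult (j h) a') *; g') <= e/2 * abs h.
  apply: Rle_trans (norm_cscal _ _) _.
  have -> : e / 2 * abs h = e / (2 * (norm g' + 1)) * abs h * (norm g' + 1) by field; lra.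
  apply: Rmult_le_compat => //; [exact: Cmod_ge_0|lra].
apply: Rle_trans (Rplus_le_compat _ _ _ _ (Rle_trans _ _ _ w b1) b2) _; lra.
Qed.

End Chain.

Lemma der_eq {K : AbsRing} {j : K -> C} {E : NormedModule C_AbsRing}
  (f : K -> E) x l l' : der K j f x l -> l = l' -> der K j f x l'.
Proof. by move=> H <-. Qed.

Lemma der_ext {K : AbsRing} {j : K -> C} {E : NormedModule C_AbsRing}
  (f g : K -> E) x l : (forall y, f y = g y) -> der K j f x l -> der K j g x l.
Proof.
by move=> H Hf e He; have [d [p h]] := Hf e He; exists d; split=> // k; rewrite -!H; apply: h.
Qed.

Lemma cnt_ext {K : AbsRing} {E : NormedModule C_AbsRing}
  (f g : K -> E) x : (forall y, f y = g y) -> cnt K f x -> cnt K g x.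
Proof.
by move=> H Hf e He; have [d [p h]] := Hf e He; exists d; split=> // k; rewrite -!H; apply: h.
Qed.

Lemma cnt_Cmult {K : AbsRing} (a b : K -> CC) x :
  cnt K a x -> cnt K b x -> cnt K (fun y => Cmult (a y) (b y) : CC) x.
Proof. exact: cnt_scal. Qed.

Lemma der_Cmult {K : AbsRing} {j : K -> C} (j_abs : forall h, Cmod (j h) = abs h)
  (a b : K -> CC) x (a' b' : C) : der K j a x a' -> der K j b x b' ->
  der K j (fun y => Cmult (a y) (b y) : CC) x (Cplus (Cmult a' (b x)) (Cmult (a x) b')).
Proof. exact: der_scal. Qed.

Lemma cder_id z : cder (fun w => w : CC) z (RtoC 1).
Proof.
move=> e He; exists 1; split; first lra; move=> h _.
have -> : minus (minus (plus z h : CC) z) (h *; (RtoC 1 : CC)) = zero.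
  by rewrite /minus /plus /opp /zero /scal /= /mult /=; ring.
by rewrite norm_zero; apply: Rmult_le_pos; [lra|exact: abs_ge_0].
Qed.

Lemma rder_line (z d : C) t :
  rder (fun s => Cplus z (Cmult (RtoC s) d) : CC) t d.
Proof.
move=> e He; exists 1; split; first lra; move=> h _.
have -> : minus (minus (Cplus z (Cmult (RtoC (plus t h)) d) : CC)
    (Cplus z (Cmult (RtoC t) d))) (RtoC h *; (d : CC)) = zero.
  rewrite /minus /plus /opp /zero /scal /= /mult /= RtoC_plus; ring.
by rewrite norm_zero; apply: Rmult_le_pos; [lra|exact: abs_ge_0].
Qed.

Section RealCalculus.
Context {E : NormedModule C_AbsRing} {cE : complete_space E}.

Lemma rcnt_continuous (u : R -> E) t :
  rcnt u t -> continuous (u : R -> VR E) t.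
Proof.
move=> H; apply/filterlim_locally => eps.
have [d [Hd h]] := H eps (cond_pos eps).
exists (mkposreal d Hd) => s Hs; apply: norm_compat1.
have := h (minus s t) Hs.
by rewrite plus_minus_cancel.
Qed.

Lemma continuous_rcnt (u : R -> E) t :
  continuous (u : R -> VR E) t -> rcnt u t.
Proof.
move=> H e He.
have hn := @norm_factor_gt_0 _ (@VR E cE).
pose e' := mkposreal _ (Rdiv_lt_0_compat _ _ He hn).
have [d Hd] := H _ (locally_ball (u t : VR E) e').
exists d; split; first exact: cond_pos.
move=> h Hh.
have B : ball t d (plus t h).
  rewrite /ball /= /AbsRing_ball.
  have -> : minus (plus t h) t = h.
    by rewrite /minus (plus_comm t) -plus_assoc plus_opp_r plus_zero_r.
  exact: Hh.
apply: Rlt_le_trans (norm_compat2 _ _ e' (Hd _ B)) _.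
by apply: Req_le; rewrite /=; field; exact: Rgt_not_eq.
Qed.

Lemma rder_is_derive (u : R -> E) t l :
  rder u t l -> is_derive (u : R -> VR E) t l.
Proof.
move=> H; split; first exact: is_linear_scal_l.
move=> x Hx e.
have -> : x = t.
  by symmetry; apply: (is_filter_lim_locally_unique t x).
have [d [Hd h]] := H e (cond_pos e).
exists (mkposreal d Hd) => s Hs.
have := h (minus s t) Hs.
have -> : plus t (minus s t) = s.
  exact: plus_minus_cancel.
by [].
Qed.

Lemma rder_RInt (u u' : R -> E) a b :
  (forall t, Rmin a b <= t <= Rmax a b -> rder u t (u' t)) ->
  (forall t, Rmin a b <= t <= Rmax a b -> rcnt u' t) ->
  is_RInt (V := VR E) u' a b (minus (u b) (u a)).
Proof.
move=> H1 H2.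
apply: (is_RInt_derive (V := VR E)).
  by move=> x Hx; apply: rder_is_derive; apply: H1.
by move=> x Hx; apply: rcnt_continuous; apply: H2.
Qed.

Lemma rcnt_ex_RInt (u : R -> E) a b :
  (forall t, Rmin a b <= t <= Rmax a b -> rcnt u t) ->
  ex_RInt (V := VR E) u a b.
Proof.
move=> H; apply: (ex_RInt_continuous (V := VR E)) => z Hz.
by apply: rcnt_continuous; apply: H.
Qed.

Lemma is_linear_cscal (a : C) : is_linear (fun x : VR E => (a *; (x : E)) : VR E).
Proof.
split.
- by move=> x y; exact: (scal_distr_l (a : C_AbsRing) (x : E) y).
- move=> k x; change (a *; (RtoC k *; (x : E)) = RtoC k *; (a *; (x : E))).
  by module_eq E.
- exists (Cmod a + 1); have := Cmod_ge_0 a; split; first lra.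
  move=> x; apply: Rle_trans (norm_cscal a (x : E)) _.
  by apply: Rmult_le_compat_r; [exact: norm_ge_0|lra].
Qed.

Lemma is_linear_cscal_vector (x : E) : is_linear (fun a : VR CC => ((a : C) *; x) : VR E).
Proof.
split.
- by move=> a b; exact: (scal_distr_r (a : C_AbsRing) b x).
- move=> k a; change (Cmult (RtoC k) a *; x = RtoC k *; ((a : C) *; x)).
  by module_eq E.
- exists (norm x + 1); have := norm_ge_0 x; split; first lra.
  move=> a; apply: Rle_trans (norm_cscal a x) _; rewrite Rmult_comm.
  by apply: Rmult_le_compat_r; [exact: Cmod_ge_0|lra].
Qed.

(** Two integrations of the bound on [u'']; the sharp factor [1/2] is given up. *)
Lemma taylor2 (u u' u'' : R -> E) M :
  (forall t, 0 <= t <= 1 -> rder u t (u' t)) ->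
  (forall t, 0 <= t <= 1 -> rder u' t (u'' t)) ->
  (forall t, 0 <= t <= 1 -> rcnt u'' t) ->
  (forall t, 0 <= t <= 1 -> norm (u'' t) <= M) ->
  norm (minus (minus (u 1) (u 0)) (u' 0)) <= M.
Proof.
move=> H0 H1 H2 H3.
have M0 : 0 <= M by apply: Rle_trans (norm_ge_0 (u'' 0)) (H3 0 _); lra.
have D : forall s, 0 <= s <= 1 -> norm (minus (u' s) (u' 0)) <= M.
  move=> s Hs.
  have I : is_RInt (V := @VR E cE) u'' 0 s (minus (u' s) (u' 0)).
    by apply: rder_RInt; rewrite Rmin_left ?Rmax_right; try lra;
      move=> t Ht; [apply: H1|apply: H2]; lra.
  have := norm_RInt_le_const (V := VR E) u'' 0 s _ M (proj1 Hs) _ I.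
  move=> h; apply: Rle_trans (h _) _; first by move=> x Hx; apply: H3; lra.
  by rewrite Rminus_0_r -{2}(Rmult_1_l M); apply: Rmult_le_compat_r; lra.
have I : is_RInt (V := @VR E cE) u' 0 1 (minus (u 1) (u 0)).
  apply: rder_RInt; rewrite Rmin_left ?Rmax_right; try lra; first exact: H0.
  by move=> t Ht; apply: (der_cnt _ RtoC RtoC_abs); apply: H1.
have I2 := is_RInt_minus _ _ _ _ _ _ I (is_RInt_const (V := VR E) 0 1 (u' 0)).
have := norm_RInt_le_const (V := VR E) _ 0 1 _ M Rle_0_1 D I2.
by rewrite Rminus_0_r Rmult_1_l (scal_one (u' 0 : @VR E cE)).
Qed.

End RealCalculus.

(** * Contour integrals *)

(** [n] pieces of length [H/n] contribute [M H^2 / n] in total, which tends to [0]. *)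
Lemma quadratic_increments_constant (P : R -> R -> R) M H : 0 <= H ->
  (forall x y z, P x z <= P x y + P y z) ->
  (forall x, 0 <= x <= H -> P x x <= 0) ->
  (forall x y, 0 <= x -> x <= y -> y <= H -> P x y <= M * (y - x) ^ 2) ->
  P 0 H <= 0.
Proof.
move=> HH tri refl inc.
have step n : (0 < n)%nat -> P 0 H <= M * H ^ 2 / INR n.
  move=> Hn; have Hn' : 0 < INR n by apply: lt_0_INR.
  have A : forall k, (k <= n)%nat ->
      P 0 (INR k * (H / INR n)) <= INR k * (M * (H / INR n) ^ 2).
    elim=> [|k IH] Hk.
      by rewrite /= !Rmult_0_l; apply: refl; lra.
    apply: Rle_trans (tri _ (INR k * (H / INR n)) _) _.
    have IH' := IH ltac:(lia).
    have hk : INR (S k) = INR k + 1 by rewrite S_INR.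
    have hk2 : INR (S k) <= INR n by apply: le_INR.
    have q : 0 <= H / INR n by apply: Rdiv_le_0_compat.
    have q2 : INR (S k) * (H / INR n) <= H.
      have {2}-> : H = INR n * (H / INR n) by field; lra.
      exact: Rmult_le_compat_r.
    have p := pos_INR k.
    have := inc (INR k * (H / INR n)) (INR (S k) * (H / INR n)) _ _ q2.
    have -> : INR (S k) * (H / INR n) - INR k * (H / INR n) = H / INR n
      by rewrite hk; ring.
    move=> h; have := h (Rmult_le_pos _ _ p q) _; rewrite hk; nra.
  have := A n (Nat.le_refl n).
  have -> : INR n * (H / INR n) = H by field; lra.
  have -> : INR n * (M * (H / INR n) ^ 2) = M * H ^ 2 / INR n by field; lra.
  by [].
apply: le_epsilon => e He; rewrite Rplus_0_l.
have [n Hn] := nfloor_ex (Rmax 0 (M * H ^ 2 / e)) (Rmax_l _ _).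
apply: Rle_trans (step (S n) ltac:(lia)) _.
have hn : 0 < INR (S n) by apply: lt_0_INR; lia.
have h2 : M * H ^ 2 / e <= INR (S n).
  by rewrite S_INR; have := Rmax_r 0 (M * H ^ 2 / e); lra.
apply: (Rmult_le_reg_r (INR (S n))) => //.
have -> : M * H ^ 2 / INR (S n) * INR (S n) = M * H ^ 2 / e * e by field; lra.
by rewrite (Rmult_comm e); apply: Rmult_le_compat_r; lra.
Qed.

Section Contour.
Context {E : NormedModule C_AbsRing} {cE : complete_space E}.
Variable iota : C.
Hypothesis iota_sq : Cmult iota iota = RtoC (-1).

Lemma iota_mod : Cmod iota = 1.
Proof.
have h : Cmod iota * Cmod iota = 1.
  by rewrite -Cmod_mult iota_sq Cmod_R Rabs_left; lra.
have := Cmod_ge_0 iota; nra.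
Qed.

Definition ray (a s : C) (t : R) : C := Cplus a (Cmult (RtoC t) s).

(** The integral of [g] along the L-shaped path that comes from infinity to
    [a] along [a - iota t] and leaves along [a + t], up to the factor [+-1]
    between [iota] and [Ci]. *)
Definition contour (g : C -> E) (a : C) (l : E) : Prop :=
  improper (V := VR E)
    (fun t => plus (g (ray a (RtoC 1) t)) (iota *; g (ray a (Copp iota) t))) l.

Definition on_rays (a : C) (P : R -> C -> Prop) : Prop :=
  forall t, 0 <= t -> P t (ray a (RtoC 1) t) /\ P t (ray a (Copp iota) t).

Lemma rcnt_ray (g : C -> E) a s t : ccnt g (ray a s t) ->
  rcnt (fun t => g (ray a s t)) t.
Proof.
move=> H; apply: (cnt_comp _ g (fun t => ray a s t)) => //.
by apply: (der_cnt _ RtoC RtoC_abs); apply: rder_line.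
Qed.

Lemma contour_rcnt (g : C -> E) a t :
  ccnt g (ray a (RtoC 1) t) -> ccnt g (ray a (Copp iota) t) ->
  rcnt (fun t => plus (g (ray a (RtoC 1) t)) (iota *; g (ray a (Copp iota) t))) t.
Proof.
move=> H1 H2; apply: cnt_plus; first exact: rcnt_ray.
by apply: cnt_scal; [exact: cnt_const|exact: rcnt_ray].
Qed.

Lemma contour_ex_RInt (g : C -> E) a T :
  on_rays a (fun _ z => ccnt g z) -> 0 <= T ->
  ex_RInt (V := VR E)
    (fun t => plus (g (ray a (RtoC 1) t)) (iota *; g (ray a (Copp iota) t))) 0 T.
Proof.
move=> H HT; apply: rcnt_ex_RInt => t; rewrite Rmin_left // Rmax_right // => Ht.
by have [h1 h2] := H t (proj1 Ht); apply: contour_rcnt.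
Qed.

Lemma contour_integrand_le (g : C -> E) a D t :
  norm (g (ray a (RtoC 1) t)) <= D * exp (- t) ->
  norm (g (ray a (Copp iota) t)) <= D * exp (- t) ->
  norm (plus (g (ray a (RtoC 1) t)) (iota *; g (ray a (Copp iota) t))) <=
    2 * D * exp (- (1) * t).
Proof.
move=> H1 H2; apply: Rle_trans (norm_triangle _ _) _.
have := norm_cscal iota (g (ray a (Copp iota) t)); rewrite iota_mod.
have -> : - (1) * t = - t by ring.
lra.
Qed.

Lemma contour_ex (g : C -> E) a D :
  on_rays a (fun t z => ccnt g z /\ norm (g z) <= D * exp (- t)) ->
  exists l, contour g a l /\ norm l <= 2 * D.
Proof.
move=> H.
have [|t Ht|l [Hl n]] := improper_dominated (V := @VR E cE) _ (2 * D) 1 Rlt_0_1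
  (fun T HT => contour_ex_RInt g a T _ HT).
- by move=> t Ht; have [[? _] [? _]] := H t Ht.
- by have [[_ ?] [_ ?]] := H t Ht; apply: contour_integrand_le.
exists l; split=> //; apply: Rle_trans n _; lra.
Qed.

Lemma contour_le (g : C -> E) a D l :
  on_rays a (fun t z => ccnt g z /\ norm (g z) <= D * exp (- t)) ->
  contour g a l -> norm l <= 2 * D.
Proof.
move=> H Hl; have [l' [Hl' n]] := contour_ex g a D H.
by rewrite (improper_unique _ _ _ Hl Hl').
Qed.

Lemma contour_plus (g h : C -> E) a l m :
  contour g a l -> contour h a m -> contour (fun z => plus (g z) (h z)) a (plus l m).
Proof.
move=> H1 H2; apply: improper_ext (improper_plus _ _ _ _ H1 H2) => t _ /=.
by module_eq E.
Qed.

Lemma contour_scal (c : C) (g : C -> E) a l :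
  contour g a l -> contour (fun z => c *; g z) a (c *; l).
Proof.
move=> H; apply: improper_ext (improper_linear _ _ _ (is_linear_cscal c) H) => t _ /=.
by module_eq E.
Qed.

Lemma contour_unique (g : C -> E) a l m : contour g a l -> contour g a m -> l = m.
Proof. exact: improper_unique. Qed.

Lemma contour_ext (g h : C -> E) a l :
  on_rays a (fun _ z => g z = h z) -> contour g a l -> contour h a l.
Proof.
by move=> H; apply: improper_ext => t Ht; have [-> ->] := H t Ht.
Qed.

(** The integrand is the derivative of [g (a + t) - g (a - iota t)], which is [0] at [t = 0] and
    tends to [0] at infinity. *)
Lemma contour_derivative (g g1 : C -> E) a D :
  on_rays a (fun t z => cder g z (g1 z) /\ ccnt g1 z /\ norm (g z) <= D * exp (- t)) ->
  contour g1 a zero.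
Proof.
move=> H.
apply: (improper_limit (V := @VR E cE) _
  (fun T => minus (minus (g (ray a (RtoC 1) T)) (g (ray a (Copp iota) T)))
     (minus (g (ray a (RtoC 1) 0)) (g (ray a (Copp iota) 0))))).
  move=> T HT.
  apply: (rder_RInt (fun t => minus (g (ray a (RtoC 1) t)) (g (ray a (Copp iota) t)))).
    move=> t; rewrite Rmin_left // Rmax_right // => Ht.
    have [[h1 _] [h2 _]] := H t (proj1 Ht).
    have r1 := der_comp _ RtoC RtoC_abs g _ t _ _ (rder_line a (RtoC 1) t) h1.
    have r2 := der_comp _ RtoC RtoC_abs g _ t _ _ (rder_line a (Copp iota) t) h2.
    have r3 := der_scal _ RtoC RtoC_abs _ _ t _ _
       (der_const _ RtoC (RtoC (-1)) t) r2.
    have r4 := der_plus _ RtoC _ _ t _ _ r1 r3.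
    have e1 : forall s, plus (g (ray a (RtoC 1) s)) (RtoC (-1) *; g (ray a (Copp iota) s))
      = minus (g (ray a (RtoC 1) s)) (g (ray a (Copp iota) s)).
      by move=> s; module_eq E.
    apply: der_eq (der_ext _ _ _ _ e1 r4) _.
    by module_eq E; rewrite /zero /=; ring.
  move=> t; rewrite Rmin_left // Rmax_right // => Ht.
  by have [[_ [? _]] [_ [? _]]] := H t (proj1 Ht); apply: contour_rcnt.
move=> e He.
have [T0 [h0 hT]] := exp_decay_small 1 Rlt_0_1 (2 * D) e He.
exists T0 => T HT.
have [[_ [_ b1]] [_ [_ b2]]] := H T ltac:(lra).
have -> : minus (minus (minus (g (ray a (RtoC 1) T)) (g (ray a (Copp iota) T)))
     (minus (g (ray a (RtoC 1) 0)) (g (ray a (Copp iota) 0)))) (zero : @VR E cE)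
  = minus (g (ray a (RtoC 1) T)) (g (ray a (Copp iota) T)) :> E.
  have e0 : forall s, ray a s 0 = a by move=> s; rewrite /ray; ring.
  by rewrite !e0; module_eq E.
apply: Rle_trans (norm_minus_le (V := E) _ _) _.
have := hT T HT.
have -> : - (1) * T = - T by ring.
lra.
Qed.

(** Two explicit derivatives are all the regularity from which [contour_translate] draws its
    quadratic Taylor remainder. *)
Definition jet2 (g g1 g2 : C -> E) (z : C) : Prop :=
  cder g z (g1 z) /\ cder g1 z (g2 z) /\ ccnt g2 z.

Lemma jet2_taylor (g g1 g2 : C -> E) (z w : C) M :
  (forall t, 0 <= t <= 1 -> jet2 g g1 g2 (ray z w t) /\ norm (g2 (ray z w t)) <= M) ->
  norm (minus (minus (g (Cplus z w)) (g z)) (w *; g1 z)) <= Cmod w ^ 2 * M.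
Proof.
move=> H.
have := taylor2 (fun t => g (ray z w t)) (fun t => w *; g1 (ray z w t))
  (fun t => Cmult w w *; g2 (ray z w t)) (Cmod w ^ 2 * M).
have -> : ray z w 1 = Cplus z w by rewrite /ray; ring.
have -> : ray z w 0 = z by rewrite /ray; ring.
apply.
- move=> t Ht; have [[h _] _] := H t Ht.
  exact: (der_comp _ RtoC RtoC_abs g _ t _ _ (rder_line z w t) h).
- move=> t Ht; have [[_ [h _]] _] := H t Ht.
  have r := der_comp _ RtoC RtoC_abs g1 _ t _ _ (rder_line z w t) h.
  apply: der_eq (der_scal _ RtoC RtoC_abs _ _ t _ _ (der_const _ RtoC (w : CC) t) r) _.
  by module_eq E; rewrite /zero /=; ring.
- move=> t Ht; have [[_ [_ h]] _] := H t Ht.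
  by apply: cnt_scal; [exact: cnt_const|exact: rcnt_ray].
- move=> t Ht; have [_ h] := H t Ht.
  apply: Rle_trans (norm_cscal _ _) _.
  rewrite Cmod_mult /= Rmult_1_r; apply: Rmult_le_compat_l => //.
  by apply: Rmult_le_pos; exact: Cmod_ge_0.
Qed.

(** Cauchy's theorem for this path. Between the corners with parameters [x] and [y] the integral
    changes by the integral of the first-order Taylor remainder, since the contour integral of [g1]
    is zero. That remainder is [O((y - x)^2)], and [quadratic_increments_constant] concludes. *)
Theorem contour_translate (g g1 g2 : C -> E) (a d : C) (H D : R) l l' :
  0 <= H ->
  (forall theta, 0 <= theta <= H ->
     on_rays (ray a d theta) (fun t z => jet2 g g1 g2 z /\
       norm (g z) <= D * exp (- t) /\ norm (g1 z) <= D * exp (- t) /\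
       norm (g2 z) <= D * exp (- t))) ->
  contour g a l -> contour g (ray a d H) l' -> l = l'.
Proof.
move=> HH Hg Hl Hl'.
have Hc : forall th, 0 <= th <= H -> exists m, contour g (ray a d th) m.
  move=> th Hth.
  have [t Ht|m [Hm _]] := contour_ex g (ray a d th) D; last by exists m.
  have [[[j1 _] [n1 _]] [[j2 _] [n2 _]]] := Hg th Hth t Ht.
  by split; split=> //; apply: (der_cnt _ _ C_abs); eassumption.
pose I th := epsilon (inhabits (zero : E)) (contour g (ray a d th)).
have HI th : 0 <= th <= H -> contour g (ray a d th) (I th).
  by move=> Hth; apply: epsilon_spec; apply: Hc.
have e0 : ray a d 0 = a by rewrite /ray; ring.
have -> : l = I 0.
  by apply: contour_unique Hl _; have := HI 0 ltac:(lra); rewrite e0.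
have -> : l' = I H by apply: contour_unique Hl' (HI H ltac:(lra)).
apply: norm_minus_eq_zero => e He.
apply: (Rle_trans _ 0); last lra.
rewrite norm_minus_sym.
apply: (quadratic_increments_constant (fun x y => norm (minus (I y) (I x)))
  (2 * (Cmod d ^ 2 * D)) H) => //.
- by move=> x y z; rewrite Rplus_comm; apply: norm_minus_tri.
- by move=> x _; rewrite minus_eq_zero norm_zero; lra.
move=> x y Hx Hxy Hy.
have D1 : contour g1 (ray a d x) zero.
  apply: (contour_derivative g g1 _ D) => t Ht.
  have [[[j1 [j1' _]] [n1 _]] [[j2 [j2' _]] [n2 _]]] := Hg x ltac:(lra) t Ht.
  by do !split=> //; apply: (der_cnt _ _ C_abs); eassumption.
pose w := Cmult (RtoC (y - x)) d.
have shift : forall s t, ray (ray a d y) s t = Cplus (ray (ray a d x) s t) w.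
  by move=> s t; rewrite /ray /w RtoC_minus; ring.
have Iy : contour (fun z => g (Cplus z w)) (ray a d x) (I y).
  apply: improper_ext (HI y ltac:(lra)) => t Ht.
  by rewrite !shift.
pose q z := minus (minus (g (Cplus z w)) (g z)) (w *; g1 z).
have Q : contour q (ray a d x) (minus (I y) (I x)).
  have := contour_plus _ _ _ _ _ Iy (contour_plus _ _ _ _ _
     (contour_scal (RtoC (-1)) _ _ _ (HI x ltac:(lra)))
     (contour_scal (Copp w) _ _ _ D1)).
  have -> : plus (I y) (plus (RtoC (-1) *; I x) (Copp w *; zero)) = minus (I y) (I x).
    by module_eq E.
  apply: contour_ext => t Ht; rewrite /q; split; module_eq E.
have wm : Cmod w ^ 2 = Cmod d ^ 2 * (y - x) ^ 2.
  by rewrite /w Cmod_mult Cmod_R Rabs_pos_eq; [ring|lra].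
have -> : 2 * (Cmod d ^ 2 * D) * (y - x) ^ 2 = 2 * (Cmod w ^ 2 * D).
  by rewrite wm; ring.
apply: contour_le Q => t Ht.
(* The segments that join the two parallel paths sweep the intermediate paths, where the bounds of
   the hypothesis hold. *)
have seg : forall s tau, ray (ray (ray a d x) s t) w tau =
   ray (ray a d (x + tau * (y - x))) s t.
  by move=> s tau; rewrite /ray /w !(RtoC_plus, RtoC_mult, RtoC_minus); ring.
have inn : forall tau, 0 <= tau <= 1 -> 0 <= x + tau * (y - x) <= H.
  by move=> tau Ht'; split; nra.
have sh1 : forall s, ray (ray (ray a d x) s t) w 1 = Cplus (ray (ray a d x) s t) w.
  by move=> s; rewrite {1}/ray; ring.
have cq : forall z, jet2 g g1 g2 z -> jet2 g g1 g2 (Cplus z w) -> ccnt q z.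
  move=> z [a1 [a2 a3]] [b1 [b2 b3]].
  have c1 := der_cnt _ _ C_abs _ _ _ a1.
  have c2 := der_cnt _ _ C_abs _ _ _ a2.
  have c3 := der_cnt _ _ C_abs _ _ _ b1.
  have c4 : ccnt (fun z => g (Cplus z w)) z.
    apply: (cnt_comp _ g (fun z => Cplus z w : CC)) => //.
    apply: (cnt_plus _ (fun z => z : CC) (fun _ => w : CC)); last exact: cnt_const.
    by apply: (der_cnt _ _ C_abs); apply: cder_id.
  have c5 := cnt_plus _ _ _ _ c4 (cnt_plus _ _ _ _
     (cnt_scal _ _ _ _ (cnt_const _ (RtoC (-1) : CC) z) c1)
     (cnt_scal _ _ _ _ (cnt_const _ (Copp w : CC) z) c2)).
  have ee : forall z, plus (g (Cplus z w)) (plus (RtoC (-1) *; g z) (Copp w *; g1 z)) = q z.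
    by move=> z'; rewrite /q; module_eq E.
  exact: cnt_ext ee c5.
have both : forall s, (s = RtoC 1 \/ s = Copp iota) -> forall th, 0 <= th <= H ->
   jet2 g g1 g2 (ray (ray a d th) s t) /\ norm (g2 (ray (ray a d th) s t)) <= D * exp (- t).
  by move=> s [->|->] th Hth; have [[? [_ [_ ?]]] [? [_ [_ ?]]]] := Hg th Hth t Ht.
have fin : forall s, (s = RtoC 1 \/ s = Copp iota) ->
   ccnt q (ray (ray a d x) s t) /\
   norm (q (ray (ray a d x) s t)) <= Cmod w ^ 2 * D * exp (- t).
  move=> s Hs; split.
    apply: cq; first by apply: (proj1 (both s Hs x ltac:(lra))).
    by rewrite -shift; apply: (proj1 (both s Hs y ltac:(lra))).
  rewrite Rmult_assoc; apply: (jet2_taylor _ _ g2) => tau Htau.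
  by rewrite seg; apply: both => //; apply: inn.
by split; apply: fin; [left|right].
Qed.

End Contour.

(** * Fourier-Laplace transforms of Gevrey functions *)

Lemma Cmod_le_abs (z : C) : Cmod z <= Rabs (fst z) + Rabs (snd z).
Proof.
case: z => x y.
have e : (x, y) = Cplus (RtoC x) (Cmult Ci (RtoC y)) :> C.
  by rewrite /Cplus /Cmult /Ci /RtoC /=; congr pair; ring.
rewrite {1}e; apply: Rle_trans (Cmod_triangle _ _) _.
by rewrite Cmod_mult Cmod_Ci !Cmod_R Rmult_1_l; apply: Rle_refl.
Qed.

Lemma rder_pair (f : R -> C) t a b :
  is_derive (fun s => fst (f s)) t a -> is_derive (fun s => snd (f s)) t b ->
  rder (f : R -> CC) t (a, b).
Proof.
move=> /is_derive_Reals H1 /is_derive_Reals H2 e He.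
have [d1 h1] := H1 (e/2) ltac:(lra).
have [d2 h2] := H2 (e/2) ltac:(lra).
exists (Rmin d1 d2); split; first by apply: Rmin_pos; exact: cond_pos.
move=> h; rewrite /abs /= => Hh.
have [->|hn] := Req_dec h 0.
  have -> : minus (minus (f (plus t 0)) (f t) : CC) (RtoC 0 *; ((a, b) : CC)) = zero.
    rewrite (_ : plus t 0 = t); last exact: Rplus_0_r.
    by rewrite /minus /plus /opp /scal /zero /= /mult /=; ring.
  by rewrite norm_zero Rabs_R0 Rmult_0_r; lra.
have k1 := h1 h hn (Rlt_le_trans _ _ _ Hh (Rmin_l _ _)).
have k2 := h2 h hn (Rlt_le_trans _ _ _ Hh (Rmin_r _ _)).
have hp : 0 < Rabs h by apply: Rabs_pos_lt.
have E0 : forall x y l, Rabs ((x - y) / h - l) < e / 2 ->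
   Rabs (x - y - h * l) <= e / 2 * Rabs h.
  move=> x y l q; have -> : x - y - h * l = ((x - y) / h - l) * h by field.
  by rewrite Rabs_mult; apply: Rmult_le_compat_r; lra.
apply: Rle_trans (Cmod_le_abs _) _.
have := E0 _ _ _ k1; have := E0 _ _ _ k2.
rewrite /minus /plus /opp /scal /= /mult /= !Rmult_0_l.
move=> u v.
match goal with |- Rabs ?x + Rabs ?y <= _ =>
  have -> : x = fst (f (t + h)) - fst (f t) - h * a by rewrite /=; ring end.
match goal with |- _ + Rabs ?y <= _ =>
  have -> : y = snd (f (t + h)) - snd (f t) - h * b by rewrite /=; ring end.
lra.
Qed.

Lemma Cexp_plus z w : Cexp (Cplus z w) = Cmult (Cexp z) (Cexp w).
Proof.
by rewrite /Cexp /Cmult /= exp_plus cos_plus sin_plus /Re /Im; apply: injective_projections => /=; ring.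
Qed.

Lemma Cexp_0 : Cexp (RtoC 0) = RtoC 1.
Proof. by rewrite /Cexp /RtoC /= exp_0 cos_0 sin_0 Rmult_1_l Rmult_0_r. Qed.

Lemma Cmod_Cexp z : Cmod (Cexp z) = exp (Re z).
Proof.
rewrite /Cmod /Cexp /=.
have -> : exp (Re z) * cos (Im z) * (exp (Re z) * cos (Im z) * 1) +
   exp (Re z) * sin (Im z) * (exp (Re z) * sin (Im z) * 1) =
   exp (Re z) * exp (Re z) * (Rsqr (sin (Im z)) + Rsqr (cos (Im z))).
  by rewrite /Rsqr; ring.
rewrite sin2_cos2 Rmult_1_r; apply: sqrt_square; exact: Rlt_le (exp_pos _).
Qed.

Lemma Re_le_Cmod z : Re z <= Cmod z.
Proof. exact: Rle_trans (Rle_abs _) (re_le_Cmod z). Qed.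

Lemma rder_Cexp (z : C) t :
  rder (fun s => Cexp (Cmult z (RtoC s)) : CC) t (Cmult z (Cexp (Cmult z (RtoC t)))).
Proof.
case: z => x y.
apply: der_eq; first apply: rder_pair; rewrite /Cexp /=.
- by auto_derive => //; reflexivity.
- by auto_derive => //; reflexivity.
- rewrite /Cmult /=; apply: injective_projections => /=; rewrite /Rminus; ring.
Qed.

Lemma Cexp_taylor z :
  Cmod (Cminus (Cminus (Cexp z) (RtoC 1)) z) <= Cmod z ^ 2 * exp (Cmod z).
Proof.
have := taylor2 (E := CC) (fun t => Cexp (Cmult z (RtoC t)))
  (fun t => Cmult z (Cexp (Cmult z (RtoC t))))
  (fun t => Cmult z (Cmult z (Cexp (Cmult z (RtoC t))))) (Cmod z ^ 2 * exp (Cmod z)).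
rewrite !Cmult_1_r !Cmult_0_r Cexp_0 Cmult_1_r; apply.
- by move=> t _; apply: rder_Cexp.
- move=> t _.
  apply: der_eq (der_scal _ RtoC RtoC_abs (E := CC) _ _ t _ _
    (der_const _ RtoC (z : CC) t) (rder_Cexp z t)) _.
  by rewrite /plus /scal /zero /= /mult /=; ring.
- move=> t _; do 2 (apply: cnt_Cmult; first exact: cnt_const).
  by apply: (der_cnt _ RtoC RtoC_abs); apply: rder_Cexp.
move=> t Ht; change (Cmod (Cmult z (Cmult z (Cexp (Cmult z (RtoC t))))) <= Cmod z ^ 2 * exp (Cmod z)).
rewrite !Cmod_mult -Rmult_assoc /= Rmult_1_r.
have hz := Cmod_ge_0 z.
apply: Rmult_le_compat_l; first nra.
rewrite Cmod_Cexp.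
have : Re (Cmult z (RtoC t)) <= Cmod z.
  apply: Rle_trans (Re_le_Cmod _) _; rewrite Cmod_mult Cmod_R Rabs_pos_eq; nra.
by case=> [h|->]; [apply: Rlt_le; apply: exp_increasing|apply: Rle_refl].
Qed.

Lemma exp_le_compat x y : x <= y -> exp x <= exp y.
Proof. by case=> [h|->]; [apply: Rlt_le; apply: exp_increasing|apply: Rle_refl]. Qed.

Definition hat_integrand (phi : R -> C) (mu : C) (t : R) : CC :=
  Cmult (Cexp (Cmult mu (RtoC t))) (phi t).

(** The Fourier-Laplace transform, an arbitrary value unless the integrals over
    [[-T, T]] are eventually constant, as they are for compact support. *)
Definition hat (phi : R -> C) (mu : C) : C :=
  epsilon (inhabits (RtoC 0)) (fun z => exists T0, forall T, T0 <= T ->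
    is_RInt (V := VR CC) (hat_integrand phi mu) (- T) T z).

Definition supported_in (phi : R -> C) (a b : R) : Prop :=
  forall t, ~ (a <= t <= b) -> phi t = RtoC 0.

Definition cont_cpt (phi : R -> C) (a b : R) : Prop :=
  a <= b /\ (forall t, rcnt (phi : R -> CC) t) /\ supported_in phi a b.

Section Hat.
Variables (phi : R -> C) (a b : R).
Hypothesis Hphi : cont_cpt phi a b.

Lemma hat_integrand_rcnt mu t : rcnt (hat_integrand phi mu) t.
Proof.
apply: cnt_Cmult; last by case: Hphi => _ [h _].
by apply: (der_cnt _ RtoC RtoC_abs); apply: rder_Cexp.
Qed.

Lemma hat_integrand_supp mu t : ~ (a <= t <= b) -> hat_integrand phi mu t = RtoC 0.
Proof. by case: Hphi => _ [_ h] /h e; rewrite /hat_integrand e Cmult_0_r. Qed.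

Lemma is_RInt_hat_extend mu a' b' z : a' <= a -> b <= b' ->
  is_RInt (V := VR CC) (hat_integrand phi mu) a b z ->
  is_RInt (V := VR CC) (hat_integrand phi mu) a' b' z.
Proof.
move=> ha hb; apply: is_RInt_zero_extend => // t Ht.
by apply: hat_integrand_supp; lra.
Qed.

Lemma is_RInt_hat mu a' b' : a' <= a -> b <= b' ->
  is_RInt (V := VR CC) (hat_integrand phi mu) a' b' (hat phi mu).
Proof.
move=> ha hb; apply: is_RInt_hat_extend => //.
have [z Hz] : ex_RInt (V := VR CC) (hat_integrand phi mu) a b.
  by apply: rcnt_ex_RInt => t _; apply: hat_integrand_rcnt.
have X : exists z, exists T0, forall T, T0 <= T ->
    is_RInt (V := VR CC) (hat_integrand phi mu) (- T) T z.
  exists z, (Rmax (Rabs a) (Rabs b)) => T HT.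
  have h1 := Rmax_l (Rabs a) (Rabs b); have h2 := Rmax_r (Rabs a) (Rabs b).
  apply: is_RInt_hat_extend Hz.
    by have := Rle_abs (- a); rewrite Rabs_Ropp; lra.
  by have := Rle_abs b; lra.
have [T0 HT0] := epsilon_spec (inhabits (RtoC 0)) _ X.
rewrite -/(hat phi mu) in HT0.
pose T := Rmax T0 (Rmax (Rabs a) (Rabs b)).
have h0 : T0 <= T := Rmax_l _ _.
have h1 : Rmax (Rabs a) (Rabs b) <= T := Rmax_r _ _.
have h2 := Rmax_l (Rabs a) (Rabs b); have h3 := Rmax_r (Rabs a) (Rabs b).
have I := is_RInt_hat_extend mu (- T) T z _ _ Hz.
rewrite (is_RInt_value_unique (V := VR CC) _ _ _ _ _ (HT0 T h0) (I _ _)) //.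
  by have := Rle_abs (- a); rewrite Rabs_Ropp; lra.
by have := Rle_abs b; lra.
Qed.

Lemma hat_le mu M B : (forall t, a <= t <= b -> Cmod (phi t) <= M) ->
  (forall t, a <= t <= b -> exp (t * Re mu) <= B) ->
  Cmod (hat phi mu) <= (b - a) * (B * M).
Proof.
move=> HM HB; have hab := proj1 Hphi.
apply: (norm_RInt_le_const (V := VR CC) _ a b _ _ hab _
  (is_RInt_hat mu a b (Rle_refl _) (Rle_refl _))).
move=> t Ht; change (Cmod (Cmult (Cexp (Cmult mu (RtoC t))) (phi t)) <= B * M).
rewrite Cmod_mult Cmod_Cexp.
apply: Rmult_le_compat; [exact: Rlt_le (exp_pos _)|exact: Cmod_ge_0| |exact: HM].
have -> : Re (Cmult mu (RtoC t)) = t * Re mu by rewrite /Re /=; ring.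
exact: HB.
Qed.

Lemma cont_cpt_bounded : exists M, 0 <= M /\ forall t, Cmod (phi t) <= M.
Proof.
have [M HM] : exists M, forall t, Rmin a b <= t <= Rmax a b -> norm (phi t : VR CC) <= M.
  apply: (ex_RInt_ub (V := VR CC)); apply: rcnt_ex_RInt => t _.
  by case: Hphi => _ [h _].
case: Hphi => hab [_ hs].
rewrite Rmin_left // Rmax_right // in HM.
exists (Rmax 0 M); split; first exact: Rmax_l.
move=> t; case: (excluded_middle_informative (a <= t <= b)) => Ht.
  by apply: Rle_trans (Rmax_r _ _); apply: HM.
by rewrite hs // Cmod_0; apply: Rmax_l.
Qed.

End Hat.

Lemma hat_unique phi mu a b z : cont_cpt phi a b ->
  is_RInt (V := VR CC) (hat_integrand phi mu) a b z -> hat phi mu = z.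
Proof.
move=> H I.
apply: (is_RInt_value_unique (V := VR CC)) I.
by apply: (is_RInt_hat _ a b H); lra.
Qed.

Lemma cont_cpt_plus phi psi a b : cont_cpt phi a b -> cont_cpt psi a b ->
  cont_cpt (fun t => Cplus (phi t) (psi t)) a b.
Proof.
move=> [h [c1 s1]] [_ [c2 s2]]; split=> //; split.
  by move=> t; apply: (cnt_plus _ (E := CC)).
by move=> t Ht; rewrite s1 // s2 // Cplus_0_l.
Qed.

Lemma cont_cpt_mult (u : R -> C) phi a b : (forall t, rcnt (u : R -> CC) t) ->
  cont_cpt phi a b -> cont_cpt (fun t => Cmult (u t) (phi t)) a b.
Proof.
move=> hu [h [c s]]; split=> //; split.
  by move=> t; apply: cnt_Cmult.
by move=> t Ht; rewrite s // Cmult_0_r.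
Qed.

Lemma cont_cpt_widen phi a b a' b' : cont_cpt phi a b -> a' <= a -> b <= b' ->
  cont_cpt phi a' b'.
Proof.
move=> [h [c s]] ha hb; split; first lra; split=> // t Ht; apply: s; lra.
Qed.

Lemma hat_plus phi psi a b mu : cont_cpt phi a b -> cont_cpt psi a b ->
  hat (fun t => Cplus (phi t) (psi t)) mu = Cplus (hat phi mu) (hat psi mu).
Proof.
move=> H1 H2; apply: (hat_unique _ _ a b); first exact: cont_cpt_plus.
have := is_RInt_plus (V := VR CC) _ _ _ _ _ _
  (is_RInt_hat _ _ _ H1 mu a b (Rle_refl _) (Rle_refl _))
  (is_RInt_hat _ _ _ H2 mu a b (Rle_refl _) (Rle_refl _)).
apply: (is_RInt_ext (V := VR CC)) => t _.
by rewrite /hat_integrand /plus /=; ring.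
Qed.

Lemma hat_scal c phi a b mu : cont_cpt phi a b ->
  hat (fun t => Cmult c (phi t)) mu = Cmult c (hat phi mu).
Proof.
move=> H; apply: (hat_unique _ _ a b).
  by apply: cont_cpt_mult => // t; apply: (cnt_const _ (E := CC)).
have := is_RInt_linear _ _ _ _ _ (is_linear_cscal (E := CC) c)
  (is_RInt_hat _ _ _ H mu a b (Rle_refl _) (Rle_refl _)).
apply: (is_RInt_ext (V := VR CC)) => t _.
by rewrite /hat_integrand /scal /= /mult /=; ring.
Qed.

(** By continuity from outside the interval. This removes the boundary terms from the integration by
    parts in [hat_derive]. *)
Lemma supported_endpoints phi a b : cont_cpt phi a b ->
  phi a = RtoC 0 /\ phi b = RtoC 0.
Proof.
move=> [hab [hc hs]].
have aux : forall t s, (forall d, 0 < d -> exists h, Rabs h < d /\ ~ (a <= t + h <= b)) ->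
    s = t -> phi s = RtoC 0.
  move=> t s H ->; symmetry.
  apply: (norm_minus_eq_zero (RtoC 0 : CC)) => e He.
  have [d [Hd h]] := hc t e He.
  have [k [hk1 hk2]] := H d Hd.
  have := h k hk1.
  rewrite (_ : phi (plus t k) = RtoC 0); last exact: hs.
  exact: Rlt_le.
split; apply: (aux _ _ _ erefl) => d Hd.
  by exists (- (d/2)); rewrite Rabs_Ropp Rabs_pos_eq; lra.
by exists (d/2); rewrite Rabs_pos_eq; lra.
Qed.

Lemma hat_derive phi phi' a b mu : cont_cpt phi a b -> cont_cpt phi' a b ->
  (forall t, rder (phi : R -> CC) t (phi' t)) ->
  hat phi' mu = Cmult (Copp mu) (hat phi mu).
Proof.
move=> H H' D.
apply: (hat_unique _ _ a b) => //.
have I1 := is_RInt_linear _ _ _ _ _ (is_linear_cscal (E := CC) mu)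
  (is_RInt_hat _ _ _ H mu a b (Rle_refl _) (Rle_refl _)).
have I2 : is_RInt (V := VR CC) (fun t => Cplus (Cmult mu (hat_integrand phi mu t))
   (hat_integrand phi' mu t)) a b (zero : CC).
  have -> : (zero : CC) = minus (hat_integrand phi mu b) (hat_integrand phi mu a).
    have [ea eb] := supported_endpoints _ _ _ H.
    by rewrite /hat_integrand ea eb /minus /plus /opp /zero /=; ring.
  apply: (rder_RInt (E := CC)) => t _.
    apply: der_eq (der_scal _ RtoC RtoC_abs (E := CC) _ _ t _ _
      (rder_Cexp mu t) (D t)) _.
    by rewrite /hat_integrand /plus /scal /= /mult /=; ring.
  apply: (cnt_plus _ (E := CC)); last by exact: (hat_integrand_rcnt _ _ _ H').
  apply: cnt_Cmult; first exact: (cnt_const _ (E := CC)).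
  by exact: (hat_integrand_rcnt _ _ _ H).
have := is_RInt_minus (V := VR CC) _ _ _ _ _ _ I2 I1.
have -> : minus (zero : VR CC) (mu *; (hat phi mu : CC)) = Cmult (Copp mu) (hat phi mu).
  by rewrite /minus /plus /opp /zero /scal /= /mult /=; ring.
apply: (is_RInt_ext (V := VR CC)) => t _.
by rewrite /minus /plus /opp /scal /= /mult /=; ring.
Qed.

Lemma rcnt_RtoC t : rcnt (RtoC : R -> CC) t.
Proof.
move=> e He; exists e; split=> // h Hh.
have -> : minus (RtoC (plus t h) : CC) (RtoC t) = RtoC h.
  by rewrite /minus /plus /opp /= -RtoC_opp -RtoC_plus; congr RtoC; ring.
by change (Cmod (RtoC h) < e); rewrite Cmod_R.
Qed.

(** Differentiation under the integral: the bound [Cexp_taylor] is uniform for [t] in the compact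
    support, so the error is at most [Q |h|^2] for [|h| <= 1]. *)
Lemma cder_hat phi a b mu : cont_cpt phi a b ->
  cder (hat phi : C -> CC) mu (hat (fun t => Cmult (RtoC t) (phi t)) mu).
Proof.
move=> H.
have H1 : cont_cpt (fun t => Cmult (RtoC t) (phi t)) a b.
  by apply: cont_cpt_mult => //; apply: rcnt_RtoC.
have [M [M0 HM]] := cont_cpt_bounded _ _ _ H.
have hab := proj1 H.
pose T := Rabs a + Rabs b.
have HT : forall t, a <= t <= b -> Rabs t <= T.
  move=> t Ht; rewrite /T; apply: Rabs_le.
  have := Rle_abs (- a); have := Rle_abs b; have := Rabs_pos a; have := Rabs_pos b.
  rewrite Rabs_Ropp; lra.
have T0 : 0 <= T by rewrite /T; have := Rabs_pos a; have := Rabs_pos b; lra.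
pose Q := (b - a) * (exp (T * Cmod mu) * (T ^ 2 * exp T) * M).
have Q0 : 0 <= Q.
  have := exp_pos (T * Cmod mu); have := exp_pos T => q1 q2.
  do !apply: Rmult_le_pos; lra.
have est : forall h, Cmod h <= 1 ->
  Cmod (Cminus (Cminus (hat phi (Cplus mu h)) (hat phi mu))
    (Cmult h (hat (fun t => Cmult (RtoC t) (phi t)) mu))) <= Q * Cmod h ^ 2.
  move=> h Hh.
  have I1 := is_RInt_hat _ _ _ H (Cplus mu h) a b (Rle_refl _) (Rle_refl _).
  have I2 := is_RInt_hat _ _ _ H mu a b (Rle_refl _) (Rle_refl _).
  have I3 := is_RInt_linear _ _ _ _ _ (is_linear_cscal (E := CC) h)
    (is_RInt_hat _ _ _ H1 mu a b (Rle_refl _) (Rle_refl _)).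
  have I := is_RInt_minus (V := VR CC) _ _ _ _ _ _
     (is_RInt_minus (V := VR CC) _ _ _ _ _ _ I1 I2) I3.
  have -> : Q * Cmod h ^ 2 = (b - a) * (exp (T * Cmod mu) * (T ^ 2 * exp T) * M * Cmod h ^ 2).
    by rewrite /Q; ring.
  apply: (norm_RInt_le_const (V := VR CC) _ a b _ _ hab _ I) => t Ht.
  match goal with |- norm ?x <= _ => change (Cmod x <= exp (T * Cmod mu) * (T ^ 2 * exp T) * M * Cmod h ^ 2);
    have -> : x = Cmult (Cmult (Cexp (Cmult mu (RtoC t))) (Cminus (Cminus (Cexp (Cmult h (RtoC t))) (RtoC 1)) (Cmult h (RtoC t)))) (phi t) end.
    rewrite /hat_integrand (_ : Cmult (Cplus mu h) (RtoC t) =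
       Cplus (Cmult mu (RtoC t)) (Cmult h (RtoC t))); last ring.
    rewrite Cexp_plus /minus /plus /opp /scal /= /mult /=; ring.
  rewrite !Cmod_mult.
  have tT := HT t Ht; have hm := Cmod_ge_0 mu; have hh := Cmod_ge_0 h.
  have e1 : Cmod (Cexp (Cmult mu (RtoC t))) <= exp (T * Cmod mu).
    rewrite Cmod_Cexp; apply: exp_le_compat; apply: Rle_trans (Re_le_Cmod _) _.
    by rewrite Cmod_mult Cmod_R Rmult_comm; apply: Rmult_le_compat_r.
  have e2 : Cmod (Cminus (Cminus (Cexp (Cmult h (RtoC t))) (RtoC 1)) (Cmult h (RtoC t)))
     <= T ^ 2 * exp T * Cmod h ^ 2.
    apply: Rle_trans (Cexp_taylor _) _.
    rewrite Cmod_mult Cmod_R.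
    have p := Rabs_pos t.
    have -> : T ^ 2 * exp T * Cmod h ^ 2 = (Cmod h * T) ^ 2 * exp T by ring.
    apply: Rmult_le_compat; [exact: pow2_ge_0|exact: Rlt_le (exp_pos _)| |].
      by apply: pow_incr; split; [apply: Rmult_le_pos|apply: Rmult_le_compat_l].
    by apply: exp_le_compat; nra.
  have -> : exp (T * Cmod mu) * (T ^ 2 * exp T) * M * Cmod h ^ 2 =
     exp (T * Cmod mu) * (T ^ 2 * exp T * Cmod h ^ 2) * M by ring.
  apply: Rmult_le_compat => //; [|exact: Cmod_ge_0|].
    by apply: Rmult_le_pos; exact: Cmod_ge_0.
  by apply: Rmult_le_compat => //; exact: Cmod_ge_0.
move=> e He.
exists (Rmin 1 (e / (Q + 1))); split.
  by apply: Rmin_pos; [lra|apply: Rdiv_lt_0_compat; lra].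
move=> h Hh.
have h1 : Cmod h < 1 := Rlt_le_trans _ _ _ Hh (Rmin_l _ _).
have h2 : Cmod h < e / (Q + 1) := Rlt_le_trans _ _ _ Hh (Rmin_r _ _).
apply: Rle_trans (est h (Rlt_le _ _ h1)) _.
change (Q * Cmod h ^ 2 <= e * Cmod h).
have hh := Cmod_ge_0 h.
have : Q * Cmod h <= e.
  have -> : e = (Q + 1) * (e / (Q + 1)) by field; lra.
  by apply: Rmult_le_compat; lra.
move=> q; have -> : Q * Cmod h ^ 2 = Q * Cmod h * Cmod h by ring.
exact: Rmult_le_compat_r.
Qed.

Lemma supported_in_supp phi a b : (forall t, supp phi t -> a <= t <= b) ->
  supported_in phi a b.
Proof.
move=> H t Ht; apply: NNPP => Hn; apply: Ht; apply: H => L.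
by apply: Hn; apply: (locally_singleton _ _ L).
Qed.

Lemma CDerive_n_0 phi t : CDerive_n phi 0 t = phi t.
Proof. by rewrite /CDerive_n /=; case: (phi t). Qed.

Lemma smooth_rder phi p t : smooth phi ->
  rder (CDerive_n phi p : R -> CC) t (CDerive_n phi (S p) t).
Proof.
move=> H; have [h1 h2] := H (S p) t.
by apply: rder_pair; apply: Derive_correct.
Qed.

Lemma CDerive_n_supported phi p a b : supported_in phi a b ->
  supported_in (CDerive_n phi p) a b.
Proof.
move=> H t Ht.
have Z : forall n, Derive_n (fun _ => 0) n t = 0.
  by case=> // n; rewrite Derive_n_const.
have op : locally t (fun u => ~ (a <= u <= b)).
  case: (Rlt_dec t a) => h1.
    have d : 0 < a - t by lra.
    exists (mkposreal _ d) => u; rewrite /ball /= /AbsRing_ball /abs /minus /plus /opp /=.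
    by move=> /Rabs_def2; lra.
  have d : 0 < t - b by apply: Rnot_le_lt => h2; apply: Ht; lra.
  exists (mkposreal _ d) => u; rewrite /ball /= /AbsRing_ball /abs /minus /plus /opp /=.
  by move=> /Rabs_def2; lra.
rewrite /CDerive_n /RtoC; congr pair.
  rewrite -(Z p); apply: Derive_n_ext_loc; apply: filter_imp op => u Hu.
  by rewrite (H u Hu).
rewrite -(Z p); apply: Derive_n_ext_loc; apply: filter_imp op => u Hu.
by rewrite (H u Hu).
Qed.

Lemma smooth_cont_cpt phi p a b : a <= b -> smooth phi -> supported_in phi a b ->
  cont_cpt (CDerive_n phi p) a b.
Proof.
move=> hab H S; split=> //; split; last exact: CDerive_n_supported.
by move=> t; apply: (der_cnt _ RtoC RtoC_abs); apply: smooth_rder.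
Qed.

Lemma cont_cpt_ext phi psi a b : (forall t, phi t = psi t) ->
  cont_cpt phi a b -> cont_cpt psi a b.
Proof.
move=> e [h [c s]]; split=> //; split; first by move=> t; apply: cnt_ext e (c t).
by move=> t Ht; rewrite -e; apply: s.
Qed.

Lemma smooth_cont_cpt0 phi a b : a <= b -> smooth phi -> supported_in phi a b ->
  cont_cpt phi a b.
Proof.
move=> hab H S; apply: cont_cpt_ext (smooth_cont_cpt phi 0 a b hab H S).
exact: CDerive_n_0.
Qed.

Lemma hat_ext phi psi mu : (forall t, phi t = psi t) -> hat phi mu = hat psi mu.
Proof.
move=> e; rewrite /hat; congr epsilon.
apply: functional_extensionality => z.
apply: propositional_extensionality.
have ee : forall t, hat_integrand phi mu t = hat_integrand psi mu t.
  by move=> t; rewrite /hat_integrand e.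
split=> -[T0 H]; exists T0 => T HT; apply: (is_RInt_ext (V := VR CC)) (H T HT) => t _.
  exact: ee.
by rewrite ee.
Qed.

Lemma hat_CDerive_n phi p a b mu : a <= b -> smooth phi -> supported_in phi a b ->
  Cmod (hat (CDerive_n phi p) mu) = Cmod mu ^ p * Cmod (hat phi mu).
Proof.
move=> hab H S; elim: p => [|p IH].
  by rewrite Rmult_1_l (hat_ext _ _ _ (CDerive_n_0 phi)).
rewrite (hat_derive (CDerive_n phi p) _ a b) //; try exact: smooth_cont_cpt.
  by rewrite Cmod_mult Cmod_opp IH /=; ring.
by move=> t; apply: smooth_rder.
Qed.

(** Termwise comparison of the exponential series with the series [b] that keeps only the term of
    index [n]. *)
Lemma exp_series_term x n : 0 <= x -> x ^ n / INR (Factorial.fact n) <= exp x.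
Proof.
move=> hx.
have h := is_exp_Reals x.
apply: Rnot_lt_le => hlt.
have S1 : is_series (fun k => x ^ k * / INR (Factorial.fact k)) (exp x).
  apply: is_series_ext h => k /=.
  by rewrite /scal /= /mult /= pow_n_pow.
have pos : forall k, 0 <= x ^ k * / INR (Factorial.fact k).
  move=> k; apply: Rmult_le_pos; first exact: pow_le.
  by apply: Rlt_le; apply: Rinv_0_lt_compat; exact: INR_fact_lt_0.
pose b k := if Nat.eqb k n then x ^ n / INR (Factorial.fact n) else 0.
have S2 : is_series b (x ^ n / INR (Factorial.fact n)).
  apply/is_series_Reals => e He; exists n => m Hm.
  have -> : sum_f_R0 b m = x ^ n / INR (Factorial.fact n).
    have Z : forall k, (k < n)%nat -> sum_f_R0 b k = 0.
      elim=> [|k IH] Hk /=; rewrite /b.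
        by case: Nat.eqb_spec; lia || lra.
      by rewrite IH /b; [case: Nat.eqb_spec; [lia|lra]|lia].
    have : (n <= m)%nat by lia.
    elim: m {Hm} => [|m IH] Hm.
      have e1 : n = O by lia.
      by rewrite /= /b e1.
    rewrite /=; have [e1|e1] : (n = S m \/ n <= m)%nat by lia.
      by rewrite (Z m ltac:(lia)) /b -e1 Nat.eqb_refl Rplus_0_l.
    by rewrite IH // /b; case: Nat.eqb_spec; [lia|move=> _; ring].
  by rewrite /R_dist Rminus_diag Rabs_R0.
have : x ^ n / INR (Factorial.fact n) <= exp x.
  rewrite -(is_series_unique _ _ S1) -(is_series_unique _ _ S2).
  apply: Series_le; last by exists (exp x).
  move=> k; rewrite /b; case: Nat.eqb_spec => [->|_]; last by split; [lra|exact: pos].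
  by split; [exact: pos|apply: Rle_refl].
lra.
Qed.

Lemma Rpower_pow_swap x s p : 0 < x -> Rpower x s ^ p = Rpower (x ^ p) s.
Proof.
move=> hx; rewrite -!Rpower_pow ?Rpower_mult; try exact: exp_pos.
  by rewrite Rmult_comm.
by [].
Qed.

Lemma fact_sq_le p : INR (Factorial.fact p) ^ 2 <= INR (Factorial.fact (2 * p)).
Proof.
rewrite -pow_INR; apply: le_INR.
elim: p => [|p IH] //.
have -> : (2 * S p = S (S (2 * p)))%nat by lia.
have -> : (Factorial.fact (S p) ^ 2 = S p * S p * Factorial.fact p ^ 2)%nat.
  by rewrite /Factorial.fact -/Factorial.fact /=; lia.
have -> : (Factorial.fact (S (S (2 * p))) = (S (S (2 * p))) * (S (2 * p)) * Factorial.fact (2 * p))%nat.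
  by rewrite /Factorial.fact -/Factorial.fact; lia.
apply: Nat.mul_le_mono => //; nia.
Qed.

Lemma gevrey_pos s p : 0 < gevrey s p. Proof. exact: exp_pos. Qed.

Lemma gevrey_0 s : gevrey s 0 = 1.
Proof. by rewrite /gevrey /= /Rpower ln_1 Rmult_0_r exp_0. Qed.

(* [p!^s <= (2p)! p!^(s-2)], and [p!^(2-s)] beats every geometric sequence. *)
Lemma gevrey_le s h L : s < 2 -> 0 < h -> 0 < L -> exists C, 0 < C /\
  forall p, h ^ p * L ^ (2 * p) * gevrey s p <= C * INR (Factorial.fact (2 * p)).
Proof.
move=> hs hh hL.
have sg : 0 < 2 - s by lra.
pose X := h * L ^ 2.
have hX : 0 < X by apply: Rmult_lt_0_compat => //; apply: pow_lt.
(* [X^p / p!^(2-s)] is [(Y^p / p!)^(2-s)], hence at most [(exp Y)^(2-s)]; this fixes the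
   constant. *)
pose Y := Rpower X (/ (2 - s)).
have hY : 0 < Y := exp_pos _.
exists (Rpower (exp Y) (2 - s)); split; first exact: exp_pos.
move=> p.
have hf : 0 < INR (Factorial.fact p) := INR_fact_lt_0 p.
have -> : h ^ p * L ^ (2 * p) = X ^ p by rewrite /X Rpow_mult_distr pow_mult.
have -> : X ^ p = Rpower (Y ^ p) (2 - s).
  rewrite -Rpower_pow_swap // /Y Rpower_mult Rinv_l; last lra.
  by rewrite Rpower_1.
have -> : gevrey s p = INR (Factorial.fact p) ^ 2 * Rpower (/ INR (Factorial.fact p)) (2 - s).
  rewrite /gevrey {2}/Rpower ln_Rinv //.
  have -> : exp ((2 - s) * - ln (INR (Factorial.fact p))) =
     Rpower (INR (Factorial.fact p)) (s - 2) by rewrite /Rpower; congr exp; ring.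
  have -> : INR (Factorial.fact p) ^ 2 = Rpower (INR (Factorial.fact p)) 2.
    by rewrite -Rpower_pow.
  by rewrite -Rpower_plus; congr Rpower; ring.
have -> : forall u v w, u * (v * w) = (u * w) * v by intros; ring.
rewrite Rpower_mult_distr; [|exact: pow_lt|exact: Rinv_0_lt_compat].
apply: Rmult_le_compat; [exact: Rlt_le (exp_pos _)|exact: pow2_ge_0| |exact: fact_sq_le].
apply: Rle_Rpower_l; first lra.
split; last by apply: exp_series_term; lra.
by apply: Rmult_lt_0_compat; [exact: pow_lt|exact: Rinv_0_lt_compat].
Qed.

(** Expand [exp (a/2) + exp (- (a/2))]: the odd terms cancel, and after multiplication by [A] the
    even ones are at most [2 Q / 2^k]. The sum of these bounds over all [k] is [4 Q]. *)
Lemma even_moments_decay A a Q : 0 <= A -> 0 <= a ->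
  (forall p, A * a ^ (2 * p) <= Q * INR (Factorial.fact (2 * p))) ->
  A * exp (a / 2) <= 4 * Q.
Proof.
move=> hA ha H.
have hQ : 0 <= Q by have := H O; rewrite /=; lra.
have S1 : forall x, is_series (fun k => x ^ k * / INR (Factorial.fact k)) (exp x).
  move=> x; apply: is_series_ext (is_exp_Reals x) => k /=.
  by rewrite /scal /= /mult /= pow_n_pow.
have S2 := is_series_scal_l A _ _ (is_series_plus _ _ _ _ (S1 (a/2)) (S1 (- (a/2)))).
have S3 : is_series (fun k => 2 * Q * (/ 2) ^ k) (2 * Q * / (1 - / 2)).
  apply: is_series_scal_l; apply: is_series_geom; rewrite Rabs_pos_eq; lra.
have le : A * (exp (a / 2) + exp (- (a / 2))) <= 2 * Q * / (1 - / 2).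
  rewrite -(is_series_unique _ _ S3).
  have := is_series_unique _ _ S2.
  rewrite /scal /= /mult /plus /= => <-.
  apply: Series_le; last by eexists; exact: S3.
  move=> k.
  have hf : 0 < / INR (Factorial.fact k) := Rinv_0_lt_compat _ (INR_fact_lt_0 k).
  have hk : 0 <= (a/2) ^ k by apply: pow_le; lra.
  have hq : 0 <= 2 * Q * (/ 2) ^ k by apply: Rmult_le_pos; [lra|apply: pow_le; lra].
  have -> : (- (a/2)) ^ k = (-1) ^ k * (a/2) ^ k.
    by rewrite -Rpow_mult_distr; congr pow; ring.
  have [[m Hm]|[m Hm]] : Nat.Even k \/ Nat.Odd k := Nat.Even_or_Odd k.
    have -> : (-1) ^ k = 1 by rewrite Hm pow_1_even.
    rewrite Rmult_1_l; split.
      by apply: Rmult_le_pos => //; have := Rmult_le_pos _ _ hk (Rlt_le _ _ hf); lra.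
    have := H m; rewrite -Hm => h.
    have -> : A * ((a / 2) ^ k * / INR (Factorial.fact k) + (a / 2) ^ k * / INR (Factorial.fact k))
      = (A * a ^ k) * (2 * (/ 2) ^ k * / INR (Factorial.fact k)).
      by rewrite /Rdiv Rpow_mult_distr; ring.
    have -> : 2 * Q * (/ 2) ^ k = Q * INR (Factorial.fact k) * (2 * (/ 2) ^ k * / INR (Factorial.fact k)).
      by field; exact: INR_fact_neq_0.
    apply: Rmult_le_compat_r => //.
    apply: Rmult_le_pos; last lra.
    by apply: Rmult_le_pos; [lra|apply: pow_le; lra].
  have -> : (-1) ^ k = -1 by rewrite Hm Nat.add_1_r pow_1_odd.
  have -> : A * ((a / 2) ^ k * / INR (Factorial.fact k) + -1 * (a / 2) ^ k * / INR (Factorial.fact k)) = 0 by ring.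
  by split; [apply: Rle_refl|].
have := Rmult_le_pos _ _ hA (Rlt_le _ _ (exp_pos (- (a/2)))).
have -> : 4 * Q = 2 * Q * / (1 - / 2) by field.
lra.
Qed.

Lemma ultra_bound_ge0 s phi h c : ultra_bound (gevrey s) phi h c -> 0 <= c.
Proof.
move=> H; have := H O 0; rewrite gevrey_0 /= !Rmult_1_r => h0.
exact: Rle_trans (Cmod_ge_0 _) h0.
Qed.

(** The transform of the [p]-th derivative has modulus [r^(2p) |hat phi mu|], and the Gevrey bound
    majorises it by a multiple of [h^p p!^s]. By [gevrey_le] these are even moments bounded by
    [(2p)!], whence exponential decay in [r]. [C] is uniform in [phi]; [B] bounds the weight on the
    support. *)
Lemma hat_decay s h L : s < 2 -> 0 < h -> 0 < L -> exists C, 0 < C /\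
  forall phi a b c B r mu, a <= b -> smooth phi -> supported_in phi a b ->
    ultra_bound (gevrey s) phi h c ->
    (forall t, a <= t <= b -> exp (t * Re mu) <= B) ->
    0 <= r -> Cmod mu = r ^ 2 ->
    Cmod (hat phi mu) <= C * ((b - a) * B * c) * exp (- L * r).
Proof.
move=> hs hh hL.
(* [2 L], because [even_moments_decay] returns half of the rate. *)
have [C [hC HC]] := gevrey_le s h (2 * L) hs hh ltac:(lra).
exists (4 * C); split; first lra.
move=> phi a b c B r mu hab Hs Hsup Hu HB hr Hmu.
have hc := ultra_bound_ge0 _ _ _ _ Hu.
have hB : 0 <= B.
  by apply: Rle_trans (HB a ltac:(lra)); exact: Rlt_le (exp_pos _).
have hbB : 0 <= (b - a) * B * c by do !apply: Rmult_le_pos; lra.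
have := even_moments_decay (Cmod (hat phi mu)) (2 * L * r) (C * ((b - a) * B * c))
  (Cmod_ge_0 _) ltac:(nra) _.
move=> H.
have -> : - L * r = - (2 * L * r / 2) by field.
rewrite exp_Ropp.
apply: (Rmult_le_reg_r (exp (2 * L * r / 2))); first exact: exp_pos.
rewrite [X in _ <= X]Rmult_assoc Rinv_l; last exact: Rgt_not_eq (exp_pos _).
rewrite Rmult_1_r.
have -> : 4 * C * ((b - a) * B * c) = 4 * (C * ((b - a) * B * c)) by ring.
apply: H => p.
have E := hat_CDerive_n phi p a b mu hab Hs Hsup.
have := hat_le _ _ _ (smooth_cont_cpt phi p a b hab Hs Hsup) mu (c * h ^ p * gevrey s p) B
  (fun t _ => Hu p t) HB.
rewrite E Hmu -pow_mult => le1.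
rewrite Rpow_mult_distr.
have hL2 : 0 <= (2 * L) ^ (2 * p) by apply: pow_le; lra.
have := Rmult_le_compat_r _ _ _ hL2 le1.
have := Rmult_le_compat_l _ _ _ hbB (HC p).
move=> u v.
have -> : Cmod (hat phi mu) * ((2 * L) ^ (2 * p) * r ^ (2 * p)) =
  r ^ (2 * p) * Cmod (hat phi mu) * (2 * L) ^ (2 * p) by ring.
apply: Rle_trans v _.
have -> : (b - a) * (B * (c * h ^ p * gevrey s p)) * (2 * L) ^ (2 * p) =
  (b - a) * B * c * (h ^ p * (2 * L) ^ (2 * p) * gevrey s p) by ring.
apply: Rle_trans u _; apply: Req_le; ring.
Qed.

(** On the transform side this is differentiation of [hat phi] in [mu]. *)
Definition tmul (phi : R -> C) : R -> C := fun t => Cmult (RtoC t) (phi t).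

(** Leibniz rule; for [p = 0] the junk index [Nat.pred 0] comes with the factor [INR 0]. *)
Lemma Derive_n_mult_id (f : R -> R) : (forall p t, ex_derive_n f p t) ->
  forall p t, ex_derive_n (fun u => u * f u) p t /\
    Derive_n (fun u => u * f u) p t = t * Derive_n f p t + INR p * Derive_n f (Nat.pred p) t.
Proof.
move=> H.
have D : forall p t, is_derive (Derive_n f p) t (Derive_n f (S p) t).
  by move=> p t; apply: Derive_correct; apply: (H (S p)).
elim=> [|p IH] t; first by split=> //=; ring.
have ext : forall u, Derive_n (fun u => u * f u) p u =
   u * Derive_n f p u + INR p * Derive_n f (Nat.pred p) u by move=> u; apply: (proj2 (IH u)).
have X : is_derive (Derive_n (fun u => u * f u) p) t
   (t * Derive_n f (S p) t + INR (S p) * Derive_n f p t).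
  apply: (is_derive_ext (fun u => u * Derive_n f p u + INR p * Derive_n f (Nat.pred p) u)).
    by move=> u; rewrite ext.
  have -> : t * Derive_n f (S p) t + INR (S p) * Derive_n f p t =
    (1 * Derive_n f p t + t * Derive_n f (S p) t) + INR p * Derive_n f p t.
    by rewrite S_INR; ring.
  apply: is_derive_plus.
    by apply: (is_derive_mult (fun u => u)) => //; [exact: is_derive_id|move=> n m; exact: Rmult_comm].
  case: p {IH ext} => [|p] /=.
    rewrite Rmult_0_l; apply: (is_derive_ext (fun _ => 0)); first by move=> u; rewrite Rmult_0_l.
    exact: is_derive_const.
  by apply: is_derive_scal; apply: (D p).
split; first by eexists; exact: X.
exact: is_derive_unique X.
Qed.

Lemma tmul_fst phi t : fst (tmul phi t) = t * fst (phi t).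
Proof. by rewrite /tmul /=; ring. Qed.
Lemma tmul_snd phi t : snd (tmul phi t) = t * snd (phi t).
Proof. by rewrite /tmul /=; ring. Qed.

Lemma tmul_smooth phi : smooth phi -> smooth (tmul phi).
Proof.
move=> H p t.
have h1 := Derive_n_mult_id _ (fun p t => proj1 (H p t)).
have h2 := Derive_n_mult_id _ (fun p t => proj2 (H p t)).
split.
  by apply: (ex_derive_n_ext _ _ _ _ (fun u => Logic.eq_sym (tmul_fst phi u))); apply: (proj1 (h1 p t)).
by apply: (ex_derive_n_ext _ _ _ _ (fun u => Logic.eq_sym (tmul_snd phi u))); apply: (proj1 (h2 p t)).
Qed.

Lemma CDerive_n_tmul phi p t : smooth phi ->
  CDerive_n (tmul phi) p t =
  Cplus (Cmult (RtoC t) (CDerive_n phi p t)) (Cmult (RtoC (INR p)) (CDerive_n phi (Nat.pred p) t)).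
Proof.
move=> H.
have h1 := Derive_n_mult_id _ (fun p t => proj1 (H p t)).
have h2 := Derive_n_mult_id _ (fun p t => proj2 (H p t)).
rewrite /CDerive_n (Derive_n_ext _ _ _ _ (tmul_fst phi)) (Derive_n_ext _ _ _ _ (tmul_snd phi)).
rewrite (proj2 (h1 p t)) (proj2 (h2 p t)).
by apply: injective_projections => /=; ring.
Qed.

Lemma tmul_supported phi a b : supported_in phi a b -> supported_in (tmul phi) a b.
Proof. by move=> H t Ht; rewrite /tmul H // Cmult_0_r. Qed.

Lemma gevrey_incr s p : 0 <= s -> gevrey s p <= gevrey s (S p).
Proof.
move=> hs; apply: Rle_Rpower_l => //; split; first exact: INR_fact_lt_0.
by apply: le_INR; rewrite /Factorial.fact -/Factorial.fact; nia.
Qed.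

Lemma INR_le_pow2 p : INR p <= 2 ^ p.
Proof.
elim: p => [|p IH]; first by rewrite /=; lra.
rewrite S_INR /=; have : 1 <= 2 ^ p by apply: pow_R1_Rle; lra.
lra.
Qed.

(** The Leibniz term [p phi^(p-1)] costs a factor [p <= 2^p], hence [2 h], and one power of [h],
    hence [/ h]; [T] bounds [|t|] on the support. *)
Lemma tmul_ultra_bound s phi T h c : 0 <= s -> 0 < h -> 0 <= T -> smooth phi ->
  supported_in phi (- T) T -> ultra_bound (gevrey s) phi h c ->
  ultra_bound (gevrey s) (tmul phi) (2 * h) (c * (T + / h)).
Proof.
move=> hs hh hT Hs Sp H p t.
have hc := ultra_bound_ge0 _ _ _ _ H.
have g0 := gevrey_pos s p.
have hp : 0 < h ^ p := pow_lt _ p hh.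
have h2 : 1 <= 2 ^ p by apply: pow_R1_Rle; lra.
rewrite CDerive_n_tmul //.
apply: Rle_trans (Cmod_triangle _ _) _.
rewrite !Cmod_mult !Cmod_R (Rabs_pos_eq (INR p)); last exact: pos_INR.
have e1 : Rabs t * Cmod (CDerive_n phi p t) <= T * (c * h ^ p * gevrey s p).
  case: (excluded_middle_informative (- T <= t <= T)) => Ht.
    apply: Rmult_le_compat; [exact: Rabs_pos|exact: Cmod_ge_0| |exact: H].
    by apply: Rabs_le; lra.
  rewrite (CDerive_n_supported _ _ _ _ Sp) // Cmod_0 Rmult_0_r.
  by do !apply: Rmult_le_pos => //; apply: Rlt_le.
have e2 : INR p * Cmod (CDerive_n phi (Nat.pred p) t) <= 2 ^ p * (c * (h ^ p * / h) * gevrey s p).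
  case: p g0 hp h2 e1 => [|p] g0 hp h2 e1.
    rewrite Rmult_0_l; apply: Rmult_le_pos; first lra.
    apply: Rmult_le_pos; last lra.
    apply: Rmult_le_pos => //; apply: Rmult_le_pos; first lra.
    exact: Rlt_le (Rinv_0_lt_compat _ hh).
  apply: Rmult_le_compat; [exact: pos_INR|exact: Cmod_ge_0|exact: INR_le_pow2|].
  apply: Rle_trans (H p t) _.
  have -> : h ^ S p * / h = h ^ p by rewrite /=; field; lra.
  apply: Rmult_le_compat_l; last exact: gevrey_incr.
  by apply: Rmult_le_pos => //; apply: Rlt_le; apply: pow_lt.
apply: Rle_trans (Rplus_le_compat _ _ _ _ e1 e2) _.
rewrite Rpow_mult_distr.
have q : 0 <= T * (c * h ^ p * gevrey s p).
  by do !apply: Rmult_le_pos => //; apply: Rlt_le.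
have : T * (c * h ^ p * gevrey s p) <= 2 ^ p * (T * (c * h ^ p * gevrey s p)).
  by rewrite -{1}(Rmult_1_l (T * _)); apply: Rmult_le_compat_r.
have -> : c * (T + / h) * (2 ^ p * h ^ p) * gevrey s p =
  2 ^ p * (T * (c * h ^ p * gevrey s p)) + 2 ^ p * (c * (h ^ p * / h) * gevrey s p) by ring.
lra.
Qed.

(** * Resolvents in the variable [z^2] *)

Section ClosedOperators.
Context {E : NormedModule C_AbsRing} {cE : complete_space E}.
Variable A : linop E.
Hypothesis A_closed : closed_linop A.

Definition graph (x y : E) : Prop := dom A x /\ app A x = y.

Lemma graph_plus x y x' y' : graph x y -> graph x' y' -> graph (plus x x') (plus y y').
Proof. by move=> [d <-] [d' <-]; split; [exact: dom_plus|exact: app_plus]. Qed.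

Lemma graph_scal (a : C) x y : graph x y -> graph (a *; x) (a *; y).
Proof. by move=> [d <-]; split; [exact: dom_scal|exact: app_scal]. Qed.

Lemma graph_zero : graph zero zero.
Proof.
split; first exact: dom_zero.
have := app_scal (RtoC 0) (dom_zero A).
have -> : RtoC 0 *; (zero : E) = zero by exact: scal_zero_r.
by move=> ->; exact: (@scal_zero_l C_Ring E).
Qed.

Lemma graph_closed x y : (forall eps, 0 < eps -> exists x' y',
  graph x' y' /\ norm (minus x' x) < eps /\ norm (minus y' y) < eps) -> graph x y.
Proof.
move=> H; apply: (A_closed (x, y)) => -[eps Heps].
have [x' [y' [g [h1 h2]]]] := H eps (cond_pos eps).
by apply: (Heps (x', y')) g; split; apply: norm_compat1.
Qed.

(** A form of Hille's theorem: a common tagged subdivision gives a pair of Riemann sums on the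
    graph, and closedness passes to the limit. *)
Lemma graph_RInt f g a b l m : (forall t, graph (f t) (g t)) ->
  is_RInt (V := VR E) f a b l -> is_RInt (V := VR E) g a b m -> graph l m.
Proof.
move=> H I1 I2; apply: graph_closed => eps He.
have hn := @norm_factor_gt_0 _ (@VR E cE).
pose e' := mkposreal _ (Rdiv_lt_0_compat _ _ He hn).
have F1 := I1 _ (locally_ball (l : @VR E cE) e').
have F2 := I2 _ (locally_ball (m : @VR E cE) e').
have [ptd [h1 h2]] := filter_ex (F := Riemann_fine a b) _ (filter_and (F := Riemann_fine a b) _ _ F1 F2).
have e : norm_factor (V := @VR E cE) * e' = eps by rewrite /=; field; exact: Rgt_not_eq.
exists (scal (sign (b - a)) (Riemann_sum (f : R -> VR E) ptd)),
   (scal (sign (b - a)) (Riemann_sum (g : R -> VR E) ptd)); split; last first.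
  have n1 := norm_compat2 _ _ e' h1; have n2 := norm_compat2 _ _ e' h2.
  by rewrite e in n1 n2.
apply: (graph_scal (RtoC (sign (b - a)))).
move: ptd {h1 h2}; apply: SF_cons_ind => [x0|h s IH].
  by rewrite /Riemann_sum /=; exact: graph_zero.
rewrite !Riemann_sum_cons; apply: graph_plus => //.
by apply: (graph_scal (RtoC (SF_h s - fst h))).
Qed.

Lemma graph_improper f g l m : (forall t, 0 <= t -> graph (f t) (g t)) ->
  improper (V := VR E) f l -> improper (V := VR E) g m -> graph l m.
Proof.
move=> H I1 I2.
(* [graph_RInt] asks for the graph relation at every real [t]; the constant extension to [t < 0]
   supplies it. *)
pose f' t := f (Rmax 0 t); pose g' t := g (Rmax 0 t).
have J1 : improper (V := @VR E cE) f' l.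
  by apply: improper_ext I1 => t Ht; rewrite /f' Rmax_right.
have J2 : improper (V := @VR E cE) g' m.
  by apply: improper_ext I2 => t Ht; rewrite /g' Rmax_right.
have H' t : graph (f' t) (g' t) by apply: H; exact: Rmax_l.
apply: graph_closed => eps He.
have [T1 h1] := J1 (eps/2) ltac:(lra).
have [T2 h2] := J2 (eps/2) ltac:(lra).
have [y1 [i1 n1]] := h1 (Rmax T1 T2) (Rmax_l _ _).
have [y2 [i2 n2]] := h2 (Rmax T1 T2) (Rmax_r _ _).
exists y1, y2; split; first exact: graph_RInt i1 i2.
by split; [apply: Rle_lt_trans n1 _|apply: Rle_lt_trans n2 _]; lra.
Qed.

End ClosedOperators.

Lemma cder_quadratic {E : NormedModule C_AbsRing} (f : C -> E) z l rho Q :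
  0 < rho -> (forall h, Cmod h < rho ->
    norm (minus (minus (f (Cplus z h)) (f z)) (h *; l)) <= Q * Cmod h ^ 2) ->
  cder f z l.
Proof.
move=> hr H e He.
have hQ : 0 < Rabs Q + 1 by have := Rabs_pos Q; lra.
exists (Rmin rho (e / (Rabs Q + 1))); split.
  by apply: Rmin_pos => //; apply: Rdiv_lt_0_compat.
move=> h Hh.
have h1 : Cmod h < rho := Rlt_le_trans _ _ _ Hh (Rmin_l _ _).
have h2 : Cmod h < e / (Rabs Q + 1) := Rlt_le_trans _ _ _ Hh (Rmin_r _ _).
apply: Rle_trans (H h h1) _; change (Q * Cmod h ^ 2 <= e * Cmod h).
have hh := Cmod_ge_0 h.
have : Q * Cmod h <= e.
  have -> : e = (Rabs Q + 1) * (e / (Rabs Q + 1)) by field; lra.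
  apply: (Rle_trans _ (Rabs Q * Cmod h)).
    by apply: Rmult_le_compat_r => //; exact: Rle_abs.
  by apply: Rmult_le_compat; try lra; exact: Rabs_pos.
move=> q; have -> : Q * Cmod h ^ 2 = Q * Cmod h * Cmod h by ring.
exact: Rmult_le_compat_r.
Qed.

(** [Rs z] is the resolvent of [A] at [z^2]; it grows at most exponentially. *)
Record square_resolvent {E : NormedModule C_AbsRing} (A : linop E) (C0 N k : R)
    (Rs : C -> E -> E) : Prop := {
  sr_N : 0 <= N;
  sr_k : 0 <= k;
  sr_plus : forall z x y, C0 < Re z -> Rs z (plus x y) = plus (Rs z x) (Rs z y);
  sr_scal : forall z (a : C) x, C0 < Re z -> Rs z (a *; x) = a *; Rs z x;
  sr_le : forall z x, C0 < Re z -> norm (Rs z x) <= N * exp (k * Cmod z) * norm x;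
  sr_dom : forall z x, C0 < Re z -> dom A (Rs z x);
  sr_app : forall z x, C0 < Re z -> app A (Rs z x) = minus (Cmult z z *; Rs z x) x;
  sr_comm : forall z x, C0 < Re z -> dom A x ->
    Rs z (app A x) = minus (Cmult z z *; Rs z x) x }.

Section Resolvent.
Context {E : NormedModule C_AbsRing} {cE : complete_space E}.
Variables (A : linop E) (C0 N k : R) (Rs : C -> E -> E).
Hypothesis HR : square_resolvent A C0 N k Rs.

Lemma sr_minus z x y : C0 < Re z -> Rs z (minus x y) = minus (Rs z x) (Rs z y).
Proof.
move=> hz.
have -> : minus x y = plus x (RtoC (-1) *; y) by module_eq E.
rewrite (sr_plus _ _ _ _ _ HR) // (sr_scal _ _ _ _ _ HR) //; module_eq E.
Qed.

(** [Rs z x] lies in [dom A], so [Rs w (A (Rs z x))] can be computed by [sr_comm] at [w] and by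
    [sr_app] at [z]. *)
Lemma resolvent_identity z w x : C0 < Re z -> C0 < Re w ->
  minus (Rs w x) (Rs z x) = Cminus (Cmult z z) (Cmult w w) *; Rs w (Rs z x).
Proof.
move=> hz hw.
have h1 := sr_comm _ _ _ _ _ HR w (Rs z x) hw (sr_dom _ _ _ _ _ HR z x hz).
rewrite (sr_app _ _ _ _ _ HR) // sr_minus // (sr_scal _ _ _ _ _ HR) // in h1.
have -> : Cminus (Cmult z z) (Cmult w w) *; Rs w (Rs z x) =
  minus (plus (minus (Cmult z z *; Rs w (Rs z x)) (Rs w x)) (Rs w x))
    (Cmult w w *; Rs w (Rs z x)) by module_eq E.
by rewrite h1; module_eq E.
Qed.

Lemma re_add_gt z h : Cmod h < Re z - C0 -> C0 < Re (Cplus z h).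
Proof.
move=> hh; have := re_le_Cmod h.
have -> : Re (Cplus z h) = Re z + Re h by [].
by have := Rle_abs (- Re h); rewrite Rabs_Ropp; lra.
Qed.

Lemma resolvent_locally_bounded z : exists K, 0 <= K /\ forall h x,
  Cmod h < Rmin 1 (Re z - C0) -> norm (Rs (Cplus z h) x) <= K * norm x.
Proof.
have hN := sr_N _ _ _ _ _ HR. have hk := sr_k _ _ _ _ _ HR.
exists (N * exp (k * (Cmod z + 1))); split.
  by apply: Rmult_le_pos => //; exact: Rlt_le (exp_pos _).
move=> h x Hh.
have h1 : Cmod h < 1 := Rlt_le_trans _ _ _ Hh (Rmin_l _ _).
have h2 : Cmod h < Re z - C0 := Rlt_le_trans _ _ _ Hh (Rmin_r _ _).
apply: Rle_trans (sr_le _ _ _ _ _ HR _ x (re_add_gt _ _ h2)) _.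
apply: Rmult_le_compat_r; first exact: norm_ge_0.
apply: Rmult_le_compat_l => //; apply: exp_le_compat.
apply: Rmult_le_compat_l => //.
by apply: Rle_trans (Cmod_triangle _ _) _; lra.
Qed.

(** Two uses of the resolvent identity, on [x] and on [Rs z x], make the remainder quadratic in [h];
    its coefficients are controlled by local boundedness alone, without prior continuity of [Rs]. *)
Lemma cder_resolvent_fixed z x : C0 < Re z ->
  cder (fun w => Rs w x) z (Cmult (RtoC (-2)) z *; Rs z (Rs z x)).
Proof.
move=> hz.
have [K [K0 HK]] := resolvent_locally_bounded z.
pose u := Rs z x.
pose v := Rs z u.
apply: (cder_quadratic _ _ _ (Rmin 1 (Re z - C0))
   (2 * Cmod z * ((2 * Cmod z + 1) * K * norm v) + K * norm u)).
  by apply: Rmin_pos; lra.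
move=> h Hh.
have h1 : Cmod h < 1 := Rlt_le_trans _ _ _ Hh (Rmin_l _ _).
have h2 : Cmod h < Re z - C0 := Rlt_le_trans _ _ _ Hh (Rmin_r _ _).
have hw := re_add_gt _ _ h2.
set w := Cplus z h in hw *.
have e1 := resolvent_identity z w x hz hw.
have e2 := resolvent_identity z w u hz hw.
rewrite -/u in e1; rewrite -/v in e2.
have ez : Cminus (Cmult z z) (Cmult w w) = Copp (Cplus (Cmult (Cmult (RtoC 2) z) h) (Cmult h h)).
  by rewrite /w; ring.
rewrite ez in e1 e2.
rewrite e1 -/u -/v.
have -> : minus (Copp (Cplus (Cmult (Cmult (RtoC 2) z) h) (Cmult h h)) *; Rs w u)
   (h *; (Cmult (RtoC (-2)) z *; v)) =
  plus (Copp (Cmult (Cmult (RtoC 2) z) h) *; minus (Rs w u) v)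
   (Copp (Cmult h h) *; Rs w u).
  by module_eq E.
rewrite e2; apply: Rle_trans (norm_triangle _ _) _.
have hh := Cmod_ge_0 h. have hz0 := Cmod_ge_0 z.
have bu := HK h u Hh. have bv := HK h v Hh. rewrite -/w in bu bv.
have c1 := norm_cscal (Copp (Cmult h h)) (Rs w u).
have c2 := norm_cscal (Copp (Cmult (Cmult (RtoC 2) z) h))
  (Copp (Cplus (Cmult (Cmult (RtoC 2) z) h) (Cmult h h)) *; Rs w v).
have c3 := norm_cscal (Copp (Cplus (Cmult (Cmult (RtoC 2) z) h) (Cmult h h))) (Rs w v).
rewrite Cmod_opp Cmod_mult in c1.
rewrite Cmod_opp !Cmod_mult Cmod_R Rabs_pos_eq in c2; last lra.
have c4 : Cmod (Copp (Cplus (Cmult (Cmult (RtoC 2) z) h) (Cmult h h))) <= (2 * Cmod z + 1) * Cmod h.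
  rewrite Cmod_opp; apply: Rle_trans (Cmod_triangle _ _) _.
  by rewrite !Cmod_mult Cmod_R Rabs_pos_eq; nra.
have c5 : norm (Copp (Cplus (Cmult (Cmult (RtoC 2) z) h) (Cmult h h)) *; Rs w v)
  <= (2 * Cmod z + 1) * Cmod h * (K * norm v).
  apply: Rle_trans c3 _; apply: Rmult_le_compat => //; [exact: Cmod_ge_0|exact: norm_ge_0].
have c6 : 2 * Cmod z * Cmod h * norm (Copp (Cplus (Cmult (Cmult (RtoC 2) z) h) (Cmult h h)) *; Rs w v)
  <= 2 * Cmod z * Cmod h * ((2 * Cmod z + 1) * Cmod h * (K * norm v)).
  by apply: Rmult_le_compat_l => //; nra.
have c7 : Cmod h * Cmod h * norm (Rs w u) <= Cmod h * Cmod h * (K * norm u).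
  by apply: Rmult_le_compat_l => //; nra.
lra.
Qed.

(** The product rule for an argument that moves too; it allows the powers of the resolvent to be
    differentiated. *)
Lemma cder_resolvent (v : C -> E) z v' : C0 < Re z -> cder v z v' ->
  cder (fun w => Rs w (v w)) z
    (plus (Cmult (RtoC (-2)) z *; Rs z (Rs z (v z))) (Rs z v')).
Proof.
move=> hz Hv.
have [K [K0 HK]] := resolvent_locally_bounded z.
move=> e He.
have [d1 [p1 h1]] := Hv (e / (3 * (K + 1))) ltac:(apply: Rdiv_lt_0_compat; lra).
have D1 := cder_resolvent_fixed z (v z) hz.
have [d2 [p2 h2]] := D1 (e / 3) ltac:(lra).
have [d3 [p3 h3]] := der_cnt _ _ C_abs _ _ _ (cder_resolvent_fixed z v' hz) (e/3) ltac:(lra).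
have hr : 0 < Rmin 1 (Re z - C0) by apply: Rmin_pos; lra.
exists (Rmin (Rmin 1 (Re z - C0)) (Rmin d1 (Rmin d2 d3))); split.
  by do !apply: Rmin_pos => //.
move=> h Hh.
have q0 := Rlt_le_trans _ _ _ Hh (Rmin_l _ _).
have q := Rlt_le_trans _ _ _ Hh (Rmin_r _ _).
have q1 := Rlt_le_trans _ _ _ q (Rmin_l _ _).
have q' := Rlt_le_trans _ _ _ q (Rmin_r _ _).
have q2 := Rlt_le_trans _ _ _ q' (Rmin_l _ _).
have q3 := Rlt_le_trans _ _ _ q' (Rmin_r _ _).
have hw : C0 < Re (Cplus z h).
  by apply: re_add_gt; exact: Rlt_le_trans q0 (Rmin_r _ _).
move: (h1 h q1) (h2 h q2) (h3 h q3) => {}h1 {}h2 {}h3.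
change (plus z h) with (Cplus z h) in h1, h2, h3 |- *.
set w := Cplus z h in hw h1 h2 h3 *.
set F := minus (minus (v w) (v z)) (h *; v') in h1.
have -> : minus (minus (Rs w (v w)) (Rs z (v z)))
   (h *; plus (Cmult (RtoC (-2)) z *; Rs z (Rs z (v z))) (Rs z v')) =
  plus (Rs w F) (plus (minus (minus (Rs w (v z)) (Rs z (v z)))
     (h *; (Cmult (RtoC (-2)) z *; Rs z (Rs z (v z)))))
     (h *; minus (Rs w v') (Rs z v'))).
  rewrite /F !sr_minus // (sr_scal _ _ _ _ _ HR) //; module_eq E.
change (abs h) with (Cmod h) in *.
have hh := Cmod_ge_0 h.
have b1 := HK h F q0; rewrite -/w in b1.
have b2 := norm_cscal h (minus (Rs w v') (Rs z v')).
set P := minus (minus (Rs w (v z)) _) _ in h2 *.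
have b3 : K * norm F <= e / 3 * Cmod h.
  have -> : e / 3 * Cmod h = (K + 1) * (e / (3 * (K + 1)) * Cmod h) by field; lra.
  by apply: Rmult_le_compat => //; [exact: norm_ge_0|lra].
have b4 : Cmod h * norm (minus (Rs w v') (Rs z v')) <= Cmod h * (e / 3).
  by apply: Rmult_le_compat_l => //; exact: Rlt_le.
apply: (Rle_trans _ (e / 3 * Cmod h + (e / 3 * Cmod h + Cmod h * (e / 3)))); last lra.
apply: Rle_trans (norm_triangle _ _) _.
apply: Rplus_le_compat; first exact: Rle_trans b1 b3.
apply: Rle_trans (norm_triangle _ _) _.
by apply: Rplus_le_compat => //; exact: Rle_trans b2 b4.
Qed.

Definition res1 (x : E) (z : C) : E := Rs z x.
Definition res2 (x : E) (z : C) : E := Rs z (Rs z x).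
Definition res3 (x : E) (z : C) : E := Rs z (Rs z (Rs z x)).
Definition res_d1 (x : E) (z : C) : E := Cmult (RtoC (-2)) z *; res2 x z.
(** The derivative of [-2 z Rs^2], where [Rs^2] has derivative [-4 z Rs^3]. *)
Definition res_d2 (x : E) (z : C) : E :=
  plus (RtoC (-2) *; res2 x z) (Cmult (RtoC 8) (Cmult z z) *; res3 x z).

Lemma resolvent_jet2 x z : C0 < Re z ->
  jet2 (res1 x) (res_d1 x) (res_d2 x) z.
Proof.
move=> hz.
have D1 : forall w, C0 < Re w -> cder (res1 x) w (res_d1 x w).
  by move=> w hw; apply: cder_resolvent_fixed.
have D2 : cder (res2 x) z (Cmult (RtoC (-4)) z *; res3 x z).
  apply: der_eq (cder_resolvent (res1 x) z _ hz (D1 z hz)) _.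
  rewrite /res_d1 /res1 (sr_scal _ _ _ _ _ HR) // /res2 /res3; module_eq E.
have D3 := cder_resolvent (res2 x) z _ hz D2.
split; first exact: D1.
split.
  apply: der_eq (der_scal _ _ C_abs _ _ z _ _
    (der_Cmult C_abs _ _ z _ _ (der_const _ _ (RtoC (-2) : CC) z) (cder_id z)) D2) _.
  by rewrite /res_d2; module_eq E; rewrite /zero /=; ring.
have c2 := der_cnt _ _ C_abs _ _ _ D2.
have c3 := der_cnt _ _ C_abs _ _ _ D3.
have ci := der_cnt _ _ C_abs _ _ _ (cder_id z).
apply: (cnt_plus _ (fun z => RtoC (-2) *; res2 x z)).
  by apply: cnt_scal => //; apply: (cnt_const _ (E := CC)).
apply: cnt_scal; last exact: c3.
apply: cnt_Cmult; first exact: (cnt_const _ (E := CC)).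
exact: cnt_Cmult.
Qed.

Lemma one_plus_le_exp r : 0 <= r -> 1 + r <= exp r.
Proof.
move=> hr; have [->|hn] := Req_dec r 0; first by rewrite exp_0; lra.
by apply: Rlt_le; apply: exp_ineq1.
Qed.

Lemma resolvent_jet_le : exists D w, 0 <= D /\ 0 <= w /\ forall x z, C0 < Re z ->
  norm (res1 x z) <= D * exp (w * Cmod z) * norm x /\
  norm (res_d1 x z) <= D * exp (w * Cmod z) * norm x /\
  norm (res_d2 x z) <= D * exp (w * Cmod z) * norm x.
Proof.
have hN := sr_N _ _ _ _ _ HR. have hk := sr_k _ _ _ _ _ HR.
(* [10 = 2 + 8] from [res_d2]; the rate is [3 k] for three resolvents and [2] for the factor
   [|z|^2]. *)
exists (10 * (1 + N) ^ 3), (2 + 3 * k).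
split; first by apply: Rmult_le_pos; [lra|apply: pow_le; lra].
split; first lra.
move=> x z hz.
set r := Cmod z; have hr : 0 <= r := Cmod_ge_0 z.
set e := exp (k * r); set M := 1 + N.
have e1 : 1 <= e.
  by rewrite -exp_0; apply: exp_le_compat; apply: Rmult_le_pos.
have hM : 1 <= M by rewrite /M; lra.
have step y : norm (Rs z y) <= M * e * norm y.
  apply: Rle_trans (sr_le _ _ _ _ _ HR z y hz) _.
  apply: Rmult_le_compat_r; first exact: norm_ge_0.
  by apply: Rmult_le_compat_r; [exact: Rlt_le (exp_pos _)|rewrite /M; lra].
have nx := norm_ge_0 x.
have Me : 1 <= M * e by nra.
have b1 : norm (res1 x z) <= M * e * norm x by exact: step.
have b2 : norm (res2 x z) <= (M * e) ^ 2 * norm x.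
  apply: Rle_trans (step _) _.
  have := Rmult_le_compat_l (M * e) _ _ ltac:(lra) b1; rewrite /res1; lra.
have b3 : norm (res3 x z) <= (M * e) ^ 3 * norm x.
  apply: Rle_trans (step _) _.
  have := Rmult_le_compat_l (M * e) _ _ ltac:(lra) b2; rewrite /res2 /=; lra.
have W : exp ((2 + 3 * k) * r) = exp r ^ 2 * e ^ 3.
  by rewrite /e /= !Rmult_1_r -!exp_plus; congr exp; ring.
have r1 := one_plus_le_exp r hr.
have er1 : 1 <= exp r by lra.
set Z := (M * e) ^ 3 * exp r ^ 2.
have tgt : 10 * M ^ 3 * exp ((2 + 3 * k) * r) * norm x = 10 * Z * norm x.
  by rewrite W /Z; ring.
rewrite tgt.
have p3 : 0 <= (M * e) ^ 3 by apply: pow_le; lra.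
have x2 : 1 <= exp r ^ 2 by apply: pow_R1_Rle.
have m12 : M * e <= (M * e) ^ 3.
  by rewrite -{1}(pow_1 (M * e)); apply: Rle_pow => //; lia.
have m23 : (M * e) ^ 2 <= (M * e) ^ 3 by apply: Rle_pow => //; lia.
have q r' : r' <= exp r ^ 2 -> r' * (M * e) ^ 3 <= Z.
  by move=> h; rewrite /Z Rmult_comm; apply: Rmult_le_compat_l.
have q1 : (M * e) ^ 3 <= Z by have := q 1 x2; lra.
have q2 : r * (M * e) ^ 3 <= Z by apply: q; rewrite /=; nra.
have q3 : r * r * (M * e) ^ 3 <= Z by apply: q; rewrite /=; nra.
split; [|split].
- apply: Rle_trans b1 _; apply: Rmult_le_compat_r => //; lra.
- apply: Rle_trans (norm_cscal _ _) _.
  rewrite Cmod_mult Cmod_R Rabs_left1 -/r; last lra.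
  apply: (Rle_trans _ (2 * r * ((M * e) ^ 2 * norm x))).
    have -> : - -2 = 2 by ring.
    by apply: Rmult_le_compat_l b2; lra.
  have -> : 2 * r * ((M * e) ^ 2 * norm x) = (2 * (r * (M * e) ^ 2)) * norm x by ring.
  by apply: Rmult_le_compat_r => //; nra.
- apply: Rle_trans (norm_triangle _ _) _.
  have c1 := norm_cscal (RtoC (-2)) (res2 x z).
  have c2 := norm_cscal (Cmult (RtoC 8) (Cmult z z)) (res3 x z).
  rewrite Cmod_R Rabs_left1 in c1; last lra.
  rewrite !Cmod_mult Cmod_R (Rabs_pos_eq 8) -/r in c2; last lra.
  have c3 : 8 * (r * r) * norm (res3 x z) <= 8 * (r * r) * ((M * e) ^ 3 * norm x).
    by apply: Rmult_le_compat_l => //; nra.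
  have d1 : (M * e) ^ 2 * norm x <= Z * norm x by apply: Rmult_le_compat_r => //; lra.
  have d2 : r * r * (M * e) ^ 3 * norm x <= Z * norm x by apply: Rmult_le_compat_r.
  lra.
Qed.

End Resolvent.

(** * The fundamental solution *)

Lemma jet2_scal {E : NormedModule C_AbsRing} (p p1 p2 : C -> CC) (b b1 b2 : C -> E) z :
  jet2 p p1 p2 z -> jet2 b b1 b2 z ->
  jet2 (fun w => p w *; b w) (fun w => plus (p1 w *; b w) (p w *; b1 w))
    (fun w => plus (p2 w *; b w) (plus (Cmult (RtoC 2) (p1 w) *; b1 w) (p w *; b2 w))) z.
Proof.
move=> [u0 [u1 u2]] [v0 [v1 v2]].
have c1 := der_cnt _ _ C_abs _ _ _ u1. have c0 := der_cnt _ _ C_abs _ _ _ u0.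
have d1 := der_cnt _ _ C_abs _ _ _ v1. have d0 := der_cnt _ _ C_abs _ _ _ v0.
split; first exact: (der_scal _ _ C_abs).
split.
  apply: der_eq (der_plus _ _ _ _ _ _ _ (der_scal _ _ C_abs _ _ _ _ _ u1 v0)
    (der_scal _ _ C_abs _ _ _ _ _ u0 v1)) _.
  by module_eq E.
apply: cnt_plus; first exact: cnt_scal.
apply: cnt_plus; last exact: cnt_scal.
by apply: cnt_scal => //; apply: cnt_Cmult => //; apply: (cnt_const _ (E := CC)).
Qed.

(** The second derivative is the worst case: [1 + 2 + 1] products of size [P Q]. *)
Lemma jet2_scal_le {E : NormedModule C_AbsRing} (p p1 p2 : C -> CC) (b b1 b2 : C -> E) z P Q :
  Cmod (p z) <= P -> Cmod (p1 z) <= P -> Cmod (p2 z) <= P ->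
  norm (b z) <= Q -> norm (b1 z) <= Q -> norm (b2 z) <= Q ->
  norm (p z *; b z) <= 4 * (P * Q) /\
  norm (plus (p1 z *; b z) (p z *; b1 z)) <= 4 * (P * Q) /\
  norm (plus (p2 z *; b z) (plus (Cmult (RtoC 2) (p1 z) *; b1 z) (p z *; b2 z))) <= 4 * (P * Q).
Proof.
move=> p_le p1_le p2_le b_le b1_le b2_le.
have P0 : 0 <= P := Rle_trans _ _ _ (Cmod_ge_0 _) p_le.
have Q0 : 0 <= Q := Rle_trans _ _ _ (norm_ge_0 _) b_le.
have PQ : 0 <= P * Q by apply: Rmult_le_pos.
have M a x : Cmod a <= P -> norm x <= Q -> norm (a *; (x : E)) <= P * Q.
  move=> ha hx; apply: Rle_trans (norm_cscal _ _) _.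
  by apply: Rmult_le_compat => //; [exact: Cmod_ge_0|exact: norm_ge_0].
have M2 : norm (Cmult (RtoC 2) (p1 z) *; b1 z) <= 2 * (P * Q).
  apply: Rle_trans (norm_cscal _ _) _.
  rewrite Cmod_mult Cmod_R Rabs_pos_eq; last lra.
  rewrite Rmult_assoc; apply: Rmult_le_compat_l; first lra.
  by apply: Rmult_le_compat => //; [exact: Cmod_ge_0|exact: norm_ge_0].
split; first by have := M _ _ p_le b_le; lra.
split.
  apply: Rle_trans (norm_triangle _ _) _.
  by apply: Rle_trans (Rplus_le_compat _ _ _ _ (M _ _ p1_le b_le) (M _ _ p_le b1_le)) _; lra.
apply: Rle_trans (norm_triangle _ _) _.
apply: Rle_trans (Rplus_le_compat _ _ _ _ (M _ _ p2_le b_le) (norm_triangle _ _)) _.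
have := M _ _ p_le b2_le; lra.
Qed.

Lemma is_linear_RtoC (c : C) : is_linear (fun r : R_NormedModule => Cmult c (RtoC r) : VR CC).
Proof.
split.
- by move=> x y; rewrite /plus /= RtoC_plus; ring.
- move=> a x; change (Cmult c (RtoC (a * x)) = Cmult (RtoC a) (Cmult c (RtoC x))).
  by rewrite RtoC_mult; ring.
- exists (Cmod c + 1); have hc := Cmod_ge_0 c; split; first lra.
  move=> x; change (Cmod (Cmult c (RtoC x)) <= (Cmod c + 1) * Rabs x).
  rewrite Cmod_mult Cmod_R; have := Rabs_pos x; nra.
Qed.

Lemma is_linear_fst : is_linear (fun z : VR CC => fst (z : C) : R_NormedModule).
Proof.
split.
- by [].
- by move=> a z; rewrite /scal /= /mult /=; ring.
- exists 1; split; first lra; move=> z; rewrite Rmult_1_l.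
  exact: (re_le_Cmod z).
Qed.

Lemma is_linear_snd : is_linear (fun z : VR CC => snd (z : C) : R_NormedModule).
Proof.
split.
- by [].
- by move=> a z; rewrite /scal /= /mult /=; ring.
- exists 1; split; first lra; move=> z; rewrite Rmult_1_l.
  apply: Rle_trans (Rmax_Cmod z); exact: Rmax_r.
Qed.

Lemma C_decompose (z : C) : z = Cplus (Cmult (RtoC 1) (RtoC (fst z))) (Cmult Ci (RtoC (snd z))).
Proof.
case: z => x y.
by rewrite /Cplus /Cmult /Ci /RtoC /=; apply: injective_projections => /=; ring.
Qed.

Lemma is_RInt_C_pair (f : R -> C) a b l1 l2 :
  is_RInt (fun t => fst (f t)) a b l1 -> is_RInt (fun t => snd (f t)) a b l2 ->
  is_RInt (V := VR CC) f a b (l1, l2).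
Proof.
move=> H1 H2.
rewrite (C_decompose (l1, l2)).
apply: (is_RInt_ext (V := VR CC)
  (fun t => Cplus (Cmult (RtoC 1) (RtoC (fst (f t)))) (Cmult Ci (RtoC (snd (f t)))))).
  by move=> t _; rewrite -C_decompose.
apply: (is_RInt_plus (V := VR CC)).
  exact: (is_RInt_linear _ _ _ _ _ (is_linear_RtoC (RtoC 1)) H1).
exact: (is_RInt_linear _ _ _ _ _ (is_linear_RtoC Ci) H2).
Qed.

Section Geometry.
Variable iota : C.
Hypothesis iota_sq : Cmult iota iota = RtoC (-1).

Lemma iota_parts : fst iota = 0 /\ (snd iota = 1 \/ snd iota = -1).
Proof.
case: iota iota_sq => x y; rewrite /Cmult /RtoC /= => -[h1 h2].
have hx : x = 0 by nra.
split=> //; rewrite hx in h1.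
have : (y - 1) * (y + 1) = 0 by lra.
by move=> /Rmult_integral; lra.
Qed.

(** The point of the quadrant [{a - iota b}]; there [Re (iota z^2) = 2 a b]. *)
Definition pt (a b : R) : C := Cminus (RtoC a) (Cmult iota (RtoC b)).

Lemma pt_re a b : Re (pt a b) = a.
Proof. by case: iota_parts => h _; rewrite /pt /Re /= h; ring. Qed.

Definition mu (z : C) : C := Cmult iota (Cmult z z).

Lemma mu_pt_re a b : Re (mu (pt a b)) = 2 * a * b.
Proof.
case: iota_parts => h h2; rewrite /mu /pt /Re /= h.
have : snd iota * snd iota = 1 by case: h2 => ->; ring.
move=> e.
transitivity (2 * a * b * (snd iota * snd iota)); first by ring.
by rewrite e; ring.
Qed.

Lemma pt_mod a b : 0 <= a -> 0 <= b -> a <= Cmod (pt a b) /\ b <= Cmod (pt a b).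
Proof.
move=> ha hb; have h := Cmod2_alt (pt a b).
rewrite pt_re in h.
have e : Im (pt a b) ^ 2 = b ^ 2.
  case: iota_parts => h1 h2; rewrite /pt /Im /= h1; case: h2 => ->; ring.
rewrite e in h.
have p := Cmod_ge_0 (pt a b).
split.
  by apply: Rnot_lt_le => q; nra.
by apply: Rnot_lt_le => q; nra.
Qed.

Lemma mu_mod z : Cmod (mu z) = Cmod z ^ 2.
Proof. by rewrite /mu !Cmod_mult (iota_mod iota iota_sq); ring. Qed.

Lemma ray_pt1 a b t : ray (pt a b) (RtoC 1) t = pt (a + t) b.
Proof. by rewrite /ray /pt RtoC_plus; ring. Qed.

Lemma ray_pt2 a b t : ray (pt a b) (Copp iota) t = pt a (b + t).
Proof. by rewrite /ray /pt RtoC_plus; ring. Qed.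

(** Turns decay in [|z|] into decay in the parameter of either leg of the path. *)
Lemma exp_pt_le a b t : 0 <= a -> 0 <= b -> t <= a \/ t <= b ->
  exp (- Cmod (pt a b)) <= exp (- t).
Proof. by move=> ha hb h; have [h1 h2] := pt_mod a b ha hb; apply: exp_le_compat; lra. Qed.

End Geometry.

(** * The scalar kernel of the contour integral *)

Section Kernel.
Variables (iota : C) (s : R).
Hypothesis iota_sq : Cmult iota iota = RtoC (-1).
Hypothesis hs : 1 < s < 2.
Notation mu := (mu iota).

(** [2 z hat phi (iota z^2) dz = -iota hat phi (mu) dmu] for [mu = iota z^2]. *)
Definition kernel (phi : R -> C) (z : C) : C :=
  Cmult (Cmult (RtoC 2) z) (hat phi (mu z)).

Definition kernel_d1 (phi : R -> C) (z : C) : C :=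
  Cplus (Cmult (RtoC 2) (hat phi (mu z)))
    (Cmult (Cmult (Cmult (RtoC 4) iota) (Cmult z z)) (hat (tmul phi) (mu z))).

(** [12 iota] collects [4 iota] from the first summand of [kernel_d1] and [8 iota] from the second;
    [-8] is [4 iota] times [2 iota]. *)
Definition kernel_d2 (phi : R -> C) (z : C) : C :=
  Cplus (Cmult (Cmult (Cmult (RtoC 12) iota) z) (hat (tmul phi) (mu z)))
    (Cmult (Cmult (RtoC (-8)) (Cmult z (Cmult z z))) (hat (tmul (tmul phi)) (mu z))).

Lemma cder_hat_mu phi a b z : cont_cpt phi a b ->
  cder (fun z => hat phi (mu z) : CC) z
    (Cmult (Cmult (Cmult (RtoC 2) iota) z) (hat (tmul phi) (mu z))).
Proof.
move=> H.
have D : cder (fun z => mu z : CC) z (Cmult (Cmult (RtoC 2) iota) z).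
  apply: der_eq (der_Cmult C_abs _ _ z _ _ (der_const _ _ (iota : CC) z)
    (der_Cmult C_abs _ _ z _ _ (cder_id z) (cder_id z))) _.
  by rewrite /zero /=; ring.
exact: (der_comp _ _ C_abs (hat phi : C -> CC) _ z _ _ D (cder_hat phi a b _ H)).
Qed.

Lemma kernel_jet2 phi a b z : a <= b -> smooth phi -> supported_in phi a b ->
  jet2 (E := CC) (kernel phi) (kernel_d1 phi) (kernel_d2 phi) z.
Proof.
move=> hab H S.
have H1 := tmul_smooth _ H. have S1 := tmul_supported _ _ _ S.
have H2 := tmul_smooth _ H1. have S2 := tmul_supported _ _ _ S1.
have D0 w := cder_hat_mu phi a b w (smooth_cont_cpt0 _ _ _ hab H S).
have D1 w := cder_hat_mu (tmul phi) a b w (smooth_cont_cpt0 _ _ _ hab H1 S1).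
have D2 w := cder_hat_mu (tmul (tmul phi)) a b w (smooth_cont_cpt0 _ _ _ hab H2 S2).
have c2 := der_cnt _ _ C_abs _ _ _ (D2 z).
have c1 := der_cnt _ _ C_abs _ _ _ (D1 z).
have ci := der_cnt _ _ C_abs _ _ _ (cder_id z).
have k c : ccnt (fun _ : C => c : CC) z by exact: cnt_const.
have kd c := der_const C_AbsRing (fun z : C => z) (c : CC) z.
split; [|split].
- apply: der_eq (der_Cmult C_abs _ _ z _ _ (der_Cmult C_abs _ _ z _ _ (kd (RtoC 2)) (cder_id z)) (D0 z)) _.
  by rewrite /kernel_d1 /zero /=; ring.
- apply: der_eq (der_plus _ _ _ _ z _ _ (der_Cmult C_abs _ _ z _ _ (kd (RtoC 2)) (D0 z))
   (der_Cmult C_abs _ _ z _ _ (der_Cmult C_abs _ _ z _ _ (kd (Cmult (RtoC 4) iota))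
      (der_Cmult C_abs _ _ z _ _ (cder_id z) (cder_id z))) (D1 z))) _.
  rewrite /kernel_d2 /zero /plus /=.
  have -> : RtoC (-8) = Cmult (RtoC 8) (Cmult iota iota) by rewrite iota_sq -RtoC_mult; congr RtoC; ring.
  ring.
- by apply: cnt_plus; do !apply: cnt_Cmult.
Qed.

Lemma pow_le_exp r n : 0 <= r -> (n <= 3)%nat -> r ^ n <= exp (3 * r).
Proof.
move=> hr hn.
have h := one_plus_le_exp r hr.
have -> : exp (3 * r) = exp r ^ 3 by rewrite /= Rmult_1_r -!exp_plus; congr exp; ring.
apply: (Rle_trans _ (exp r ^ n)); first by apply: pow_incr; lra.
by apply: Rle_pow; [lra|].
Qed.

(** The condition with [S] limits the growth of the weight [exp (t Re mu)] on the support. As the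
    transform beats every exponential in [|z|], any prescribed rate [L] is reached, uniformly in
    [phi] up to the factor [c]. *)
Lemma kernel_le T h S L : 0 < T -> 0 < h -> 0 <= S -> 0 < L ->
  exists D, 0 <= D /\ forall phi a b c z, - T <= a -> a <= b -> b <= T ->
    smooth phi -> supported_in phi a b -> ultra_bound (gevrey s) phi h c ->
    (forall t, a <= t <= b -> t * Re (mu z) <= S * Cmod z) ->
    Cmod (kernel phi z) <= D * c * exp (- L * Cmod z) /\
    Cmod (kernel_d1 phi z) <= D * c * exp (- L * Cmod z) /\
    Cmod (kernel_d2 phi z) <= D * c * exp (- L * Cmod z).
Proof.
move=> hT hh hS hL.
have hi : 0 < / h by apply: Rinv_0_lt_compat.
have hi2 : 0 < / (2 * h) by apply: Rinv_0_lt_compat; lra.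
(* [S] absorbs the weight and [3] the powers of [|z|] up to the third; the rate [L] is left. *)
have HL : 0 < L + S + 3 by lra.
have [D0 [p0 B0]] := hat_decay s h _ (proj2 hs) hh HL.
have [D1 [p1 B1]] := hat_decay s (2 * h) _ (proj2 hs) ltac:(lra) HL.
have [D2 [p2 B2]] := hat_decay s (2 * (2 * h)) _ (proj2 hs) ltac:(lra) HL.
pose q1 := T + / h. pose q2 := T + / (2 * h).
have hq1 : 0 < q1 by rewrite /q1; lra.
have hq2 : 0 < q2 by rewrite /q2; lra.
pose M := 2 * T * (D0 + D1 * q1 + D2 * (q1 * q2)).
have m1 : 0 < D1 * q1 by apply: Rmult_lt_0_compat.
have m2 : 0 < D2 * (q1 * q2) by apply: Rmult_lt_0_compat => //; apply: Rmult_lt_0_compat.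
have hM : 0 <= M by rewrite /M; apply: Rmult_le_pos; lra.
(* [20 = 12 + 8], the coefficients of [kernel_d2]. *)
exists (20 * M); split; first lra.
move=> phi a b c z ha hab hb H Sp U reg.
have hc := ultra_bound_ge0 _ _ _ _ U.
have SpT : supported_in phi (- T) T by move=> t Ht; apply: Sp; lra.
have H1 := tmul_smooth _ H. have S1 := tmul_supported _ _ _ Sp.
have S1T := tmul_supported _ _ _ SpT.
have H2 := tmul_smooth _ H1. have S2 := tmul_supported _ _ _ S1.
have U1 := tmul_ultra_bound s phi T h c ltac:(lra) hh ltac:(lra) H SpT U.
have U2 := tmul_ultra_bound s _ T (2 * h) _ ltac:(lra) ltac:(lra) ltac:(lra) H1 S1T U1.
set r := Cmod z; have hr : 0 <= r := Cmod_ge_0 z.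
have reg' t : a <= t <= b -> exp (t * Re (mu z)) <= exp (S * r).
  by move=> Ht; apply: exp_le_compat; apply: reg.
have mm := mu_mod iota iota_sq z.
have {}B0 := B0 phi a b c _ r _ hab H Sp U reg' hr mm.
have {}B1 := B1 _ a b _ _ r _ hab H1 S1 U1 reg' hr mm.
have {}B2 := B2 _ a b _ _ r _ hab H2 S2 U2 reg' hr mm.
have e3 : exp (S * r) * exp (- (L + S + 3) * r) * exp (3 * r) = exp (- L * r).
  by rewrite -!exp_plus; congr exp; ring.
set w := exp (S * r) in B0 B1 B2 e3. set v := exp (- (L + S + 3) * r) in B0 B1 B2 e3.
have hw : 0 < w := exp_pos _. have hv : 0 < v := exp_pos _.
have wv : 0 < w * v by apply: Rmult_lt_0_compat.
have cwv : 0 <= c * (w * v) by apply: Rmult_le_pos; lra.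
have gen D q x : 0 <= D * q -> 2 * T * (D * q) <= M ->
   Cmod x <= D * ((b - a) * w * (c * q)) * v -> Cmod x <= M * (c * (w * v)).
  move=> hD hDM hx; apply: Rle_trans hx _.
  have -> : D * ((b - a) * w * (c * q)) * v = (b - a) * (D * q) * (c * (w * v)) by ring.
  apply: Rmult_le_compat_r => //; apply: Rle_trans hDM.
  by apply: Rmult_le_compat_r => //; lra.
have t0 : Cmod (hat phi (mu z)) <= M * (c * (w * v)).
  apply: (gen D0 1); rewrite ?Rmult_1_r //; first lra.
  by rewrite /M; apply: Rmult_le_compat_l; lra.
have t1 : Cmod (hat (tmul phi) (mu z)) <= M * (c * (w * v)).
  apply: (gen D1 q1) => //; first lra.
  by rewrite /M; apply: Rmult_le_compat_l; lra.
have t2 : Cmod (hat (tmul (tmul phi)) (mu z)) <= M * (c * (w * v)).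
  apply: (gen D2 (q1 * q2)); first lra.
    by rewrite /M; apply: Rmult_le_compat_l; lra.
  by rewrite -(Rmult_assoc c q1 q2).
set X := M * (c * (w * v)) in t0 t1 t2.
have X0 : 0 <= X by apply: Rmult_le_pos.
have tgt : 20 * M * c * exp (- L * r) = 20 * (X * exp (3 * r)).
  by rewrite -e3 /X; ring.
rewrite tgt.
have E n x : (n <= 3)%nat -> Cmod x <= X -> r ^ n * Cmod x <= X * exp (3 * r).
  move=> hn hx; rewrite (Rmult_comm X).
  apply: Rmult_le_compat => //; [exact: pow_le|exact: Cmod_ge_0|exact: pow_le_exp].
have E0 := E 0%nat _ ltac:(lia) t0. have E1 := E 1%nat _ ltac:(lia) t0.
have E2 := E 1%nat _ ltac:(lia) t1. have E3 := E 2%nat _ ltac:(lia) t1.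
have E4 := E 3%nat _ ltac:(lia) t2.
have Xe : 0 <= X * exp (3 * r) by apply: Rmult_le_pos => //; exact: Rlt_le (exp_pos _).
have im := iota_mod iota iota_sq.
rewrite /= ?Rmult_1_r ?Rmult_1_l in E0 E1 E2 E3 E4.
split; [|split].
- by rewrite /kernel !Cmod_mult Cmod_R Rabs_pos_eq -/r; lra.
- apply: Rle_trans (Cmod_triangle _ _) _.
  by rewrite !Cmod_mult !Cmod_R im !Rabs_pos_eq -/r; lra.
- apply: Rle_trans (Cmod_triangle _ _) _.
  rewrite !Cmod_mult !Cmod_R im (Rabs_pos_eq 12) -/r; last lra.
  rewrite Rabs_left1; last lra.
  lra.
Qed.

(** Here [Re mu = 2 a b], and either [a] is bounded by [C1] or [b] vanishes; these cases cover the
    two legs of every path with corner on [[0, C1]]. *)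
Lemma kernel_reg T C1 a b : 0 <= T -> 0 <= C1 -> 0 <= a -> 0 <= b -> a <= C1 \/ b = 0 ->
  forall t, - T <= t <= T -> t * Re (mu (pt iota a b)) <= 2 * T * C1 * Cmod (pt iota a b).
Proof.
move=> hT hC ha hb h t Ht.
rewrite mu_pt_re //.
have [m1 m2] := pt_mod iota iota_sq a b ha hb.
set r := Cmod _ in m1 m2 *.
have hr : 0 <= r by lra.
have key : a * b <= C1 * r.
  case: h => [h|->]; last by rewrite Rmult_0_r; apply: Rmult_le_pos.
  by apply: Rmult_le_compat.
have ab : 0 <= a * b by apply: Rmult_le_pos.
have -> : t * (2 * a * b) = 2 * (t * (a * b)) by ring.
have -> : 2 * T * C1 * r = 2 * (T * (C1 * r)) by ring.
apply: Rmult_le_compat_l; first lra.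
apply: (Rle_trans _ (T * (a * b))); first by apply: Rmult_le_compat_r; lra.
by apply: Rmult_le_compat_l.
Qed.

(** Adding the values at [mu] and [- mu] leaves a cosine, which folds [[-T, T]] onto [[0, T]]; as
    the cosine is even, the sign of [iota] disappears. *)
Lemma cos_transform_at phi T xi : 0 < T -> smooth phi -> supported_in phi (- T) T ->
  Cplus (hat phi (Cmult iota (RtoC xi))) (hat phi (Copp (Cmult iota (RtoC xi)))) =
  (2 * RInt (fun t => (fst (phi t) + fst (phi (- t))) * cos (xi * t)) 0 T,
   2 * RInt (fun t => (snd (phi t) + snd (phi (- t))) * cos (xi * t)) 0 T).
Proof.
move=> hT H S.
have hab : - T <= T by lra.
have Hc := smooth_cont_cpt0 _ _ _ hab H S.
have I := is_RInt_plus (V := VR CC) _ _ _ _ _ _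
  (is_RInt_hat _ _ _ Hc (Cmult iota (RtoC xi)) (- T) T (Rle_refl _) (Rle_refl _))
  (is_RInt_hat _ _ _ Hc (Copp (Cmult iota (RtoC xi))) (- T) T (Rle_refl _) (Rle_refl _)).
have [i0 i1] := iota_parts iota iota_sq.
have E t : Cplus (Cexp (Cmult (Cmult iota (RtoC xi)) (RtoC t)))
    (Cexp (Cmult (Copp (Cmult iota (RtoC xi))) (RtoC t))) = RtoC (2 * cos (xi * t)).
  pose y1 := snd iota * xi * t.
  have Ey y : Cexp (0, y) = (cos y, sin y).
    by rewrite /Cexp /= exp_0 !Rmult_1_l.
  have -> : Cmult (Cmult iota (RtoC xi)) (RtoC t) = (0, y1).
    by apply: injective_projections; rewrite /= i0 /y1; ring.
  have -> : Cmult (Copp (Cmult iota (RtoC xi))) (RtoC t) = (0, - y1).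
    by apply: injective_projections; rewrite /= i0 /y1; ring.
  rewrite !Ey cos_neg sin_neg /RtoC; apply: injective_projections => /=; last ring.
  have -> : cos y1 = cos (xi * t).
    rewrite /y1; case: i1 => ->.
      by congr cos; ring.
    by rewrite -cos_neg; congr cos; ring.
  ring.
have I' : is_RInt (V := VR CC) (fun t => Cmult (RtoC (2 * cos (xi * t))) (phi t)) (- T) T
  (Cplus (hat phi (Cmult iota (RtoC xi))) (hat phi (Copp (Cmult iota (RtoC xi))))).
  apply: (is_RInt_ext (V := VR CC)) I => t _.
  by rewrite -E /hat_integrand /plus /=; ring.
have J1 := is_RInt_linear _ _ _ _ _ is_linear_fst I'.
have J2 := is_RInt_linear _ _ _ _ _ is_linear_snd I'.
have fold (f : R -> R) (v : R) : (forall t, continuous f t) ->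
   is_RInt (fun t => 2 * cos (xi * t) * f t) (- T) T v ->
   v = 2 * RInt (fun t => (f t + f (- t)) * cos (xi * t)) 0 T.
  move=> hf Hv.
  pose g t := 2 * cos (xi * t) * f t.
  have gc t : continuous g t.
    apply: (continuous_mult (fun t => 2 * cos (xi * t)) f) => //.
    by apply: (ex_derive_continuous (fun t => 2 * cos (xi * t))); auto_derive.
  have ei u w : ex_RInt g u w.
    by apply: (ex_RInt_continuous (V := R_CompleteNormedModule)) => z _; exact: gc.
  have C1 := RInt_correct _ _ _ (ei (- T) 0). have C2 := RInt_correct _ _ _ (ei 0 T).
  have C3 := is_RInt_Chasles _ _ _ _ _ _ C1 C2.
  rewrite (is_RInt_value_unique _ _ _ _ _ Hv C3).
  have O : is_RInt (fun t => - g (- t)) 0 T (- RInt g (- T) 0).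
    have := is_RInt_comp_opp g 0 T (- RInt g (- T) 0).
    apply; rewrite Ropp_0; exact: is_RInt_swap C1.
  have P1 := is_RInt_minus _ _ _ _ _ _ C2 O.
  have P2 := is_RInt_scal _ _ _ (/ 2) _ P1.
  have -> : RInt (fun t => (f t + f (- t)) * cos (xi * t)) 0 T =
     / 2 * (RInt g 0 T - - RInt g (- T) 0).
    apply: is_RInt_unique; apply: is_RInt_ext P2 => t _.
    rewrite /scal /minus /plus /opp /= /mult /= /g.
    rewrite (_ : xi * - t = - (xi * t)) ?cos_neg; [field|ring].
  by rewrite /plus /=; set x := RInt g 0 T; set y := RInt g _ 0; change (y + x = 2 * (/ 2 * (x - - y))); field.
have cont t : continuous (fun t => fst (phi t)) t /\ continuous (fun t => snd (phi t)) t.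
  have [h1 h2] := H 1%nat t.
  by split; apply: ex_derive_continuous.
apply: injective_projections => /=.
  apply: fold; first by move=> t; apply: (proj1 (cont t)).
  by apply: is_RInt_ext J1 => t _; rewrite /=; ring.
apply: fold; first by move=> t; apply: (proj2 (cont t)).
by apply: is_RInt_ext J2 => t _; rewrite /=; ring.
Qed.

(** With the corner at [0] both legs lie on the axes, where [iota z^2] is [iota t^2] and
    [- iota t^2]; the factor [2 t] is the derivative of [t^2]. *)
Lemma kernel_axis phi t : Cplus (kernel phi (RtoC t)) (Cmult iota (kernel phi (Cmult (RtoC t) (Copp iota)))) =
  Cmult (RtoC (2 * t)) (Cplus (hat phi (Cmult iota (RtoC (t ^ 2)))) (hat phi (Copp (Cmult iota (RtoC (t ^ 2)))))).
Proof.
rewrite /kernel /mu.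
have -> : Cmult iota (Cmult (RtoC t) (RtoC t)) = Cmult iota (RtoC (t ^ 2)).
  by rewrite /= Rmult_1_r RtoC_mult.
have -> : Cmult iota (Cmult (Cmult (RtoC t) (Copp iota)) (Cmult (RtoC t) (Copp iota))) =
   Copp (Cmult iota (RtoC (t ^ 2))).
  transitivity (Cmult iota (Cmult (Cmult iota iota) (Cmult (RtoC t) (RtoC t)))); first by ring.
  rewrite iota_sq /= Rmult_1_r RtoC_mult (_ : RtoC (-1) = Copp (RtoC 1)); first by ring.
  by rewrite -RtoC_opp.
have -> : forall x, Cmult iota (Cmult (Cmult (RtoC 2) (Cmult (RtoC t) (Copp iota))) x) =
  Cmult (Copp (Cmult iota iota)) (Cmult (Cmult (RtoC 2) (RtoC t)) x) by move=> x; ring.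
rewrite iota_sq -RtoC_opp (_ : - -1 = 1) ?(RtoC_mult 2 t); [ring|lra].
Qed.

(** The substitution [xi = t^2] turns the path integral up to [N] into twice the integral up to
    [N^2] of the cosine transform of [F t = phi t + phi (- t)]. By [cosine_inversion] its limit is
    [2 (PI / 2) F 0 = 2 PI phi 0]. *)
Lemma kernel_axis_improper phi T h c : 0 < T -> smooth phi -> supported_in phi (- T) T ->
  ultra_bound (gevrey s) phi h c ->
  improper (V := VR CC) (fun t => Cplus (kernel phi (RtoC t))
     (Cmult iota (kernel phi (Cmult (RtoC t) (Copp iota))))) (Cmult (RtoC (2 * PI)) (phi 0)).
Proof.
move=> hT H S U.
have hab : - T <= T by lra.
have der p t : is_derive (fun u => fst (phi u)) t (Derive (fun u => fst (phi u)) t).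
  by apply: Derive_correct; apply: (proj1 (H 1%nat t)).
have comp (f : R -> R) : (forall p t, ex_derive_n f p t) ->
    (forall t, Rabs (Derive f t) <= c * h ^ 1 * gevrey s 1) ->
    (forall t, ~ (- T <= t <= T) -> f t = 0) ->
  let P := fun xi => RInt (fun t => (f t + f (- t)) * cos (xi * t)) 0 T in
  (forall N, 0 <= N -> is_RInt (fun t => 2 * t * (2 * P (t ^ 2))) 0 N (2 * RInt P 0 (N ^ 2))) /\
  (forall eps, 0 < eps -> exists X0, forall X, X0 <= X ->
    Rabs (2 * RInt P 0 X - 2 * PI * f 0) <= eps).
  move=> sm bd sp P.
  have D1 t : is_derive f t (Derive f t) by apply: Derive_correct; apply: (sm 1%nat).
  have D2 t : continuous (Derive f) t.
    by apply: ex_derive_continuous; apply: (sm 2%nat).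
  pose F t := f t + f (- t). pose F' t := Derive f t - Derive f (- t).
  have DF t : is_derive F t (F' t).
    rewrite /F /F'; auto_derive.
      by split; [exact: (sm 1%nat)|split; [exact: (sm 1%nat)|]].
    by change (1 * Derive f t + - (1) * Derive f (- t) = Derive f t - Derive f (- t)); ring.
  have cF' t : continuous F' t.
    apply: (continuous_minus (V := R_NormedModule)) => //.
    apply: (continuous_comp Ropp (Derive f)) => //.
    by apply: (ex_derive_continuous Ropp); auto_derive.
  have cF t : continuous F t by apply: ex_derive_continuous; eexists; exact: DF.
  have bF' t : Rabs (F' t) <= 2 * (c * h ^ 1 * gevrey s 1).
    apply: Rle_trans (Rabs_triang _ _) _; rewrite Rabs_Ropp.
    by have := bd t; have := bd (- t); lra.
  have sF t : T < t -> F t = 0 by move=> Ht; rewrite /F !sp; lra.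
  have cP xi : continuous P xi.
    by apply: cos_integral_continuous => //; lra.
  split.
    move=> N hN.
    have I := is_RInt_comp (V := R_CompleteNormedModule) P (fun t => t ^ 2) (fun t => 2 * t) 0 N
       (fun x _ => cP (x ^ 2)).
    have I2 := is_RInt_scal _ _ _ 2 _ (I _).
    rewrite (_ : 0 ^ 2 = 0) in I2; last by ring.
    apply: is_RInt_ext (I2 _) => t _.
      by rewrite /scal /= /mult /=; ring.
    split; first by auto_derive => //; ring.
    by apply: (ex_derive_continuous (fun t => 2 * t)); auto_derive.
  move=> e He.
  have [X0 HX] := cosine_inversion F F' T _ hT DF cF' bF' sF (e/2) ltac:(lra).
  exists X0 => X hX; have := HX X hX; rewrite /F Ropp_0 -/(P _).
  have -> : 2 * RInt P 0 X - 2 * PI * f 0 = 2 * (RInt P 0 X - PI / 2 * (f 0 + f 0)) by field.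
  rewrite Rabs_mult (Rabs_pos_eq 2); last lra.
  move=> q; apply: (Rle_trans _ (2 * (e/2))); last lra.
  by apply: Rmult_le_compat_l; [lra|exact: q].
have b1 t := U 1%nat t.
have [A1 A2] := comp (fun t => fst (phi t)) (fun p t => proj1 (H p t))
  (fun t => Rle_trans _ _ _ (re_le_Cmod _) (U 1%nat t)) (fun t Ht => f_equal fst (S t Ht)).
have [B1 B2] := comp (fun t => snd (phi t)) (fun p t => proj2 (H p t))
  (fun t => Rle_trans _ _ _ (Rle_trans _ _ _ (Rmax_r _ _) (Rmax_Cmod _)) (U 1%nat t))
  (fun t Ht => f_equal snd (S t Ht)).
set P1 := (fun xi => RInt (fun t => (fst (phi t) + _) * _) 0 T) in A1 A2.
set P2 := (fun xi => RInt (fun t => (snd (phi t) + _) * _) 0 T) in B1 B2.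
apply: (improper_limit (V := VR CC) _ (fun N => (2 * RInt P1 0 (N ^ 2), 2 * RInt P2 0 (N ^ 2)))).
  move=> N hN.
  have J := is_RInt_C_pair (fun t => (2 * t * (2 * P1 (t ^ 2)), 2 * t * (2 * P2 (t ^ 2)))) 0 N _ _
    (A1 N hN) (B1 N hN).
  apply: (is_RInt_ext (V := VR CC)) J => t _.
  rewrite kernel_axis (cos_transform_at _ _ _ hT H S) -/(P1 (t ^ 2)) -/(P2 (t ^ 2)).
  by rewrite /Cmult /RtoC /=; apply: injective_projections => /=; ring.
move=> e He.
have [X1 h1] := A2 (e/2) ltac:(lra). have [X2 h2] := B2 (e/2) ltac:(lra).
exists (Rmax 1 (Rmax X1 X2)) => N hN.
have n1 := Rmax_l 1 (Rmax X1 X2). have n2 := Rmax_r 1 (Rmax X1 X2).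
have n3 := Rmax_l X1 X2. have n4 := Rmax_r X1 X2.
have NN : N <= N ^ 2 by rewrite /=; nra.
apply: Rle_trans (Cmod_le_abs _) _.
rewrite /minus /plus /opp /=.
have := h1 (N ^ 2) ltac:(lra); have := h2 (N ^ 2) ltac:(lra).
move=> u v.
apply: (Rle_trans _ (e/2 + e/2)); last lra.
apply: Rplus_le_compat.
  apply: Rle_trans v; apply: Req_le; congr Rabs; rewrite /=; ring.
apply: Rle_trans u; apply: Req_le; congr Rabs; rewrite /=; ring.
Qed.

End Kernel.

Ltac lra_or := first [lra | left; lra | right; lra].

(** * The vector-valued contour integral and its properties *)

Section Assembly.
Context {E : NormedModule C_AbsRing} {cE : complete_space E}.
Variables (A : linop E) (C0 N k : R) (Rs : C -> E -> E).
Hypothesis A_closed : closed_linop A.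
Hypothesis HR : square_resolvent A C0 N k Rs.
Variables (iota : C) (s : R).
Hypothesis iota_sq : Cmult iota iota = RtoC (-1).
Hypothesis hs : 1 < s < 2.
Notation pt := (pt iota).
Notation kernel := (kernel iota).
Notation contour := (contour iota).

(** To the right of [C0], where [Rs] is controlled, and positive, so that the whole path lies in the
    quadrant parametrised by [pt]. *)
Definition corner : R := Rmax C0 0 + 1.

Lemma corner_gt : C0 < corner /\ 0 < corner.
Proof. by rewrite /corner; have := Rmax_l C0 0; have := Rmax_r C0 0; lra. Qed.

Lemma on_rays_pt a b (P : R -> C -> Prop) :
  (forall t, 0 <= t -> P t (pt (a + t) b) /\ P t (pt a (b + t))) ->
  on_rays iota (pt a b) P.
Proof. by move=> H t Ht; rewrite ray_pt1 ray_pt2; apply: H. Qed.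

Definition tdata (phi : R -> C) (a b h c : R) : Prop :=
  smooth phi /\ supported_in phi a b /\ ultra_bound (gevrey s) phi h c.

Definition reg (a b S : R) (z : C) : Prop :=
  forall t, a <= t <= b -> t * Re (mu iota z) <= S * Cmod z.

(** Serves for the resolvent and for a constant vector alike; [D'] is uniform in [phi], [x] and
    [z]. *)
Lemma scal_kernel_jets T h S (b b1 b2 : E -> C -> E) D w :
  0 < T -> 0 < h -> 0 <= S -> 0 <= D -> 0 <= w ->
  exists D', 0 <= D' /\ forall phi u v c x z, - T <= u -> u <= v -> v <= T ->
    tdata phi u v h c -> reg u v S z ->
    jet2 (b x) (b1 x) (b2 x) z ->
    norm (b x z) <= D * exp (w * Cmod z) * norm x ->
    norm (b1 x z) <= D * exp (w * Cmod z) * norm x ->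
    norm (b2 x z) <= D * exp (w * Cmod z) * norm x ->
    let g := fun z => kernel phi z *; b x z in
    let g1 := fun z => plus (kernel_d1 iota phi z *; b x z) (kernel phi z *; b1 x z) in
    let g2 := fun z => plus (kernel_d2 iota phi z *; b x z)
      (plus (Cmult (RtoC 2) (kernel_d1 iota phi z) *; b1 x z) (kernel phi z *; b2 x z)) in
    jet2 g g1 g2 z /\
    norm (g z) <= D' * c * norm x * exp (- Cmod z) /\
    norm (g1 z) <= D' * c * norm x * exp (- Cmod z) /\
    norm (g2 z) <= D' * c * norm x * exp (- Cmod z).
Proof.
move=> hT hh hS hD hw.
(* In the rate [w + 1], [w] cancels the growth of the vector factor and [1] is the surviving
   decay. *)
have [K [K0 HK]] := kernel_le iota s iota_sq hs T h S (w + 1) hT hh hS ltac:(lra).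
exists (4 * (K * D)); split; first by have := Rmult_le_pos _ _ K0 hD; lra.
move=> phi u v c x z hu huv hv [H1 [H2 H3]] hreg J n0 n1 n2 g g1 g2.
split.
  apply: jet2_scal => //; exact: (kernel_jet2 iota iota_sq phi u v).
have [k0 [k1 k2]] := HK phi u v c z hu huv hv H1 H2 H3 hreg.
have -> : 4 * (K * D) * c * norm x * exp (- Cmod z) =
  4 * (K * c * exp (- (w + 1) * Cmod z) * (D * exp (w * Cmod z) * norm x)).
  have -> : exp (- Cmod z) = exp (- (w + 1) * Cmod z) * exp (w * Cmod z).
    by rewrite -exp_plus; congr exp; ring.
  ring.
exact: jet2_scal_le.
Qed.

Lemma reg_strip T a b : 0 <= T -> 0 <= a -> 0 <= b -> a <= corner \/ b = 0 ->
  reg (- T) T (2 * T * corner) (pt a b).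
Proof.
move=> hT ha hb h t Ht; apply: kernel_reg => //.
by have := corner_gt; lra.
Qed.

Lemma corner_exp T h : 0 < T -> 0 < h ->
  exists D, 0 <= D /\ forall phi c x, tdata phi (- T) T h c ->
  on_rays iota (pt corner 0) (fun t z =>
    ccnt (fun z => kernel phi z *; Rs z x) z /\
    norm (kernel phi z *; Rs z x) <= D * c * norm x * exp (- t)).
Proof.
move=> hT hh; have [hc0 hc1] := corner_gt.
have [D [w [hD [hw HD]]]] := resolvent_jet_le A C0 N k Rs HR.
have [D' [hD' H]] := scal_kernel_jets T h (2 * T * corner) (res1 Rs) (res_d1 Rs) (res_d2 Rs)
   D w hT hh ltac:(nra) hD hw.
exists D'; split=> // phi c x Hphi; apply: on_rays_pt => t Ht.
have hc := ultra_bound_ge0 _ _ _ _ (proj2 (proj2 Hphi)).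
have nx := norm_ge_0 x.
have Dcx : 0 <= D' * c * norm x by do !apply: Rmult_le_pos.
have aux a b : 0 <= a -> 0 <= b -> C0 < a -> a <= corner \/ b = 0 -> t <= a \/ t <= b ->
  ccnt (fun z => kernel phi z *; Rs z x) (pt a b) /\
    norm (kernel phi (pt a b) *; Rs (pt a b) x) <= D' * c * norm x * exp (- t).
  move=> ha hb hC hst ht.
  have hre : C0 < Re (pt a b) by rewrite pt_re.
  have [n0 [n1 n2]] := HD x (pt a b) hre.
  have [[j _] [n _]] := H phi (- T) T c x (pt a b) (Rle_refl _) ltac:(lra) (Rle_refl _) Hphi
    (reg_strip T a b ltac:(lra) ha hb hst) (resolvent_jet2 A C0 N k Rs HR x _ hre) n0 n1 n2.
  split; first exact: (der_cnt _ _ C_abs _ _ _ j).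
  apply: Rle_trans n _; apply: Rmult_le_compat_l => //.
  exact: exp_pt_le.
by split; apply: aux; lra_or.
Qed.

Definition sol_integrand (phi : R -> C) (x : E) (z : C) : E := kernel phi z *; Rs z x.

(** Choice makes the value total; for test functions the contour integral exists, and uniqueness of
    its value identifies the choice. *)
Definition raw_sol (phi : R -> C) (x : E) : E :=
  epsilon (inhabits zero) (contour (sol_integrand phi x) (pt corner 0)).

Definition sol (phi : R -> C) (x : E) : E :=
  Cinv (Cmult (RtoC (2 * PI)) iota) *; raw_sol phi x.

Lemma raw_sol_eq phi x l : contour (sol_integrand phi x) (pt corner 0) l -> raw_sol phi x = l.
Proof.
move=> H; refine (contour_unique iota _ _ _ _ _ H).
by rewrite /raw_sol; apply: epsilon_spec; exists l.
Qed.

Lemma raw_sol_spec phi T h c x : 0 < T -> 0 < h -> tdata phi (- T) T h c ->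
  contour (sol_integrand phi x) (pt corner 0) (raw_sol phi x).
Proof.
move=> hT hh H; have [D [hD HD]] := corner_exp T h hT hh.
have [l [Hl _]] := contour_ex iota iota_sq _ _ _ (HD phi c x H).
by rewrite (raw_sol_eq _ _ _ Hl).
Qed.

Lemma raw_sol_bound T h : 0 < T -> 0 < h -> exists m, 0 <= m /\
  forall phi c x, tdata phi (- T) T h c -> norm (raw_sol phi x) <= m * c * norm x.
Proof.
move=> hT hh; have [D [hD HD]] := corner_exp T h hT hh.
exists (2 * D); split; first lra; move=> phi c x H.
have := contour_le iota iota_sq _ _ _ _ (HD phi c x H) (raw_sol_spec _ _ _ _ x hT hh H).
lra.
Qed.

Definition image_integrand (phi : R -> C) (x : E) (z : C) : E :=
  kernel phi z *; minus (Cmult z z *; Rs z x) x.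

(** Closedness moves [A] under the integral, where [A Rs = z^2 Rs - 1]; the kernel also beats the
    extra [z^2]. The bound on [y] is the graph norm part of the continuity of the solution. *)
Lemma raw_sol_graph T h : 0 < T -> 0 < h -> exists m, 0 <= m /\
  forall phi c x, tdata phi (- T) T h c -> exists y,
    contour (image_integrand phi x) (pt corner 0) y /\
    graph A (raw_sol phi x) y /\ norm y <= m * c * norm x.
Proof.
move=> hT hh; have [hc0 hc1] := corner_gt.
have hk := sr_k _ _ _ _ _ HR. have hN := sr_N _ _ _ _ _ HR.
(* [k] cancels the resolvent, [3] absorbs [|z|^2], and [1] is left as decay. *)
have [K [K0 HK]] := kernel_le iota s iota_sq hs T h (2 * T * corner) (k + 3 + 1) hT hh
  ltac:(nra) ltac:(lra).
exists (2 * (K * (N + 1))); split; first nra.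
move=> phi c x Hphi; have [H1 [H2 H3]] := Hphi.
have hc := ultra_bound_ge0 _ _ _ _ H3. have nx := norm_ge_0 x.
have aux : on_rays iota (pt corner 0) (fun t z => ccnt (image_integrand phi x) z /\
    norm (image_integrand phi x z) <= K * (N + 1) * c * norm x * exp (- t)).
  apply: on_rays_pt => t Ht.
  have aux a b : 0 <= a -> 0 <= b -> C0 < a -> a <= corner \/ b = 0 -> t <= a \/ t <= b ->
      ccnt (image_integrand phi x) (pt a b) /\
      norm (image_integrand phi x (pt a b)) <= K * (N + 1) * c * norm x * exp (- t).
    move=> ha hb hC hst ht.
    have hre : C0 < Re (pt a b) by rewrite pt_re.
    set z := pt a b.
    have [k0 _] := HK phi (- T) T c z (Rle_refl _) ltac:(lra) (Rle_refl _) H1 H2 H3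
      (reg_strip T a b ltac:(lra) ha hb hst).
    have [j _] := kernel_jet2 iota iota_sq phi (- T) T z ltac:(lra) H1 H2.
    have [j2 _] := resolvent_jet2 A C0 N k Rs HR x z hre.
    have ci := der_cnt _ _ C_abs _ _ _ (cder_id z).
    split.
      apply: cnt_scal; first exact: (der_cnt _ _ C_abs _ _ _ j).
      apply: (cnt_ext (fun z => plus (Cmult z z *; Rs z x) (RtoC (-1) *; x))).
        by move=> y; module_eq E.
      apply: cnt_plus; last exact: cnt_const.
      apply: cnt_scal; first by apply: cnt_Cmult.
      exact: (der_cnt _ _ C_abs _ _ _ j2).
    apply: Rle_trans (norm_cscal _ _) _.
    set r := Cmod z in k0 * . have hr : 0 <= r := Cmod_ge_0 z.
    have e1 : 1 <= exp (k * r) by rewrite -exp_0; apply: exp_le_compat; nra.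
    have b1 : norm (minus (Cmult z z *; Rs z x) x) <= (N + 1) * exp ((k + 3) * r) * norm x.
      apply: Rle_trans (norm_minus_le _ _) _.
      apply: Rle_trans (Rplus_le_compat_r _ _ _ (norm_cscal _ _)) _.
      have q := sr_le _ _ _ _ _ HR z x hre; rewrite -/r in q.
      rewrite Cmod_mult -/r.
      have r2 := pow_le_exp r 2 hr ltac:(lia).
      have r0 := pow_le_exp r 0 hr ltac:(lia).
      rewrite /= Rmult_1_r in r2; rewrite /= in r0.
      have -> : exp ((k + 3) * r) = exp (k * r) * exp (3 * r).
        by rewrite -exp_plus; congr exp; ring.
      set e := exp (k * r) in e1 q *. set f := exp (3 * r) in r2 r0 *.
      have q2 : r * r * norm (Rs z x) <= f * (N * e * norm x).
        by apply: Rmult_le_compat => //; [nra|exact: norm_ge_0].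
      have ef : 1 <= e * f by nra.
      have : norm x <= e * f * norm x by nra.
      have -> : (N + 1) * (e * f) * norm x = f * (N * e * norm x) + e * f * norm x by ring.
      lra.
    have -> : K * (N + 1) * c * norm x * exp (- t) =
       (K * c * (N + 1) * norm x) * exp (- t) by ring.
    apply: (Rle_trans _ ((K * c * (N + 1) * norm x) * exp (- r))); last first.
      apply: Rmult_le_compat_l; last exact: exp_pt_le.
      by do !apply: Rmult_le_pos => //; lra.
    have -> : (K * c * (N + 1) * norm x) * exp (- r) =
      (K * c * exp (- (k + 3 + 1) * r)) * ((N + 1) * exp ((k + 3) * r) * norm x).
      have -> : exp (- r) = exp (- (k + 3 + 1) * r) * exp ((k + 3) * r).
        by rewrite -exp_plus; congr exp; ring.
      ring.
    by apply: Rmult_le_compat => //; [exact: Cmod_ge_0|exact: norm_ge_0].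
  by split; apply: aux; lra_or.
have [y [Hy ny]] := contour_ex iota iota_sq _ _ _ aux.
exists y; split=> //; split; last lra.
apply: (graph_improper A A_closed) (raw_sol_spec _ _ _ _ x hT hh Hphi) Hy.
move=> t Ht; rewrite ray_pt1 ray_pt2 /sol_integrand /image_integrand.
have g a b : C0 < a -> graph A (Rs (pt a b) x) (minus (Cmult (pt a b) (pt a b) *; Rs (pt a b) x) x).
  move=> ha; have hre : C0 < Re (pt a b) by rewrite pt_re.
  by split; [exact: (sr_dom _ _ _ _ _ HR)|exact: (sr_app _ _ _ _ _ HR)].
by apply: graph_plus; [|apply: graph_scal]; apply: graph_scal; apply: g; lra.
Qed.

(** Without the resolvent the integrand is entire, so the corner may leave the half-plane and move
    along the real axis to [0], where [kernel_axis_improper] evaluates the integral. *)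
Lemma kernel_contour phi T h c x : 0 < T -> 0 < h -> tdata phi (- T) T h c ->
  contour (fun z => kernel phi z *; x) (pt corner 0) (Cmult (RtoC (2 * PI)) (phi 0) *; x).
Proof.
move=> hT hh Hphi; have [hc0 hc1] := corner_gt; have [H1 [H2 H3]] := Hphi.
have [D [hD HD]] := scal_kernel_jets T h (2 * T * corner) (fun x _ => x) (fun _ _ => zero)
  (fun _ _ => zero) 1 0 hT hh ltac:(nra) Rle_0_1 (Rle_refl 0).
have hc := ultra_bound_ge0 _ _ _ _ H3. have nx := norm_ge_0 x.
have Dcx : 0 <= D * c * norm x by do !apply: Rmult_le_pos.
have bnd a b t : 0 <= a -> 0 <= b -> a <= corner \/ b = 0 -> t <= a \/ t <= b ->
    let g := fun z => kernel phi z *; x in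
    let g1 := fun z => plus (kernel_d1 iota phi z *; x) (kernel phi z *; zero) in
    let g2 := fun z => plus (kernel_d2 iota phi z *; x)
      (plus (Cmult (RtoC 2) (kernel_d1 iota phi z) *; zero) (kernel phi z *; zero)) in
    jet2 g g1 g2 (pt a b) /\
    norm (g (pt a b)) <= D * c * norm x * exp (- t) /\
    norm (g1 (pt a b)) <= D * c * norm x * exp (- t) /\
    norm (g2 (pt a b)) <= D * c * norm x * exp (- t).
  move=> ha hb hst ht g g1 g2.
  have n1 : 1 * exp (0 * Cmod (pt a b)) * norm x = norm x by rewrite Rmult_0_l exp_0; ring.
  have jc : jet2 (fun _ => x) (fun _ => zero) (fun _ => zero) (pt a b).
    by split; [exact: der_const|split; [exact: der_const|exact: cnt_const]].
  have := HD phi (- T) T c x (pt a b) (Rle_refl _) ltac:(lra) (Rle_refl _) Hphi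
     (reg_strip T a b ltac:(lra) ha hb hst) jc.
  rewrite n1 norm_zero => h0; have [j [b0 [b1 b2]]] := h0 (Rle_refl _) nx nx.
  have le : D * c * norm x * exp (- Cmod (pt a b)) <= D * c * norm x * exp (- t).
    by apply: Rmult_le_compat_l => //; exact: exp_pt_le.
  split; first exact: j.
  by split; [exact: Rle_trans b0 le|split; [exact: Rle_trans b1 le|exact: Rle_trans b2 le]].
have rth th : ray (pt 0 0) (RtoC 1) th = pt th 0 by rewrite ray_pt1 Rplus_0_l.
have hyp th : 0 <= th <= corner ->
   on_rays iota (ray (pt 0 0) (RtoC 1) th) (fun t z =>
     jet2 (fun z => kernel phi z *; x)
       (fun z => plus (kernel_d1 iota phi z *; x) (kernel phi z *; zero))
       (fun z => plus (kernel_d2 iota phi z *; x)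
      (plus (Cmult (RtoC 2) (kernel_d1 iota phi z) *; zero) (kernel phi z *; zero))) z /\
     norm (kernel phi z *; x) <= D * c * norm x * exp (- t) /\
     norm (plus (kernel_d1 iota phi z *; x) (kernel phi z *; zero)) <= D * c * norm x * exp (- t) /\
     norm (plus (kernel_d2 iota phi z *; x)
      (plus (Cmult (RtoC 2) (kernel_d1 iota phi z) *; zero) (kernel phi z *; zero))) <= D * c * norm x * exp (- t)).
  move=> Hth; rewrite rth; apply: on_rays_pt => t Ht.
  by split; apply: bnd; lra_or.
have [l [Hl _]] : exists l, contour (fun z => kernel phi z *; x) (pt corner 0) l /\ norm l <= 2 * (D * c * norm x).
  apply: (contour_ex iota iota_sq) => t Ht.
  have := hyp corner ltac:(lra) t Ht; rewrite rth => -[[[j _] [n _]] [[j' _] [n' _]]].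
  by split; split=> //; apply: (der_cnt _ _ C_abs); eassumption.
have H0 : contour (fun z => kernel phi z *; x) (pt 0 0) (Cmult (RtoC (2 * PI)) (phi 0) *; x).
  apply: improper_ext (improper_linear _ _ _ (is_linear_cscal_vector x)
    (kernel_axis_improper iota s iota_sq phi T h c hT H1 H2 H3)) => t Ht.
  have -> : ray (pt 0 0) (RtoC 1) t = RtoC t by rewrite /ray /pt; ring.
  have -> : ray (pt 0 0) (Copp iota) t = Cmult (RtoC t) (Copp iota) by rewrite /ray /pt; ring.
  by module_eq E.
suff <- : l = Cmult (RtoC (2 * PI)) (phi 0) *; x by [].
symmetry.
apply: (contour_translate iota iota_sq _ _ _ _ _ _ _ _ _ (Rlt_le _ _ hc1) hyp H0).
by rewrite rth.
Qed.

(** For [t <= 0] and [Re mu = 2 a b >= 0] the weight [exp (t Re mu)] is at most [1], so the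
    estimates hold with [S = 0] on the whole part of the quadrant to the right of [C0]. The corner
    can then go to infinity, the integral being at most [2 M exp(-Hh)]. *)
Lemma sol_support phi T h c x : 0 < T -> 0 < h -> tdata phi (- T) 0 h c -> raw_sol phi x = zero.
Proof.
move=> hT hh Hphi; have [hc0 hc1] := corner_gt.
have [D [w [hD [hw HD]]]] := resolvent_jet_le A C0 N k Rs HR.
have [D' [hD' H]] := scal_kernel_jets T h 0 (res1 Rs) (res_d1 Rs) (res_d2 Rs)
   D w hT hh (Rle_refl 0) hD hw.
have [H1 [H2 H3]] := Hphi.
have hc := ultra_bound_ge0 _ _ _ _ H3. have nx := norm_ge_0 x.
pose M := D' * c * norm x.
have hM : 0 <= M by do !apply: Rmult_le_pos.
have HT : tdata phi (- T) T h c by split=> //; split=> // t Ht; apply: H2; lra.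
pose d := Cminus (RtoC 1) iota.
have rd th : ray (pt corner 0) d th = pt (corner + th) th.
  by rewrite /ray /pt /d RtoC_plus; ring.
have bnd a b : C0 < a -> 0 <= a -> 0 <= b ->
    let g := fun z => kernel phi z *; res1 Rs x z in
    let g1 := fun z => plus (kernel_d1 iota phi z *; res1 Rs x z) (kernel phi z *; res_d1 Rs x z) in
    let g2 := fun z => plus (kernel_d2 iota phi z *; res1 Rs x z)
      (plus (Cmult (RtoC 2) (kernel_d1 iota phi z) *; res_d1 Rs x z) (kernel phi z *; res_d2 Rs x z)) in
    jet2 g g1 g2 (pt a b) /\
    norm (g (pt a b)) <= M * exp (- Cmod (pt a b)) /\
    norm (g1 (pt a b)) <= M * exp (- Cmod (pt a b)) /\
    norm (g2 (pt a b)) <= M * exp (- Cmod (pt a b)).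
  move=> hC ha hb.
  have hre : C0 < Re (pt a b) by rewrite pt_re.
  have [n0 [n1 n2]] := HD x (pt a b) hre.
  apply: (H phi (- T) 0 c x (pt a b)) => //; try lra.
    move=> t Ht; rewrite mu_pt_re // Rmult_0_l.
    have : 0 <= a * b by apply: Rmult_le_pos.
    by nra.
  exact: (resolvent_jet2 A C0 N k Rs HR).
have sol0 := raw_sol_spec _ _ _ _ x hT hh HT.
apply: norm_minus_eq_zero => e He.
have -> : minus (raw_sol phi x) zero = raw_sol phi x by module_eq E.
have [Hh [hH0 hH]] := exp_decay_small 1 Rlt_0_1 (2 * M) e He.
have small : on_rays iota (ray (pt corner 0) d Hh) (fun t z =>
   ccnt (fun z => kernel phi z *; res1 Rs x z) z /\
   norm (kernel phi z *; res1 Rs x z) <= M * exp (- Hh) * exp (- t)).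
  rewrite rd; apply: on_rays_pt => t Ht.
  have aux a b : C0 < a -> 0 <= a -> 0 <= b -> Hh + t <= a \/ Hh + t <= b ->
    ccnt (fun z => kernel phi z *; res1 Rs x z) (pt a b) /\
    norm (kernel phi (pt a b) *; res1 Rs x (pt a b)) <= M * exp (- Hh) * exp (- t).
    move=> hC ha hb ht.
    have [[j _] [n _]] := bnd a b hC ha hb.
    split; first exact: (der_cnt _ _ C_abs _ _ _ j).
    apply: Rle_trans n _; rewrite Rmult_assoc -exp_plus.
    apply: Rmult_le_compat_l => //.
    have -> : - Hh + - t = - (Hh + t) by ring.
    exact: exp_pt_le.
  by split; apply: aux; lra_or.
have [l' [Hl' nl']] := contour_ex iota iota_sq _ _ _ small.
have hyp th : 0 <= th <= Hh ->
   on_rays iota (ray (pt corner 0) d th) (fun t z =>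
     jet2 (fun z => kernel phi z *; res1 Rs x z)
       (fun z => plus (kernel_d1 iota phi z *; res1 Rs x z) (kernel phi z *; res_d1 Rs x z))
       (fun z => plus (kernel_d2 iota phi z *; res1 Rs x z)
      (plus (Cmult (RtoC 2) (kernel_d1 iota phi z) *; res_d1 Rs x z) (kernel phi z *; res_d2 Rs x z))) z /\
     norm (kernel phi z *; res1 Rs x z) <= M * exp (- t) /\
     norm (plus (kernel_d1 iota phi z *; res1 Rs x z) (kernel phi z *; res_d1 Rs x z)) <= M * exp (- t) /\
     norm (plus (kernel_d2 iota phi z *; res1 Rs x z)
      (plus (Cmult (RtoC 2) (kernel_d1 iota phi z) *; res_d1 Rs x z) (kernel phi z *; res_d2 Rs x z))) <= M * exp (- t)).
  move=> Hth; rewrite rd; apply: on_rays_pt => t Ht.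
  have aux a b : C0 < a -> 0 <= a -> 0 <= b -> t <= a \/ t <= b ->
     M * exp (- Cmod (pt a b)) <= M * exp (- t).
    by move=> hC ha hb ht; apply: Rmult_le_compat_l => //; exact: exp_pt_le.
  have [j [b0 [b1 b2]]] := bnd (corner + th + t) th ltac:(lra) ltac:(lra) ltac:(lra).
  have le := aux (corner + th + t) th ltac:(lra) ltac:(lra) ltac:(lra) ltac:(lra_or).
  have [j' [b0' [b1' b2']]] := bnd (corner + th) (th + t) ltac:(lra) ltac:(lra) ltac:(lra).
  have le' := aux (corner + th) (th + t) ltac:(lra) ltac:(lra) ltac:(lra) ltac:(lra_or).
  split; (split; first by []).
    by split; [exact: Rle_trans b0 le|split; [exact: Rle_trans b1 le|exact: Rle_trans b2 le]].
  by split; [exact: Rle_trans b0' le'|split; [exact: Rle_trans b1' le'|exact: Rle_trans b2' le']].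
rewrite (contour_translate iota iota_sq _ _ _ _ _ _ _ _ _ hH0 hyp sol0 Hl').
apply: Rle_trans nl' _; have := hH Hh (Rle_refl _).
have -> : - (1) * Hh = - Hh by ring.
lra.
Qed.

(** Reduces both classes to one pair [h], [c] on a symmetric interval; in the Beurling case [h = 1]
    is picked. The summand [1] keeps [T] positive. *)
Lemma test_on_tdata cl a b phi : test_on cl (gevrey s) a b phi -> smooth phi /\
  (forall T, Rabs a + Rabs b + 1 <= T -> supported_in phi (- T) T) /\
  exists h c, 0 < h /\ ultra_bound (gevrey s) phi h c.
Proof.
move=> [H1 [H2 H3]]; split=> //; split.
  move=> T HT t Ht; apply: (supported_in_supp _ _ _ H2) => q; apply: Ht.
  have := Rle_abs (- a); have := Rle_abs b; rewrite Rabs_Ropp.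
  have := Rabs_pos a; have := Rabs_pos b; lra.
case: cl H3 => H3; last by have [h [c [hh Hc]]] := H3; exists h, c.
by have [c Hc] := H3 1 Rlt_0_1; exists 1, c; split; [lra|].
Qed.

Lemma test_tdata cl phi : test cl (gevrey s) phi ->
  exists T h c, 0 < T /\ 0 < h /\ tdata phi (- T) T h c.
Proof.
move=> [a [b H]]; have [H1 [H2 [h [c [hh Hc]]]]] := test_on_tdata _ _ _ _ H.
exists (Rabs a + Rabs b + 1), h, c.
split; first by have := Rabs_pos a; have := Rabs_pos b; lra.
by split=> //; split=> //; split=> //; apply: H2; lra.
Qed.

Lemma tdata_cont phi T h c : 0 < T -> tdata phi (- T) T h c -> cont_cpt phi (- T) T.
Proof. by move=> hT [H1 [H2 _]]; apply: smooth_cont_cpt0 => //; lra. Qed.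

Lemma sol_additive phi T h c x y : 0 < T -> 0 < h -> tdata phi (- T) T h c ->
  raw_sol phi (plus x y) = plus (raw_sol phi x) (raw_sol phi y).
Proof.
move=> hT hh H; have [hc0 hc1] := corner_gt; apply: raw_sol_eq.
have := contour_plus iota _ _ _ _ _ (raw_sol_spec _ _ _ _ x hT hh H) (raw_sol_spec _ _ _ _ y hT hh H).
apply: contour_ext; apply: on_rays_pt => t Ht; rewrite /sol_integrand.
by split; rewrite (sr_plus _ _ _ _ _ HR) ?pt_re //; [module_eq E|lra|module_eq E].
Qed.

Lemma sol_homogeneous phi T h c (a : C) x : 0 < T -> 0 < h -> tdata phi (- T) T h c ->
  raw_sol phi (a *; x) = a *; raw_sol phi x.
Proof.
move=> hT hh H; have [hc0 hc1] := corner_gt; apply: raw_sol_eq.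
have := contour_scal iota a _ _ _ (raw_sol_spec _ _ _ _ x hT hh H).
apply: contour_ext; apply: on_rays_pt => t Ht; rewrite /sol_integrand.
by split; rewrite (sr_scal _ _ _ _ _ HR) ?pt_re //; [module_eq E|lra|module_eq E].
Qed.

Lemma norm_sol_factor (y : E) : norm (Cinv (Cmult (RtoC (2 * PI)) iota) *; y) <= norm y.
Proof.
apply: Rle_trans (norm_cscal _ _) _.
have im := iota_mod iota iota_sq.
have nz : Cmult (RtoC (2 * PI)) iota <> RtoC 0.
  apply/Cmod_gt_0; rewrite Cmod_mult im Cmod_R Rmult_1_r; apply: Rabs_pos_lt.
  by have := PI_RGT_0; lra.
rewrite Cmod_inv // Cmod_mult im Cmod_R Rmult_1_r Rabs_pos_eq; last by have := PI_RGT_0; lra.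
rewrite -{2}(Rmult_1_l (norm y)); apply: Rmult_le_compat_r; first exact: norm_ge_0.
rewrite -Rinv_1; apply: Rinv_le_contravar; first lra.
by have := PI2_1; lra.
Qed.

(** [m] depends on [T] and [h] only: this is continuity on each step of the inductive limit, for
    either class. *)
Lemma sol_graph_bound T h : 0 < T -> 0 < h -> exists m, 0 <= m /\
  forall phi c, tdata phi (- T) T h c ->
    (forall x, dom A (sol phi x)) /\ graph_opnorm_le (scale_linop iota A) (sol phi) (m * c).
Proof.
move=> hT hh; have [m1 [p1 B1]] := raw_sol_bound T h hT hh.
have [m2 [p2 B2]] := raw_sol_graph T h hT hh.
exists (m1 + m2); split; first lra.
move=> phi c H; split=> x.
  have [y [_ [[g _] _]]] := B2 phi c x H.
  exact: dom_scal.
have [y [_ [[g e] n]]] := B2 phi c x H.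
rewrite /graph_norm /= /scale_app /sol app_scal // e.
have n1 := norm_sol_factor (raw_sol phi x). have n2 := B1 phi c x H.
have n3 := norm_sol_factor y.
have n4 := norm_cscal iota (Cinv (Cmult (RtoC (2 * PI)) iota) *; y).
rewrite (iota_mod iota iota_sq) in n4.
lra.
Qed.

(** The transformed function is [- phi'], so [hat_derive] yields multiplication by the spectral
    variable with a positive sign. *)
Lemma hat_neg_derive phi T h c z : 0 < T -> tdata phi (- T) T h c ->
  hat (fun t => delta' (fun u => phi (t + u))) z = Cmult z (hat phi z).
Proof.
move=> hT [H1 [H2 H3]].
have ee t : delta' (fun u => phi (t + u)) = Cmult (RtoC (-1)) (CDerive_n phi 1 t).
  have sh (f : R -> R) : (forall t, ex_derive f t) -> Derive (fun u => f (t + u)) 0 = Derive f t.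
    move=> hf; apply: is_derive_unique.
    have := is_derive_comp f (fun u => t + u) 0 (Derive f t) 1.
    rewrite Rplus_0_r /scal /= /mult /= Rmult_1_l; apply; first by apply: Derive_correct.
    by auto_derive.
  rewrite /delta' /CDerive_n /=.
  rewrite (sh (fun u => fst (phi u))); last by move=> v; apply: (proj1 (H1 1%nat v)).
  rewrite (sh (fun u => snd (phi u))); last by move=> v; apply: (proj2 (H1 1%nat v)).
  by apply: injective_projections => /=; ring.
have hab : - T <= T by lra.
rewrite (hat_ext _ _ _ ee) (hat_scal _ _ (- T) T); last exact: smooth_cont_cpt.
rewrite (hat_derive phi _ (- T) T); [|exact: smooth_cont_cpt0|exact: smooth_cont_cpt|].
  by rewrite (_ : RtoC (-1) = Copp (RtoC 1)); [ring|rewrite -RtoC_opp].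
move=> t; apply: der_ext (smooth_rder phi 0 t H1); exact: CDerive_n_0.
Qed.

Lemma conv_delta_eq (G : (R -> C) -> E -> E) phi : conv delta G phi = G phi.
Proof.
by rewrite /conv /delta; congr G; apply: functional_extensionality => t; rewrite Rplus_0_r.
Qed.

Theorem sol_fundamental cl : fundamental_solution cl (gevrey s) (scale_linop iota A) sol.
Proof.
have [hc0 hc1] := corner_gt.
have im := iota_mod iota iota_sq.
have nz : Cmult (RtoC (2 * PI)) iota <> RtoC 0.
  apply/Cmod_gt_0; rewrite Cmod_mult im Cmod_R Rmult_1_r; apply: Rabs_pos_lt.
  by have := PI_RGT_0; lra.
have factor : Cmult (Cinv (Cmult (RtoC (2 * PI)) iota)) (Cmult iota (RtoC (2 * PI))) = RtoC 1.
  by rewrite (Cmult_comm iota) Cinv_l.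
(* Multiplying the transform by [iota z^2] gives [iota z^2 Rs x = iota ((z^2 Rs x - x) + x)]: the
   integrand of [y] plus the part evaluated by [kernel_contour]. *)
have deriv phi T h c x y : 0 < T -> 0 < h -> tdata phi (- T) T h c ->
   contour (image_integrand phi x) (pt corner 0) y ->
   conv delta' sol phi x = Cinv (Cmult (RtoC (2 * PI)) iota) *;
      (iota *; plus y (Cmult (RtoC (2 * PI)) (phi 0) *; x)).
  move=> hT hh H Hy; rewrite /conv /sol; congr (_ *; _); apply: raw_sol_eq.
  have := contour_scal iota iota _ _ _ (contour_plus iota _ _ _ _ _ Hy (kernel_contour _ _ _ _ x hT hh H)).
  apply: contour_ext => t Ht; rewrite /image_integrand /sol_integrand /kernel.
  rewrite !(hat_neg_derive phi T h c) // /mu.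
  by split; module_eq E.
(* The terms in [y] cancel, and the normalising factor removes [2 PI iota]. *)
have final (phi : R -> C) (x y : E) :
   minus (Cinv (Cmult (RtoC (2 * PI)) iota) *; (iota *; plus y (Cmult (RtoC (2 * PI)) (phi 0) *; x)))
     (iota *; (Cinv (Cmult (RtoC (2 * PI)) iota) *; y)) = phi 0 *; x.
  transitivity (Cmult (Cmult (Cinv (Cmult (RtoC (2 * PI)) iota)) (Cmult iota (RtoC (2 * PI)))) (phi 0) *; x).
    by module_eq E.
  by rewrite factor Cmult_1_l.
split; last split; last split.
- split; last split; last split.
  + move=> phi Hphi; have [T [h [c [hT [hh H]]]]] := test_tdata _ _ Hphi.
    have [m [hm Hm]] := sol_graph_bound T h hT hh.
    have [hd hb] := Hm phi c H.
    have hc := ultra_bound_ge0 _ _ _ _ (proj2 (proj2 H)).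
    split; last by split=> //; exists (m * c).
    split.
    * by move=> x y; rewrite /sol (sol_additive _ _ _ _ x y hT hh H) scal_distr_l.
    * move=> a x; rewrite /sol (sol_homogeneous _ _ _ _ a x hT hh H).
      by change (Cinv (Cmult (RtoC (2 * PI)) iota) *; (a *; raw_sol phi x) =
         (a : C) *; (Cinv (Cmult (RtoC (2 * PI)) iota) *; raw_sol phi x)); module_eq E.
    * exists (m * c + 1); split; first by have := Rmult_le_pos _ _ hm hc; lra.
      move=> x; have := hb x; rewrite /graph_norm.
      have := norm_ge_0 (app (scale_linop iota A) (sol phi x)); have := norm_ge_0 x; lra.
  + move=> phi psi x Hphi Hpsi.
    have [T1 [h1 [c1 [hT1 [hh1 H1]]]]] := test_tdata _ _ Hphi.
    have [T2 [h2 [c2 [hT2 [hh2 H2]]]]] := test_tdata _ _ Hpsi.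
    rewrite /sol; have -> : raw_sol (fun t => Cplus (phi t) (psi t)) x = plus (raw_sol phi x) (raw_sol psi x).
      apply: raw_sol_eq.
      have := contour_plus iota _ _ _ _ _ (raw_sol_spec _ _ _ _ x hT1 hh1 H1) (raw_sol_spec _ _ _ _ x hT2 hh2 H2).
      have m1 := Rmax_l T1 T2. have m2 := Rmax_r T1 T2.
      apply: contour_ext => t Ht; rewrite /sol_integrand /kernel.
      have w1 := cont_cpt_widen _ _ _ (- Rmax T1 T2) (Rmax T1 T2)
        (tdata_cont _ _ _ _ hT1 H1) ltac:(lra) m1.
      have w2 := cont_cpt_widen _ _ _ (- Rmax T1 T2) (Rmax T1 T2)
        (tdata_cont _ _ _ _ hT2 H2) ltac:(lra) m2.
      rewrite !(hat_plus phi psi (- Rmax T1 T2) (Rmax T1 T2)) //.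
      by split; module_eq E.
    by module_eq E.
  + move=> a phi x Hphi.
    have [T [h [c [hT [hh H]]]]] := test_tdata _ _ Hphi.
    rewrite /sol; have -> : raw_sol (fun t => Cmult a (phi t)) x = a *; raw_sol phi x.
      apply: raw_sol_eq.
      have := contour_scal iota a _ _ _ (raw_sol_spec _ _ _ _ x hT hh H).
      apply: contour_ext => t Ht; rewrite /sol_integrand /kernel.
      rewrite !(hat_scal a phi (- T) T); try exact: tdata_cont H.
      by split; module_eq E.
    by module_eq E.
  + move=> a b.
    have hT : 0 < Rabs a + Rabs b + 1 by have := Rabs_pos a; have := Rabs_pos b; lra.
    have key h : 0 < h -> exists m, forall phi c, test_on cl (gevrey s) a b phi ->
        ultra_bound (gevrey s) phi h c ->
        graph_opnorm_le (scale_linop iota A) (sol phi) (m * c).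
      move=> hh; have [m [hm Hm]] := sol_graph_bound _ h hT hh.
      exists m => phi c /test_on_tdata [H1 [H2 _]] H3.
      by apply: (proj2 (Hm phi c _)); split=> //; split=> //; apply: H2; lra.
    case: cl key => key; last exact: key.
    (* Beurling continuity asks for one seminorm; [h = 1] will do. *)
    by have [m Hm] := key 1 Rlt_0_1; exists 1, m; split; [lra|].
- move=> phi Hphi Hs x.
  have [T [h [c [hT [hh [H1 [H2 H3]]]]]]] := test_tdata _ _ Hphi.
  rewrite /sol (sol_support phi T h c x hT hh); first exact: scal_zero_r.
  split=> //; split=> // t Ht.
  case: (excluded_middle_informative (- T <= t <= T)) => Ht2; last exact: H2.
  apply: NNPP => Hn; have hs' : supp phi t.
    by move=> L; apply: Hn; apply: (locally_singleton _ _ L).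
  by have := Hs t hs'; lra.
- move=> phi x Hphi.
  have [T [h [c [hT [hh H]]]]] := test_tdata _ _ Hphi.
  have [m [hm Hm]] := raw_sol_graph T h hT hh.
  have [y [Hy [[g e] _]]] := Hm phi c x H.
  rewrite (deriv phi T h c x y) // conv_delta_eq /= /scale_app /sol app_scal // e.
  exact: final.
- move=> phi x Hphi Hx.
  have [T [h [c [hT [hh H]]]]] := test_tdata _ _ Hphi.
  have [m [hm Hm]] := raw_sol_graph T h hT hh.
  have [y [Hy _]] := Hm phi c x H.
  rewrite (deriv phi T h c x y) // conv_delta_eq.
  have -> : sol phi (app (scale_linop iota A) x) =
    iota *; (Cinv (Cmult (RtoC (2 * PI)) iota) *; y).
    rewrite /sol /= /scale_app (_ : raw_sol phi (iota *; app A x) = iota *; y).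
      by module_eq E.
    rewrite (sol_homogeneous phi T h c) //; congr (_ *; _); apply: raw_sol_eq.
    (* [sr_comm] turns [Rs z (A x)] into [z^2 Rs z x - x], so the same [y] appears as in the first
       identity. *)
    apply: contour_ext Hy; apply: on_rays_pt => t Ht; rewrite /sol_integrand /image_integrand.
    by split; rewrite (sr_comm _ _ _ _ _ HR) ?pt_re //; lra.
  exact: final.
Qed.

End Assembly.

(** * Laplace transforms of convoluted cosine functions *)

(** Half of the rate pays for the polynomial: [T <= 2 exp (T/2)] and [T^2 <= 16 exp (T/2)], whence
    the constant [2 + 2 * 16 L]. *)
Lemma poly_exp_decay L : 0 <= L -> exists D, 0 <= D /\ forall T, 0 <= T ->
  exp (- T) * (T + L * (2 * T ^ 2)) <= D * exp (- (/ 2) * T).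
Proof.
move=> hL; exists (2 + 32 * L); split; first lra.
move=> T hT.
have h1 := one_plus_le_exp (T / 4) ltac:(lra).
have e : exp (T / 2) = exp (T / 4) ^ 2 by rewrite /= Rmult_1_r -exp_plus; congr exp; field.
have e2 : exp (- T) * exp (T / 2) = exp (- (/ 2) * T) by rewrite -exp_plus; congr exp; field.
have t1 : T <= 2 * exp (T / 2) by rewrite e; nra.
have t2 : T ^ 2 <= 16 * exp (T / 2).
  rewrite e; have : (T / 4) ^ 2 <= exp (T / 4) ^ 2 by apply: pow_incr; lra.
  lra.
rewrite -e2.
have -> : (2 + 32 * L) * (exp (- T) * exp (T / 2)) = exp (- T) * ((2 + 32 * L) * exp (T / 2)) by ring.
by apply: Rmult_le_compat_l; [exact: Rlt_le (exp_pos _)|nra].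
Qed.

Section VectorCalculus.
Context {E : NormedModule C_AbsRing} {cE : complete_space E}.

Lemma is_RInt_rcnt (c : R -> E) a b : (forall t, rcnt c t) ->
  is_RInt (V := VR E) c a b (RInt (V := VR E) c a b).
Proof. by move=> hc; apply: RInt_correct; apply: rcnt_ex_RInt. Qed.

Lemma rder_primitive (c : R -> E) t : (forall t, rcnt c t) ->
  rder (fun t => RInt (V := VR E) c 0 t : E) t (c t).
Proof.
move=> hc e He; have [d [hd Hd]] := hc t e He.
exists d; split=> // h Hh.
have I1 := is_RInt_rcnt c 0 t hc. have I2 := is_RInt_rcnt c t (t + h) hc.
have I3 := is_RInt_unique _ _ _ _ (is_RInt_Chasles _ _ _ _ _ _ I1 I2).
have I4 := is_RInt_minus _ _ _ _ _ _ I2 (is_RInt_const (V := @VR E cE) t (t + h) (c t)).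
have B : norm (minus (RInt (V := @VR E cE) c t (t + h)) (scal (t + h - t) (c t : @VR E cE)) : @VR E cE)
    <= Rabs (t + h - t) * e.
  apply: (norm_RInt_le_const_abs _ _ _ _ _ _ I4) => x Hx.
  have hx : Rabs (x - t) < d.
    apply: Rle_lt_trans Hh; rewrite /abs /=; move: Hx; rewrite /Rmin /Rmax.
    case: Rle_dec => q Hx; rewrite /Rabs; repeat match goal with |- context [Rcase_abs ?x] => destruct (Rcase_abs x) end; lra.
  have := Hd (x - t) hx; rewrite (_ : plus t (x - t) = x); last by rewrite /plus /=; ring.
  by move=> q; exact: Rlt_le.
rewrite (_ : t + h - t = h) in B; last by ring.
rewrite Rmult_comm.
have -> : minus (minus (RInt (V := @VR E cE) c 0 (plus t h) : E) (RInt (V := @VR E cE) c 0 t)) (RtoC h *; c t)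
  = minus (RInt (V := @VR E cE) c t (t + h)) (scal h (c t : @VR E cE)) :> E.
  rewrite (_ : plus t h = t + h) // I3; module_eq E.
exact: B.
Qed.

Lemma norm_RInt_growth (c : R -> E) M T : 0 <= T -> (forall t, rcnt c t) ->
  (forall t, 0 <= t <= T -> norm (c t) <= M) -> norm (RInt (V := VR E) c 0 T : E) <= T * M.
Proof.
move=> hT hc hM.
have := norm_RInt_le_const (V := @VR E cE) c 0 T _ M hT hM (is_RInt_rcnt c 0 T hc).
by rewrite Rminus_0_r.
Qed.

End VectorCalculus.

Section VectorLaplace.
Context {E : NormedModule C_AbsRing} {cE : complete_space E}.
Variables (c : R -> E) (M omega : R).
Hypothesis c_cnt : forall t, rcnt c t.
Hypothesis omega_ge0 : 0 <= omega.
Hypothesis c_le : forall t, 0 <= t -> norm (c t) <= M * exp (omega * t).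

Definition exp_weight (z : C) (t : R) : C := Cexp (Copp (Cmult z (RtoC t))).

Lemma rder_exp_weight z t :
  rder (exp_weight z : R -> CC) t (Cmult (Copp z) (exp_weight z t)).
Proof.
have ee s : Cexp (Cmult (Copp z) (RtoC s)) = exp_weight z s by rewrite /exp_weight; congr Cexp; ring.
by rewrite -ee; apply: der_ext (rder_Cexp (Copp z) t) => s; rewrite ee.
Qed.

Lemma rcnt_exp_weight z t : rcnt (exp_weight z : R -> CC) t.
Proof. exact: (der_cnt _ RtoC RtoC_abs _ _ _ (rder_exp_weight z t)). Qed.

Lemma Cmod_exp_weight z t : Cmod (exp_weight z t) = exp (- (Re z * t)).
Proof. by rewrite Cmod_Cexp; congr exp; rewrite /Re /=; ring. Qed.

Definition integral1 (t : R) : E := RInt (V := VR E) c 0 t.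
(** The second primitive [int_0^t (t - s) c s ds], split so that the product rule can differentiate
    it. *)
Definition integral2 (t : R) : E :=
  minus (RtoC t *; integral1 t) (RInt (V := VR E) (fun s => RtoC s *; c s) 0 t).

Lemma mul_time_cnt t : rcnt (fun s => RtoC s *; c s) t.
Proof. by apply: cnt_scal => //; exact: rcnt_RtoC. Qed.

Lemma rder_integral2 t : rder integral2 t (integral1 t).
Proof.
have D1 := @rder_primitive E cE c t c_cnt.
have D2 := @rder_primitive E cE _ t mul_time_cnt.
have D0 : rder (RtoC : R -> CC) t (RtoC 1).
  have e0 : forall s : R, Cplus (RtoC 0) (Cmult (RtoC s) (RtoC 1)) = RtoC s.
    by move=> s; ring.
  exact: der_ext e0 (rder_line (RtoC 0) (RtoC 1) t).
have D3 := der_plus _ _ _ _ _ _ _ (der_scal _ _ RtoC_abs _ _ _ _ _ D0 D1)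
  (der_scal _ _ RtoC_abs _ _ _ _ _ (der_const _ RtoC (RtoC (-1) : CC) t) D2).
apply: der_eq (der_ext _ _ _ _ _ D3) _.
  by move=> s; rewrite /integral2 /integral1; module_eq E.
by rewrite /integral1; module_eq E; rewrite /zero /=; ring.
Qed.

Lemma is_RInt_integral2 t : is_RInt (V := VR E) (fun s => RtoC (t - s) *; c s) 0 t (integral2 t).
Proof.
have I1 := is_RInt_linear _ _ _ _ _ (is_linear_cscal (RtoC t)) (@is_RInt_rcnt E cE c 0 t c_cnt).
have I2 := @is_RInt_rcnt E cE _ 0 t mul_time_cnt.
have I3 := is_RInt_minus _ _ _ _ _ _ I1 I2.
apply: is_RInt_ext I3 => s _.
change (minus (RtoC t *; c s) (RtoC s *; c s) = RtoC (t - s) *; c s).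
by rewrite RtoC_minus; module_eq E.
Qed.

Lemma weighted_cnt z (u : R -> E) t : (forall t, rcnt u t) -> rcnt (fun t => exp_weight z t *; u t) t.
Proof. by move=> hu; apply: cnt_scal => //; exact: rcnt_exp_weight. Qed.

Lemma laplace_exists z : omega < Re z ->
  exists F, improper (V := VR E) (fun t => exp_weight z t *; c t) F /\
    norm F <= M / (Re z - omega).
Proof.
move=> hz.
apply: (improper_dominated (V := @VR E cE)); first lra.
  by move=> T hT; apply: rcnt_ex_RInt => t _; exact: weighted_cnt.
move=> t ht; apply: Rle_trans (norm_cscal _ (c t : E)) _.
rewrite Cmod_exp_weight.
have -> : M * exp (- (Re z - omega) * t) = exp (- (Re z * t)) * (M * exp (omega * t)).
  have -> : exp (- (Re z - omega) * t) = exp (- (Re z * t)) * exp (omega * t).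
    by rewrite -exp_plus; congr exp; ring.
  ring.
by apply: Rmult_le_compat_l; [exact: Rlt_le (exp_pos _)|exact: c_le].
Qed.

Lemma orbit_bound_ge0 : 0 <= M.
Proof.
have := Rle_trans _ _ _ (norm_ge_0 _) (c_le 0 (Rle_refl 0)).
by rewrite Rmult_0_r exp_0 Rmult_1_r.
Qed.

Lemma integral_bounds T : 0 <= T ->
  norm (integral1 T) <= T * (M * exp (omega * T)) /\
  norm (integral2 T) <= 2 * T ^ 2 * (M * exp (omega * T)).
Proof.
move=> hT; have hM := orbit_bound_ge0.
have b t : 0 <= t <= T -> norm (c t) <= M * exp (omega * T).
  move=> Ht; apply: Rle_trans (c_le t (proj1 Ht)) _.
  by apply: Rmult_le_compat_l => //; apply: exp_le_compat; nra.
have B1 := @norm_RInt_growth E cE c _ T hT c_cnt b.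
have B2 : norm (RInt (V := @VR E cE) (fun s => RtoC s *; c s) 0 T : E) <= T * (T * (M * exp (omega * T))).
  apply: norm_RInt_growth => // [t|t Ht]; first exact: mul_time_cnt.
  apply: Rle_trans (norm_cscal _ _) _; rewrite Cmod_R Rabs_pos_eq; last lra.
  by apply: Rmult_le_compat; [lra|exact: norm_ge_0|lra|exact: b].
split; first exact: B1.
apply: Rle_trans (norm_minus_le _ _) _.
have := norm_cscal (RtoC T) (integral1 T); rewrite Cmod_R Rabs_pos_eq // => q.
have q2 : T * norm (integral1 T) <= T * (T * (M * exp (omega * T))) by exact: (Rmult_le_compat_l _ _ _ hT B1).
apply: Rle_trans (Rplus_le_compat _ _ _ _ (Rle_trans _ _ _ q q2) B2) _.
by apply: Req_le; ring.
Qed.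

(* [(e^{-zt} (v' + z v))' = e^{-zt} (v'' - z^2 v)] for [v'' = c]. *)
Lemma laplace_second_primitive z F : omega + 1 <= Re z ->
  improper (V := VR E) (fun t => exp_weight z t *; c t) F ->
  improper (V := VR E) (fun t => exp_weight z t *; integral2 t) (Cinv (Cmult z z) *; F).
Proof.
move=> hz HF.
have z0 : z <> RtoC 0 by move=> h; rewrite h /= in hz; lra.
pose G t := exp_weight z t *; plus (integral1 t) (z *; integral2 t).
pose G' t := exp_weight z t *; minus (c t) (Cmult z z *; integral2 t).
have D t : rder G t (G' t).
  have D1 := @rder_primitive E cE c t c_cnt. have D2 := rder_integral2 t.
  have D3 := der_plus _ _ _ _ _ _ _ D1
    (der_scal _ _ RtoC_abs _ _ _ _ _ (der_const _ RtoC (z : CC) t) D2).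
  apply: der_eq (der_scal _ _ RtoC_abs _ _ _ _ _ (rder_exp_weight z t) D3) _.
  by rewrite /G' -/(integral1 t); module_eq E; rewrite /zero /=; ring.
have c2 t : rcnt integral2 t by exact: (der_cnt _ RtoC RtoC_abs _ _ _ (rder_integral2 t)).
have cG' t : rcnt G' t.
  apply: weighted_cnt => {}t.
  apply: (cnt_ext (fun t => plus (c t) (Copp (Cmult z z) *; integral2 t))).
    by move=> s; module_eq E.
  by apply: cnt_plus => //; apply: cnt_scal => //; exact: cnt_const.
have G0 : G 0 = zero.
  have i1 : integral1 0 = zero by rewrite /integral1 (RInt_point (V := @VR E cE)).
  rewrite /G /integral2 i1 (RInt_point (V := @VR E cE)); module_eq E.
have H0 : improper (V := @VR E cE) G' (zero : E).
  apply: (improper_limit (V := @VR E cE) _ G).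
    move=> T hT.
    have := rder_RInt G G' 0 T (fun t _ => D t) (fun t _ => cG' t).
    by rewrite G0; have -> : minus (G T) zero = G T by module_eq E.
  move=> e He.
  have hM := orbit_bound_ge0.
  (* [omega + 1 <= Re z] leaves [exp (- T)] after the growth of [c], enough for the quadratic factor
     in the bound on [G]. *)
  have [K [hK HK]] := poly_exp_decay (Cmod z) (Cmod_ge_0 z).
  have [T0 [h0 hT]] := exp_decay_small (/ 2) ltac:(lra) (K * M) e He.
  exists T0 => T HT.
  have hT0 : 0 <= T by lra.
  apply: Rle_trans (hT T HT).
  have -> : minus (G T) (zero : E) = G T :> E by module_eq E.
  apply: Rle_trans (norm_cscal _ _) _.
  rewrite Cmod_exp_weight.
  have [b1 b2] := integral_bounds T hT0.
  have b3 : norm (plus (integral1 T) (z *; integral2 T)) <=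
     (T + Cmod z * (2 * T ^ 2)) * (M * exp (omega * T)).
    apply: Rle_trans (norm_triangle _ _) _.
    have := norm_cscal z (integral2 T).
    have := Rmult_le_compat_l _ _ _ (Cmod_ge_0 z) b2; lra.
  have P0 : 0 <= T + Cmod z * (2 * T ^ 2).
    have := Rmult_le_pos _ _ (Cmod_ge_0 z) (Rmult_le_pos 2 _ ltac:(lra) (pow2_ge_0 T)); lra.
  apply: (Rle_trans _ (exp (- T) * (T + Cmod z * (2 * T ^ 2)) * M)).
    apply: Rle_trans (Rmult_le_compat_l _ _ _ (Rlt_le _ _ (exp_pos _)) b3) _.
    have -> : exp (- (Re z * T)) * ((T + Cmod z * (2 * T ^ 2)) * (M * exp (omega * T))) =
      exp (- (Re z * T) + omega * T) * ((T + Cmod z * (2 * T ^ 2)) * M) by rewrite exp_plus; ring.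
    rewrite Rmult_assoc; apply: Rmult_le_compat_r; first exact: Rmult_le_pos.
    by apply: exp_le_compat; nra.
  have := Rmult_le_compat_r _ _ _ hM (HK T hT0); lra.
have H1 := improper_plus _ _ _ _ (improper_linear _ _ _ (is_linear_cscal (Cinv (Cmult z z))) HF)
  (improper_linear _ _ _ (is_linear_cscal (Copp (Cinv (Cmult z z)))) H0).
have -> : Cinv (Cmult z z) *; F = plus (Cinv (Cmult z z) *; F) (Copp (Cinv (Cmult z z)) *; (zero : E)).
  by module_eq E.
apply: improper_ext H1 => t _; rewrite /G'.
change (plus (Cinv (Cmult z z) *; (exp_weight z t *; c t))
  (Copp (Cinv (Cmult z z)) *; (exp_weight z t *; minus (c t) (Cmult z z *; integral2 t))) =
  exp_weight z t *; integral2 t).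
by module_eq E; field.
Qed.

End VectorLaplace.

(** * The resolvent from the transform of the cosine function *)

Section CosineResolvent.
Context {E : NormedModule C_AbsRing} {cE : complete_space E}.
Variables (A : linop E) (CK : R -> E -> E) (M omega : R).
Variables (TH : R -> C) (KL : C -> C) (omega1 c0 k D : R).
Hypothesis A_closed : closed_linop A.
Hypothesis CK_linear : forall t, 0 <= t -> is_linear (CK t).
Hypothesis CK_cont : forall (x : E) (t : R), 0 <= t ->
    filterlim (fun s => CK s x) (within (fun s => 0 <= s) (locally t))
      (locally (CK t x)).
Hypothesis CK_comm : forall t x, 0 <= t -> dom A x ->
     dom A (CK t x) /\ app A (CK t x) = CK t (app A x).
Hypothesis CK_integral : forall t x, 0 <= t ->
     exists y : E,
       is_RInt (V := realify E)
         (fun s => scal (RtoC (t - s) : C_AbsRing) (CK s x)) 0 t y /\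
       dom A y /\
       app A y = minus (CK t x) (scal (TH t : C_AbsRing) x).
Hypothesis M_pos : 0 < M.
Hypothesis omega_ge0 : 0 <= omega.
Hypothesis CK_le : forall t x, 0 <= t -> norm (CK t x) <= M * exp (omega * t) * norm x.
Hypothesis TH_laplace : forall z, omega1 < Re z ->
  improper (V := VR CC) (fun t => Cmult (exp_weight z t) (TH t)) (Cmult (KL z) (Cinv z)).
Hypothesis KL_neq0 : forall z, c0 <= Re z -> KL z <> RtoC 0.
Hypothesis k_ge0 : 0 <= k.
Hypothesis D_ge0 : 0 <= D.
Hypothesis KL_inv : forall z, c0 <= Re z -> / Cmod (KL z) <= D * exp (k * Cmod z).

(* Extended by a constant to negative times, so as to be continuous on [R]. *)
Definition cosine_orbit (x : E) (t : R) : E := CK (Rmax 0 t) x.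

Lemma orbit_eq x t : 0 <= t -> cosine_orbit x t = CK t x.
Proof. by move=> ht; rewrite /cosine_orbit Rmax_right. Qed.

Lemma orbit_cnt x t : rcnt (cosine_orbit x) t.
Proof.
apply: continuous_rcnt; apply/filterlim_locally => eps.
have [d Hd] := CK_cont x (Rmax 0 t) (Rmax_l _ _) _ (locally_ball _ eps).
exists d => s Hs; apply: (Hd (Rmax 0 s)); last exact: Rmax_l.
exact: Rle_lt_trans (Rmax0_lipschitz s t) Hs.
Qed.

Lemma orbit_le x t : 0 <= t -> norm (cosine_orbit x t) <= M * norm x * exp (omega * t).
Proof. by move=> ht; rewrite orbit_eq //; have := CK_le t x ht; lra. Qed.

Definition cosine_laplace (z : C) (x : E) : E :=
  epsilon (inhabits zero) (improper (V := VR E) (fun t => exp_weight z t *; cosine_orbit x t)).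

Lemma cosine_laplace_spec z x : omega < Re z ->
  improper (V := VR E) (fun t => exp_weight z t *; cosine_orbit x t) (cosine_laplace z x) /\
  norm (cosine_laplace z x) <= M * norm x / (Re z - omega).
Proof.
move=> hz.
have [F [HF n]] := laplace_exists _ _ _ (orbit_cnt x) (orbit_le x) z hz.
have S : improper (V := @VR E cE) (fun t => exp_weight z t *; cosine_orbit x t) (cosine_laplace z x).
  by apply: epsilon_spec; exists F.
by split=> //; rewrite (improper_unique _ _ _ S HF).
Qed.

Lemma cosine_laplace_eq z x F : omega < Re z ->
  improper (V := VR E) (fun t => exp_weight z t *; cosine_orbit x t) F -> cosine_laplace z x = F.
Proof. by move=> hz H; apply: improper_unique (proj1 (cosine_laplace_spec z x hz)) H. Qed.

(** Transform the integral identity of the generator: with [F] the transform of the orbit, the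
    double integral becomes [F / z^2] and [Theta x] becomes [(K~ / z) x]. Closedness lets [A] pass
    under the integral, and multiplication by [z^2] finishes. *)
Lemma cosine_laplace_graph z x : omega + 1 <= Re z -> omega1 < Re z ->
  graph A (cosine_laplace z x)
    (minus (Cmult z z *; cosine_laplace z x) (Cmult z (KL z) *; x)).
Proof.
move=> hz hz1.
have z0 : z <> RtoC 0 by move=> h; rewrite h /= in hz; lra.
have [HF _] := cosine_laplace_spec z x ltac:(lra).
set F := cosine_laplace z x in HF *.
have H2 := @laplace_second_primitive E cE _ _ _ (orbit_cnt x) omega_ge0 (orbit_le x) z F hz HF.
have HT := improper_linear _ _ _ (@is_linear_cscal_vector E cE x) (TH_laplace z hz1).
have H3 := improper_plus _ _ _ _ HF (improper_linear _ _ _ (@is_linear_cscal E cE (RtoC (-1))) HT).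
have g : graph A (Cinv (Cmult z z) *; F) (plus F (RtoC (-1) *; (Cmult (KL z) (Cinv z) *; x))).
  apply: (graph_improper A A_closed _ _ _ _ _ H2 H3) => t ht.
  have [y [Iy [dy ey]]] := CK_integral t x ht.
  have eq2 : y = integral2 (cosine_orbit x) t.
    have I2 := @is_RInt_integral2 E cE (cosine_orbit x) (orbit_cnt x) t.
    apply: (is_RInt_value_unique (V := realify E) _ _ _ _ _ Iy).
    apply: is_RInt_ext I2 => s; rewrite Rmin_left // Rmax_right // => Hs.
    by rewrite orbit_eq //; lra.
  rewrite -eq2.
  have -> : plus (exp_weight z t *; cosine_orbit x t)
     (RtoC (-1) *; (Cmult (exp_weight z t) (TH t) *; x)) =
     exp_weight z t *; minus (CK t x) (TH t *; x).
    by rewrite orbit_eq //; module_eq E.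
  by apply: graph_scal; split.
have := graph_scal A (Cmult z z) _ _ g.
have -> : Cmult z z *; (Cinv (Cmult z z) *; F) = F by module_eq E; field.
have -> : Cmult z z *; plus F (RtoC (-1) *; (Cmult (KL z) (Cinv z) *; x)) =
   minus (Cmult z z *; F) (Cmult z (KL z) *; x) by module_eq E; field.
by [].
Qed.

Lemma cosine_laplace_comm z x : omega < Re z -> dom A x ->
  graph A (cosine_laplace z x) (cosine_laplace z (app A x)).
Proof.
move=> hz dx.
have [H1 _] := cosine_laplace_spec z x hz. have [H2 _] := cosine_laplace_spec z (app A x) hz.
apply: (graph_improper A A_closed _ _ _ _ _ H1 H2) => t ht.
by apply: graph_scal; rewrite !orbit_eq //; exact: CK_comm.
Qed.

Theorem cosine_square_resolvent : exists C0 N (Rs : C -> E -> E), square_resolvent A C0 N k Rs.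
Proof.
(* Right of [omega + 1] both [1 / (Re z - omega)] and [1 / |z|] are at most [1], so the constant of
   the resolvent bound is just [D M]. *)
pose C0 := Rmax (omega + 1) (Rmax omega1 c0).
have m1 : omega + 1 <= C0 := Rmax_l _ _.
have m2 : Rmax omega1 c0 <= C0 := Rmax_r _ _.
have m3 : omega1 <= C0 := Rle_trans _ _ _ (Rmax_l _ _) m2.
have m4 : c0 <= C0 := Rle_trans _ _ _ (Rmax_r _ _) m2.
pose w z := Cinv (Cmult z (KL z)).
have nz z : C0 < Re z -> Cmult z (KL z) <> RtoC 0.
  move=> hz; apply: Cmult_neq_0; last by apply: KL_neq0; lra.
  by move=> h; rewrite h /= in hz; lra.
have wle z : C0 < Re z -> Cmod (w z) <= D * exp (k * Cmod z).
  move=> hz; rewrite /w Cmod_inv; last exact: nz.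
  have hz1 : 1 <= Cmod z by have := Re_le_Cmod z; lra.
  have hK : 0 < Cmod (KL z) by apply/Cmod_gt_0; apply: KL_neq0; lra.
  rewrite Cmod_mult Rinv_mult.
  have h1 := KL_inv z ltac:(lra).
  have h2 : / Cmod z <= 1 by rewrite -Rinv_1; apply: Rinv_le_contravar; lra.
  have h3 : 0 < / Cmod (KL z) by apply: Rinv_0_lt_compat.
  have h4 : 0 < / Cmod z by apply: Rinv_0_lt_compat; lra.
  nra.
exists C0, (D * M), (fun z x => w z *; cosine_laplace z x).
split.
- by apply: Rmult_le_pos; lra.
- exact: k_ge0.
- move=> z x y hz.
  rewrite (cosine_laplace_eq z (plus x y) (plus (cosine_laplace z x) (cosine_laplace z y))).
  + by module_eq E.
  + lra.
  have [H1 _] := cosine_laplace_spec z x ltac:(lra). have [H2 _] := cosine_laplace_spec z y ltac:(lra).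
  apply: improper_ext (improper_plus _ _ _ _ H1 H2) => t ht.
  rewrite !orbit_eq //.
  by rewrite (linear_plus _ (CK_linear t ht)); module_eq E.
- move=> z a x hz.
  rewrite (cosine_laplace_eq z (a *; x) (a *; cosine_laplace z x)).
  + by module_eq E.
  + lra.
  have [H1 _] := cosine_laplace_spec z x ltac:(lra).
  apply: improper_ext (improper_linear _ _ _ (is_linear_cscal a) H1) => t ht.
  rewrite !orbit_eq //.
  by rewrite (linear_scal _ (CK_linear t ht)); module_eq E.
- move=> z x hz.
  have [_ n] := cosine_laplace_spec z x ltac:(lra).
  have nx := norm_ge_0 x.
  have n2 : norm (cosine_laplace z x) <= M * norm x.
    apply: Rle_trans n _; rewrite -[X in _ <= X]Rmult_1_r.
    apply: Rmult_le_compat_l; first by apply: Rmult_le_pos; lra.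
    by rewrite -Rinv_1; apply: Rinv_le_contravar; lra.
  apply: Rle_trans (norm_cscal _ _) _.
  have -> : D * M * exp (k * Cmod z) * norm x = D * exp (k * Cmod z) * (M * norm x) by ring.
  by apply: Rmult_le_compat => //; [exact: Cmod_ge_0|exact: norm_ge_0|exact: wle].
- move=> z x hz; have [d _] := cosine_laplace_graph z x ltac:(lra) ltac:(lra).
  exact: dom_scal.
- move=> z x hz; have [d e] := cosine_laplace_graph z x ltac:(lra) ltac:(lra).
  rewrite app_scal // e /w; have := nz z hz => h.
  have h1 : z <> RtoC 0 by move=> q; apply: h; rewrite q; ring.
  have h2 : KL z <> RtoC 0 by move=> q; apply: h; rewrite q; ring.
  by module_eq E; field.
- move=> z x hz dx.
  have [d e] := cosine_laplace_graph z x ltac:(lra) ltac:(lra).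
  have [_ <-] := cosine_laplace_comm z x ltac:(lra) dx.
  rewrite e /w; have := nz z hz => h.
  have h1 : z <> RtoC 0 by move=> q; apply: h; rewrite q; ring.
  have h2 : KL z <> RtoC 0 by move=> q; apply: h; rewrite q; ring.
  by module_eq E; field.
Qed.

End CosineResolvent.

(** * The transform of the kernel and of its primitive *)

Import LebesguePrimitive.

Lemma continuous_continuity (g : R -> R) : (forall t, continuous g t) -> continuity g.
Proof. by move=> H t; apply/continuity_pt_filterlim; exact: H. Qed.

Lemma prim_dominated f a b : locally_integrable f -> 0 <= a -> a <= b ->
  Rabs (prim f b - prim f a) <= prim (fun t => Rabs (f t)) b - prim (fun t => Rabs (f t)) a.
Proof.
move=> hf ha hab.
have := prim_increment_le f (fun _ => 1) 1 a b hf _ ha hab _.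
have -> : (fun t => 1 * f t) = f by apply: functional_extensionality => t; rewrite Rmult_1_l.
rewrite Rmult_1_l; apply.
  by apply: continuous_continuity => t; exact: continuous_const.
by move=> t _ _; rewrite Rabs_R1; lra.
Qed.

Section PrimitiveByParts.
Variables (f g g' : R -> R).
Hypothesis hf : locally_integrable f.
Hypothesis g_derive : forall t, is_derive g t (g' t).
Hypothesis g'_cont : forall t, continuous g' t.

Lemma prim_continuous t : continuous (fun s => prim f (Rmax 0 s)) t.
Proof.
apply: (primitive_continuous (prim f) (prim (fun t => Rabs (f t)))).
  by move=> a b ha hab; exact: prim_dominated.
by move=> T e hT he; exact: prim_abs_continuous.
Qed.

Lemma prim_by_parts T : 0 <= T ->
  prim (fun t => g t * f t) T =
  g T * prim f T - RInt (fun t => g' t * prim f (Rmax 0 t)) 0 T.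
Proof.
have gc : continuity g.
  by apply: continuous_continuity => t; apply: ex_derive_continuous; eexists; exact: g_derive.
apply: (integral_by_parts (prim f) (prim (fun t => g t * f t)) (prim (fun t => Rabs (f t))) g g').
- exact: prim_0.
- exact: prim_0.
- by move=> a b ha hab; exact: prim_dominated.
- move=> c M a b ha hab hM.
  have hc : continuity (fun t => g t - c).
    apply: continuous_continuity => t; apply: (continuous_minus (V := R_NormedModule)).
      by apply: ex_derive_continuous; eexists; exact: g_derive.
    exact: continuous_const.
  have e x : 0 <= x -> prim (fun t => g t * f t) x - c * prim f x = prim (fun t => (g t - c) * f t) x.
    move=> hx.
    have hcf : locally_integrable (fun t => c * f t).
      apply: (locally_integrable_mul f (fun _ => c)) => //.
      by apply: continuous_continuity => t; exact: continuous_const.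
    rewrite -(prim_scal c f) // -(prim_minus (fun t => g t * f t) (fun t => c * f t)) //.
      by congr prim; apply: functional_extensionality => t; ring.
    exact: locally_integrable_mul.
  rewrite !e //; last lra.
  exact: prim_increment_le.
- by move=> T' e' hT he; exact: prim_abs_continuous.
- exact: g_derive.
- exact: g'_cont.
Qed.
End PrimitiveByParts.

Lemma exp_weight_derive z t :
  is_derive (fun s => fst (exp_weight z s)) t (fst (Cmult (Copp z) (exp_weight z t))) /\
  is_derive (fun s => snd (exp_weight z s)) t (snd (Cmult (Copp z) (exp_weight z t))).
Proof.
case: z => x y; rewrite /exp_weight /Cexp /Cmult /Copp /Re /Im /=; split.
  by auto_derive => //; rewrite /Rminus; ring.
by auto_derive => //; rewrite /Rminus; ring.
Qed.

Lemma exp_weight_derive_continuous z t :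
  continuous (fun s => fst (Cmult (Copp z) (exp_weight z s))) t /\
  continuous (fun s => snd (Cmult (Copp z) (exp_weight z s))) t.
Proof.
case: z => x y; rewrite /exp_weight /Cexp /Cmult /Copp /Re /Im /=; split.
  by apply: (ex_derive_continuous (fun s => _ : R)); auto_derive.
by apply: (ex_derive_continuous (fun s => _ : R)); auto_derive.
Qed.

Lemma exp_weight_continuous z t :
  continuous (fun s => fst (exp_weight z s)) t /\ continuous (fun s => snd (exp_weight z s)) t.
Proof.
by have [h1 h2] := exp_weight_derive z t; split; apply: ex_derive_continuous; eexists; eassumption.
Qed.

Lemma L1loc_exp_weight z K : L1loc K -> L1loc (fun t => Cmult (exp_weight z t) (K t)).
Proof.
move=> /L1loc_parts [h1 h2].
have c1 : continuity (fun s => fst (exp_weight z s)).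
  by apply: continuous_continuity => t; have [] := exp_weight_continuous z t.
have c2 : continuity (fun s => snd (exp_weight z s)).
  by apply: continuous_continuity => t; have [] := exp_weight_continuous z t.
move=> T hT; split.
  exact: (locally_integrable_minus _ _ (locally_integrable_mul _ _ h1 c1)
    (locally_integrable_mul _ _ h2 c2) T hT).
exact: (locally_integrable_plus _ _ (locally_integrable_mul _ _ h2 c1)
    (locally_integrable_mul _ _ h1 c2) T hT).
Qed.

(** Four real integrations by parts, one for each product of real and imaginary parts, recombined
    because [exp (- z t)] has derivative [- z exp (- z t)]. Here the Lebesgue integral of [K] is
    traded for the Riemann integral of its continuous primitive. *)
Lemma CLint_by_parts z K T : L1loc K -> 0 <= T -> exists I : C,
  is_RInt (V := VR CC) (fun t => Cmult (exp_weight z t) (CLint K t)) 0 T I /\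
  CLint (fun t => Cmult (exp_weight z t) (K t)) T =
    Cplus (Cmult (exp_weight z T) (CLint K T)) (Cmult z I).
Proof.
move=> /L1loc_parts [h1 h2] hT.
pose e1 t := fst (exp_weight z t). pose e2 t := snd (exp_weight z t).
pose d1 t := fst (Cmult (Copp z) (exp_weight z t)). pose d2 t := snd (Cmult (Copp z) (exp_weight z t)).
pose p1 t := prim (fun t => fst (K t)) (Rmax 0 t). pose p2 t := prim (fun t => snd (K t)) (Rmax 0 t).
have D1 t : is_derive e1 t (d1 t) by have [] := exp_weight_derive z t.
have D2 t : is_derive e2 t (d2 t) by have [] := exp_weight_derive z t.
have cd1 t : continuous d1 t by have [] := exp_weight_derive_continuous z t.
have cd2 t : continuous d2 t by have [] := exp_weight_derive_continuous z t.
have ce1 t : continuous e1 t by have [] := exp_weight_continuous z t.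
have ce2 t : continuous e2 t by have [] := exp_weight_continuous z t.
have cp1 t : continuous p1 t by exact: prim_continuous.
have cp2 t : continuous p2 t by exact: prim_continuous.
have ei (u v : R -> R) : (forall t, continuous u t) -> (forall t, continuous v t) ->
    is_RInt (fun t => u t * v t) 0 T (RInt (fun t => u t * v t) 0 T).
  move=> hu hv; apply: RInt_correct; apply: (ex_RInt_continuous (V := R_CompleteNormedModule)) => t _.
  exact: (continuous_mult u v).
have i11 := ei e1 p1 ce1 cp1. have i22 := ei e2 p2 ce2 cp2.
have i12 := ei e1 p2 ce1 cp2. have i21 := ei e2 p1 ce2 cp1.
set a11 := RInt _ 0 T in i11. set a22 := RInt _ 0 T in i22.
set a12 := RInt _ 0 T in i12. set a21 := RInt _ 0 T in i21.
exists (a11 - a22, a12 + a21); split.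
  apply: (is_RInt_ext (V := VR CC) (fun t => (e1 t * p1 t - e2 t * p2 t, e1 t * p2 t + e2 t * p1 t))).
    move=> t; rewrite Rmin_left // Rmax_right // => Ht.
    by rewrite CLintE /p1 /p2 Rmax_right; last lra.
  apply: is_RInt_C_pair; first exact: (is_RInt_minus _ _ _ _ _ _ i11 i22).
  exact: (is_RInt_plus _ _ _ _ _ _ i12 i21).
have c1 : continuity e1 by exact: continuous_continuity.
have c2 : continuity e2 by exact: continuous_continuity.
have B11 := prim_by_parts _ e1 d1 h1 D1 cd1 T hT. have B12 := prim_by_parts _ e1 d1 h2 D1 cd1 T hT.
have B21 := prim_by_parts _ e2 d2 h1 D2 cd2 T hT. have B22 := prim_by_parts _ e2 d2 h2 D2 cd2 T hT.
have ed1 t : d1 t = - (fst z * e1 t - snd z * e2 t) by rewrite /d1 /e1 /e2 /=; ring.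
have ed2 t : d2 t = - (fst z * e2 t + snd z * e1 t) by rewrite /d2 /e1 /e2 /=; ring.
have R1 (p : R -> R) u v : is_RInt (fun t => e1 t * p t) 0 T u -> is_RInt (fun t => e2 t * p t) 0 T v ->
   RInt (fun t => d1 t * p t) 0 T = - (fst z * u - snd z * v) /\
   RInt (fun t => d2 t * p t) 0 T = - (fst z * v + snd z * u).
  move=> Iu Iv; split; apply: is_RInt_unique.
    have := is_RInt_opp _ _ _ _ (is_RInt_minus _ _ _ _ _ _ (is_RInt_scal _ _ _ (fst z) _ Iu) (is_RInt_scal _ _ _ (snd z) _ Iv)).
    apply: is_RInt_ext => t _; rewrite ed1 /opp /minus /plus /opp /scal /= /mult /=; ring.
  have := is_RInt_opp _ _ _ _ (is_RInt_plus _ _ _ _ _ _ (is_RInt_scal _ _ _ (fst z) _ Iv) (is_RInt_scal _ _ _ (snd z) _ Iu)).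
  apply: is_RInt_ext => t _; rewrite ed2 /opp /plus /scal /= /mult /=; ring.
have [r11 r21] := R1 p1 _ _ i11 i21. have [r12 r22] := R1 p2 _ _ i12 i22.
rewrite -/p1 in B11, B21. rewrite -/p2 in B12, B22.
have q11 : prim (fun t => e1 t * fst (K t)) T = e1 T * prim (fun t => fst (K t)) T + (fst z * a11 - snd z * a21).
  by rewrite B11 (_ : RInt _ 0 T = - (fst z * a11 - snd z * a21)) //; ring.
have q21 : prim (fun t => e2 t * fst (K t)) T = e2 T * prim (fun t => fst (K t)) T + (fst z * a21 + snd z * a11).
  by rewrite B21 (_ : RInt _ 0 T = - (fst z * a21 + snd z * a11)) //; ring.
have q12 : prim (fun t => e1 t * snd (K t)) T = e1 T * prim (fun t => snd (K t)) T + (fst z * a12 - snd z * a22).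
  by rewrite B12 (_ : RInt _ 0 T = - (fst z * a12 - snd z * a22)) //; ring.
have q22 : prim (fun t => e2 t * snd (K t)) T = e2 T * prim (fun t => snd (K t)) T + (fst z * a22 + snd z * a12).
  by rewrite B22 (_ : RInt _ 0 T = - (fst z * a22 + snd z * a12)) //; ring.
rewrite !CLintE; apply: injective_projections.
  change (prim (fun t => e1 t * fst (K t) - e2 t * snd (K t)) T =
    e1 T * prim (fun t => fst (K t)) T - e2 T * prim (fun t => snd (K t)) T +
    (fst z * (a11 - a22) - snd z * (a12 + a21))).
  rewrite (prim_minus (fun t => e1 t * fst (K t)) (fun t => e2 t * snd (K t))) //;
    try exact: locally_integrable_mul.
  by rewrite q11 q22; ring.
change (prim (fun t => e1 t * snd (K t) + e2 t * fst (K t)) T =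
  e1 T * prim (fun t => snd (K t)) T + e2 T * prim (fun t => fst (K t)) T +
  (fst z * (a12 + a21) + snd z * (a11 - a22))).
rewrite (prim_plus (fun t => e1 t * snd (K t)) (fun t => e2 t * fst (K t))) //;
  try exact: locally_integrable_mul.
by rewrite q12 q21; ring.
Qed.

Lemma prim_bounded f T0 : locally_integrable f -> exists B, forall T, 0 <= T <= T0 -> Rabs (prim f T) <= B.
Proof.
move=> hf; pose Phi := prim (fun t => Rabs (f t)).
exists (Phi T0 - Phi 0) => T HT.
have h1 := prim_dominated f 0 T hf (Rle_refl 0) (proj1 HT).
have h2 := prim_dominated f T T0 hf (proj1 HT) (proj2 HT).
rewrite prim_0 Rminus_0_r in h1; have := Rabs_pos (prim f T0 - prim f T); rewrite -/Phi in h1 h2; lra.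
Qed.

Lemma is_laplace_eps K z l e : is_laplace K z l -> 0 < e -> exists T0, forall T, T0 <= T ->
  Cmod (Cminus (CLint (fun t => Cmult (exp_weight z t) (K t)) T) l) <= e.
Proof.
move=> H He.
have hn := @norm_factor_gt_0 _ CC.
pose e' := mkposreal _ (Rdiv_lt_0_compat _ _ He hn).
have [T0 h] := H _ (locally_ball (l : CC) e').
exists (T0 + 1) => T HT.
apply: Rlt_le; apply: Rlt_le_trans (norm_compat2 (V := CC) _ _ e' (h T _)) _; first lra.
by apply: Req_le; rewrite /=; field; exact: Rgt_not_eq.
Qed.

(** At a real point [w] of convergence the primitive of [f = exp (- w t) K] is bounded; writing
    [K = exp (w t) f] and integrating by parts bounds the primitive of [K]. *)
Lemma CLint_growth K : laplace_transformable K -> exists B w, 0 <= B /\ 0 <= w /\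
  forall T, 0 <= T -> Cmod (CLint K T) <= B * exp (w * T).
Proof.
move=> [hK [om Hom]].
pose w := Rmax om 0 + 1.
have w1 : om < w by rewrite /w; have := Rmax_l om 0; lra.
have w0 : 0 < w by rewrite /w; have := Rmax_r om 0; lra.
have [l Hl] := Hom (RtoC w) w1.
pose f t := Cmult (exp_weight (RtoC w) t) (K t).
have hf : L1loc f by exact: L1loc_exp_weight.
have [B [B0 HB]] : exists B, 0 <= B /\ forall T, 0 <= T -> Cmod (CLint f T) <= B.
  have [T0 h0] := is_laplace_eps K _ l 1 Hl Rlt_0_1.
  have [f1 f2] := L1loc_parts _ hf.
  have [B1 h1] := prim_bounded _ T0 f1. have [B2 h2] := prim_bounded _ T0 f2.
  exists (Rmax (Cmod l + 1) (B1 + B2)).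
  split; first by apply: Rle_trans (Rmax_l _ _); have := Cmod_ge_0 l; lra.
  move=> T hT; case: (Rle_dec T T0) => h.
    apply: Rle_trans (Rmax_r _ _); apply: Rle_trans (Cmod_le_abs _) _.
    by apply: Rplus_le_compat; [apply: h1|apply: h2].
  apply: Rle_trans (Rmax_l _ _).
  have := h0 T ltac:(lra); rewrite -/f.
  have := norm_le_minus (CLint f T : CC) l.
  change (Cmod (CLint f T) <= Cmod l + Cmod (Cminus (CLint f T) l) ->
    Cmod (Cminus (CLint f T) l) <= 1 -> Cmod (CLint f T) <= Cmod l + 1); lra.
(* One [w] is the weight, the other absorbs the factor [1 + w T] produced by the integration by
   parts. *)
exists B, (2 * w); split=> //; split; first lra.
move=> T hT.
have [I [HI e]] := CLint_by_parts (RtoC (- w)) f T hf hT.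
have eK : (fun t => Cmult (exp_weight (RtoC (- w)) t) (f t)) = K.
  apply: functional_extensionality => t; rewrite /f Cmult_assoc /exp_weight -Cexp_plus.
  rewrite (_ : Cplus _ _ = RtoC 0) ?Cexp_0 ?Cmult_1_l //.
  by rewrite RtoC_opp; ring.
rewrite eK in e; rewrite e.
have mw t : Cmod (exp_weight (RtoC (- w)) t) = exp (w * t).
  by rewrite Cmod_exp_weight; congr exp; rewrite /Re /=; ring.
have bI : Cmod I <= T * (exp (w * T) * B).
  have := norm_RInt_le_const (V := VR CC) _ 0 T _ (exp (w * T) * B) hT _ HI.
  rewrite Rminus_0_r; apply => t Ht.
  change (Cmod (Cmult (exp_weight (RtoC (- w)) t) (CLint f t)) <= exp (w * T) * B).
  rewrite Cmod_mult mw; apply: Rmult_le_compat; [exact: Rlt_le (exp_pos _)|exact: Cmod_ge_0| |apply: HB; lra].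
  by apply: exp_le_compat; nra.
apply: Rle_trans (Cmod_triangle _ _) _.
rewrite !Cmod_mult mw Cmod_R Rabs_Ropp (Rabs_pos_eq w); last lra.
have p := exp_pos (w * T).
have q1 : exp (w * T) * Cmod (CLint f T) <= exp (w * T) * B.
  by apply: Rmult_le_compat_l; [lra|exact: HB].
have q2 : w * Cmod I <= w * (T * (exp (w * T) * B)) by apply: Rmult_le_compat_l; lra.
have q3 := one_plus_le_exp (w * T) ltac:(nra).
have -> : 2 * w * T = w * T + w * T by ring.
rewrite exp_plus.
have : (1 + w * T) * (exp (w * T) * B) <= exp (w * T) * (exp (w * T) * B).
  by apply: Rmult_le_compat_r => //; nra.
lra.
Qed.

(** In the integration by parts the boundary term [exp (- z T) Theta T] dies out once [Re z] exceeds
    the growth rate of [Theta] by [1]; dividing by [z] gives the transform of [Theta]. *)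
Lemma laplace_primitive K : laplace_transformable K -> exists w, forall z l,
  w < Re z -> is_laplace K z l ->
  improper (V := VR CC) (fun t => Cmult (exp_weight z t) (CLint K t)) (Cmult l (Cinv z)).
Proof.
move=> HK; have [B [w [B0 [w0 HB]]]] := CLint_growth K HK.
exists (w + 1) => z l hz Hl e He.
have hz1 : 1 <= Cmod z by have := Re_le_Cmod z; lra.
have z0 : z <> RtoC 0 by move=> h; rewrite h Cmod_0 in hz1; lra.
have [T1 h1] := is_laplace_eps K z l (e/2) Hl ltac:(lra).
have [T2 [h2 h3]] := exp_decay_small 1 Rlt_0_1 B (e/2) ltac:(lra).
exists (Rmax T1 T2) => T HT.
have m1 := Rmax_l T1 T2. have m2 := Rmax_r T1 T2.
have hT : 0 <= T by lra.
have [I [HI eI]] := CLint_by_parts z K T (proj1 HK) hT.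
exists I; split=> //.
change (Cmod (Cminus I (Cmult l (Cinv z))) <= e).
set X := CLint _ T in eI.
have -> : Cminus I (Cmult l (Cinv z)) =
  Cmult (Cinv z) (Cminus (Cminus X l) (Cmult (exp_weight z T) (CLint K T))).
  by rewrite eI; field.
rewrite Cmod_mult Cmod_inv //.
have i1 : / Cmod z <= 1 by rewrite -Rinv_1; apply: Rinv_le_contravar; lra.
have i0 : 0 < / Cmod z by apply: Rinv_0_lt_compat; lra.
have bX : Cmod (Cminus X l) <= e/2 by apply: h1; lra.
have bE : Cmod (Cmult (exp_weight z T) (CLint K T)) <= e/2.
  apply: Rle_trans (h3 T ltac:(lra)).
  rewrite Cmod_mult Cmod_exp_weight.
  apply: (Rle_trans _ (exp (- (Re z * T)) * (B * exp (w * T)))).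
    by apply: Rmult_le_compat_l; [exact: Rlt_le (exp_pos _)|exact: HB].
  have -> : exp (- (Re z * T)) * (B * exp (w * T)) = B * exp (- (Re z * T) + w * T).
    by rewrite exp_plus; ring.
  by apply: Rmult_le_compat_l => //; apply: exp_le_compat; nra.
have bT : Cmod (Cminus (Cminus X l) (Cmult (exp_weight z T) (CLint K T))) <= e.
  by apply: Rle_trans (norm_minus_le (V := CC) _ _) _; apply: Rle_trans (Rplus_le_compat _ _ _ _ bX bE) _; lra.
have p := Cmod_ge_0 (Cminus (Cminus X l) (Cmult (exp_weight z T) (CLint K T))).
nra.
Qed.

(** Since [p!^s >= p!], each logarithm is at most [ln (rho^p / p!)], and one term of the exponential
    series is at most [exp rho]. *)
Lemma assoc_gevrey_le s rho : 1 <= s -> 0 <= rho -> assoc (gevrey s) rho <= rho.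
Proof.
move=> hs hr; rewrite /assoc; case: Rlt_dec => // h.
have term p : ln (rho ^ p / gevrey s p) <= rho.
  rewrite -{2}(ln_exp rho).
  have f1 : 1 <= INR (Factorial.fact p).
    by rewrite (_ : 1 = INR 1) //; apply: le_INR; have := Factorial.lt_O_fact p; lia.
  have g1 : INR (Factorial.fact p) <= gevrey s p.
    rewrite /gevrey -{1}(Rpower_1 (INR (Factorial.fact p))); last lra.
    by apply: Rle_Rpower.
  have hp : 0 < rho ^ p by apply: pow_lt.
  apply: ln_le; first by apply: Rdiv_lt_0_compat => //; exact: gevrey_pos.
  apply: Rle_trans (exp_series_term rho p hr).
  by apply: Rmult_le_compat_l; [lra|apply: Rinv_le_contravar; lra].
have := Sup_seq_correct (fun p => Finite (ln (rho ^ p / gevrey s p))).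
(* [real] sends an infinite supremum to [0], where the bound is trivial. *)
case: (Sup_seq _) => [r| |] /= H; try lra.
apply: Rnot_lt_le => hlt.
have hd : 0 < r - rho by lra.
have [_ [n Hn]] := H (mkposreal _ hd).
by have := term n; simpl in Hn; lra.
Qed.

Lemma cosine_resolvent (E : CompleteNormedModule C_AbsRing)
    (K : R -> C) (beta : R) (A : linop E) (CK : R -> E -> E) (s k Cbar : R) :
  laplace_transformable K ->
  (forall lambda l : C, beta < Re lambda -> is_laplace K lambda l -> l <> RtoC 0) ->
  closed_linop A -> generates_convoluted_cosine K A CK -> exponentially_bounded CK ->
  1 < s -> 0 < k -> inv_laplace_bigO (gevrey s) K k Cbar ->
  exists C0 N Rs, square_resolvent A C0 N k Rs.
Proof.
move=> HK Hneq Acl [G1 [G2 [G3 G4]]] [M [om [HM Hb]]] hs hk [c Hc].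
have [om1 Hom1] := (proj2 HK).
have [w Hw] := laplace_primitive K HK.
(* [is_laplace] is a relation; a value is chosen wherever the transform exists. *)
pose KL z := epsilon (inhabits (RtoC 0)) (is_laplace K z).
have HKL z : om1 < Re z -> is_laplace K z (KL z).
  by move=> hz; apply: epsilon_spec; exact: Hom1.
(* The shifts by [1] turn [c0 <= Re z] into the strict inequalities needed for convergence and
   nonvanishing. *)
pose c0 := Rmax (om1 + 1) (Rmax (beta + 1) Cbar).
have m1 : om1 + 1 <= c0 := Rmax_l _ _.
have m2 : Rmax (beta + 1) Cbar <= c0 := Rmax_r _ _.
have m3 : beta + 1 <= c0 := Rle_trans _ _ _ (Rmax_l _ _) m2.
have m4 : Cbar <= c0 := Rle_trans _ _ _ (Rmax_r _ _) m2.
have r1 := Rmax_l w om1. have r2 := Rmax_r w om1.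
apply: (@cosine_square_resolvent E (complete_CompleteNormedModule E) A CK M (Rmax om 0)
  (CLint K) KL (Rmax w om1) c0 k (Rabs c)) => //.
- exact: Rmax_r.
- move=> t x ht; apply: Rle_trans (Hb t x ht) _.
  apply: Rmult_le_compat_r; first exact: norm_ge_0.
  apply: Rmult_le_compat_l; first lra.
  by apply: exp_le_compat; apply: Rmult_le_compat_r => //; exact: Rmax_l.
- by move=> z hz; apply: Hw; [lra|apply: HKL; lra].
- by move=> z hz; apply: (Hneq z); [lra|apply: HKL; lra].
- lra.
- exact: Rabs_pos.
- move=> z hz.
  apply: Rle_trans (Hc z (KL z) ltac:(lra) (HKL z ltac:(lra))) _.
  apply: (Rle_trans _ (Rabs c * exp (assoc (gevrey s) (k * Cmod z)))).
    by apply: Rmult_le_compat_r; [exact: Rlt_le (exp_pos _)|exact: Rle_abs].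
  apply: Rmult_le_compat_l; first exact: Rabs_pos.
  apply: exp_le_compat; apply: assoc_gevrey_le; first lra.
  by apply: Rmult_le_pos; [lra|exact: Cmod_ge_0].
Qed.

Theorem theorem19 :
  forall (E : CompleteNormedModule C_AbsRing)
    (K : R -> C) (beta : R) (A : linop E) (CK : R -> E -> E) (s : R),
  laplace_transformable K ->
  Rbar_le (abs_laplace K) (Finite beta) ->
  (forall lambda l : C, beta < Re lambda -> is_laplace K lambda l ->
     l <> RtoC 0) ->
  closed_linop A ->
  generates_convoluted_cosine K A CK ->
  exponentially_bounded CK ->
  1 < s < 2 ->
  ((exists k Cbar : R, 0 < k /\ 0 < Cbar /\
      inv_laplace_bigO (gevrey s) K k Cbar) ->
   (exists G, fundamental_solution Beurling (gevrey s) (scale_linop Ci A) G) /\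
   (exists G, fundamental_solution Beurling (gevrey s)
      (scale_linop (Copp Ci) A) G)) /\
  ((forall k : R, 0 < k -> exists Cbar : R, 0 < Cbar /\
      inv_laplace_bigO (gevrey s) K k Cbar) ->
   (exists G, fundamental_solution Roumieu (gevrey s) (scale_linop Ci A) G) /\
   (exists G, fundamental_solution Roumieu (gevrey s)
      (scale_linop (Copp Ci) A) G)).
Proof.
move=> E K beta A CK s HK _ Hneq Acl HCK Hb hs.
have Ci_sq : Cmult Ci Ci = RtoC (-1).
  by rewrite /Cmult /Ci /RtoC /=; apply: injective_projections => /=; ring.
have Copp_Ci_sq : Cmult (Copp Ci) (Copp Ci) = RtoC (-1).
  by rewrite -Ci_sq; ring.
(* The class [cl] stays a parameter because [sol_fundamental] holds for both, given a resolvent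
   bound with one rate [k]. *)
have key cl k Cbar : 0 < k -> inv_laplace_bigO (gevrey s) K k Cbar ->
   (exists G, fundamental_solution cl (gevrey s) (scale_linop Ci A) G) /\
   (exists G, fundamental_solution cl (gevrey s) (scale_linop (Copp Ci) A) G).
  move=> hk Hinv.
  have [C0 [N [Rs HR]]] := cosine_resolvent E K beta A CK s k Cbar HK Hneq Acl HCK Hb
    (proj1 hs) hk Hinv.
  by split; eexists;
    apply: (@sol_fundamental E (complete_CompleteNormedModule E) A C0 N k Rs Acl HR).
split=> H.
  by have [k [Cbar [hk [_ Hinv]]]] := H; exact: key hk Hinv.
(* The hypothesis is taken at the rate [k = 1]. *)
by have [Cbar [_ Hinv]] := H 1 Rlt_0_1; exact: key Rlt_0_1 Hinv.
Qed.
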